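(* If $\varphi;\Phi;\Gamma\vdash P\triangleleft K$ for an annotated process $P$, all types in $\Gamma$ are reliable under $\varphi;\Phi$, and $P\Rightarrow Q$, then there exists a context $\Gamma'$ with $\varphi;\Phi\vdash\Gamma\longrightarrow^*\Gamma'$ and $\varphi;\Phi;\Gamma'\vdash Q\triangleleft K$.
   Context: Context reduction: $\varphi;\Phi\vdash\Gamma\longrightarrow^*\Gamma'$ holds if either $\Gamma=\Gamma'$, or $\Gamma=\Delta,a:\mathsf{ch}(\tilde T)/U$ and $\Gamma'=\Delta,a:\mathsf{ch}(\tilde T)/U'$ with $\varphi;\Phi\vdash U\longrightarrow^*U'$, or $\Gamma=\Delta,a:\forall\tilde i.\mathsf{serv}^K(\tilde T)/U$ and $\Gamma'=\Delta,a:\forall\tilde i.\mathsf{serv}^K(\tilde T)/U'$ with $\varphi;\Phi\vdash U\longrightarrow^*U'$. INDICES. Index variables $i,j,k$ range over a countable set. Indices: $I ::= \tilde I \mid \infty$, $\tilde I ::= i \mid f(\tilde I,\dots,\tilde I)$, where $f$ ranges over function symbols (containing natural constants, $+$, $\times$, and truncated subtraction) interpreted as functions $\mathbb{N}^k\to\mathbb{N}$; valuations into $\mathbb{N}$ extend to indices with values in $\mathbb{N}\cup\{\infty\}$. Conventions: $\infty+J=\infty$, $\max(\infty,J)=\infty$, $\min(\infty,J)=J$, $\infty-1=\infty$. A constraint is $I\bowtie J$, $\bowtie\in\{\le,<,=,\neq\}$; $\Phi$ is a finite set of constraints on a finite set $\varphi$ of index variables; $\varphi;\Phi\vDash C$ means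 every valuation of $\varphi$ satisfying $\Phi$ satisfies $C$. $\varphi;\Phi\vDash[I,J]\subseteq[I',J']$ means $I'\le I$ and $J\le J'$ are entailed. USAGES. $U,V ::= 0 \mid (U\mid V) \mid \mathsf{in}^{A_o}_{J_c}.U \mid \mathsf{out}^{A_o}_{J_c}.U \mid\ !U \mid U+V$, obligation $A_o=[I,J]$ an interval ($\varphi;\Phi\vDash I\le J$), capacity $J_c$ a single index $J$ (read as $[-\infty,J]$) or an interval. $\alpha^{A_o}_{J_c}$ denotes $\mathsf{in}$ or $\mathsf{out}$; $\mathrm{Lf}([I,J])=I$, $\mathrm{Rt}([I,J])=J$. Congruence $\equiv$: least congruence with $U\mid0\equiv U$, commutativity/associativity of $\mid$, $!0\equiv0$, $!U\equiv\,!U\mid U$, $!(U\mid V)\equiv\,!U\mid!V$, $!!U\equiv\,!U$. $A_o\oplus J=[0,\mathrm{Lf}(A_o)+J]$; $A_o\oplus[I,J]=[\mathrm{Rt}(A_o)+I,\mathrm{Lf}(A_o)+J]$; $[I,J]\sqcup[I',J']=[\max(I,I'),\max(J,J')]$; $[I,J]+[I',J']=[I+I',J+J']$; $[I,J]+J'=[I,J+J']$. Delay: $\uparrow^A0=0$, $\uparrow^A$ distributes over $\mid$, $+$, $!$, and $\uparrow^A\alpha^{B_o}_{J_c}.U=\alpha^{A+B_o}_{J_c}.U$. Reduction $\varphi;\Phi\vdash U\longrightarrow U'$: if $\varphi;\Phi\vDash B_o\subseteq A_o\oplus I_c$ and $\varphi;\Phi\vDash A_o\subseteq B_o\oplus J_c$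 then $\mathsf{in}^{A_o}_{I_c}.U\mid\mathsf{out}^{B_o}_{J_c}.V\longrightarrow\uparrow^{A_o\sqcup B_o}(U\mid V)$, otherwise it $\longrightarrow\mathsf{Error}$; $U+V\longrightarrow U$, $U+V\longrightarrow V$; $U\longrightarrow U'\ne\mathsf{Error}$ gives $U\mid V\longrightarrow U'\mid V$, $U\longrightarrow\mathsf{Error}$ gives $U\mid V\longrightarrow\mathsf{Error}$; closed under $\equiv$. $U$ is reliable if no reduction sequence reaches $\mathsf{Error}$. Subusage $\sqsubseteq$: least relation with $U\sqsubseteq0$; $U_1+U_2\sqsubseteq U_i$; compatible with $+$ (both sides), $\mid$, $!$, prefixes $\alpha^{A_o}_{J_c}.(\cdot)$; closed under $\equiv$ and transitivity; $\alpha^{A_o}_{I_c}.U\sqsubseteq\alpha^{B_o}_{J_c}.U$ when $\varphi;\Phi\vDash B_o\subseteq A_o$ and $I_c\le J_c$ (interval inclusion); $(\alpha^{A_o}_{J_c}.U)\mid(\uparrow^{A_o+J_c}V)\sqsubseteq\alpha^{A_o}_{J_c}.(U\mid V)$. PROCESSES. Expressions $e::=v\mid0\mid s(e)$ ($v$ integer variable or channel name). Processes $P ::= 0\mid P\mid Q\mid\ !a(\tilde v).P\mid a(\tilde v).P\mid\bar a\langle\tilde e\rangle.P\mid(\nu a)P\mid\mathsf{tick}.P\mid\mathsf{match}\ e\ \{0\mapsto P;s(x)\mapsto Q\}$, up to $\alpha$-renaming; annotated processes add $m:P$, $m\in\mathbb{N}$. Congruence: $P\mid0\equiv P$, commutativity/associativity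 of $\mid$, $(\nu a)(\nu b)P\equiv(\nu b)(\nu a)P$, $(\nu a)(P\mid Q)\equiv(\nu a)P\mid Q$ ($a$ not free in $Q$), $0:P\equiv P$, $m:(P\mid Q)\equiv m:P\mid m:Q$, $m:(\nu a)P\equiv(\nu a)(m:P)$, $m:(n:P)\equiv(m+n):P$. Reduction $\Rightarrow$: $(n:a(\tilde v).P)\mid(m:\bar a\langle\tilde e\rangle.Q)\Rightarrow\max(m,n):(P[\tilde v:=\tilde e]\mid Q)$; $(n:!a(\tilde v).P)\mid(m:\bar a\langle\tilde e\rangle.Q)\Rightarrow(n:!a(\tilde v).P)\mid(\max(m,n):(P[\tilde v:=\tilde e]\mid Q))$; $\mathsf{tick}.P\Rightarrow1:P$; $\mathsf{match}\ 0\ \{\dots\}\Rightarrow P$; $\mathsf{match}\ s(e)\ \{\dots\}\Rightarrow Q[x:=e]$; closed under parallel context, $(\nu a)$, $n:(\cdot)$ and $\equiv$. TYPES. $T ::= \mathsf{Nat}[I,J]\mid\mathsf{ch}(\tilde T)/U\mid\forall\tilde i.\mathsf{serv}^K(\tilde T)/U$, $K$ an interval. $\uparrow^AT$ delays the usage (identity on $\mathsf{Nat}$); a type is reliable if it is $\mathsf{Nat}$ or its usage is reliable. $T\mid T'$ combines usages by $\mid$ when the types otherwise coincide ($\mathsf{Nat}[I,J]\mid\mathsf{Nat}[I,J]=\mathsf{Nat}[I,J]$), undefined otherwise; $!T$ replicates the usage ($!\mathsf{Nat}=\mathsf{Nat}$); extended pointwise to contexts. Subtyping: $\mathsf{Nat}[I,J]\le\mathsf{Nat}[I',J']$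 iff $I'\le I$, $J\le J'$ entailed; $\mathsf{ch}(\tilde T)/U\le\mathsf{ch}(\tilde T')/V$ iff $\tilde T\le\tilde T'$, $\tilde T'\le\tilde T$, $U\sqsubseteq V$; servers: $\tilde T\le\tilde T'\le\tilde T$ and $K=K'$ under $\varphi,\tilde i;\Phi$, and $U\sqsubseteq V$; pointwise on contexts. $J;[K_1,K_2]=[0,J+K_2]$, $[\infty,\infty];[K_1,K_2]=[0,0]$, $[\tilde I,J];[K_1,K_2]=[0,J+K_2]$ ($\tilde I\ne\infty$). TYPING under $\varphi;\Phi$. Expressions: variable rule from $\Gamma$; $0:\mathsf{Nat}[0,0]$; $s(e):\mathsf{Nat}[I+1,J+1]$ if $e:\mathsf{Nat}[I,J]$; subtyping ($\Delta\vdash e:T'$, $\Gamma\le\Delta$, $T'\le T$ give $\Gamma\vdash e:T$). Processes: (zero) $\Gamma\vdash0\triangleleft[0,0]$; (par) $\Gamma\vdash P\triangleleft K_1$, $\Delta\vdash Q\triangleleft K_2\Rightarrow\Gamma\mid\Delta\vdash P\mid Q\triangleleft K_1\sqcup K_2$; (tick) $\Gamma\vdash P\triangleleft K\Rightarrow\uparrow^{[1,1]}\Gamma\vdash\mathsf{tick}.P\triangleleft K+[1,1]$; (annot) $\Gamma\vdash P\triangleleft K\Rightarrow\uparrow^{[m,m]}\Gamma\vdash m:P\triangleleft K+[m,m]$; (ich) $\Gamma,a:\mathsf{ch}(\tilde T)/U,\tilde v:\tilde T\vdash P\triangleleft K\Rightarrow\uparrow^{J_c}\Gamma,a:\mathsf{ch}(\tilde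 T)/\mathsf{in}^{[0,0]}_{J_c}.U\vdash a(\tilde v).P\triangleleft J_c;K$; (iserv) $\varphi,\tilde i;\Phi;\Gamma,a:\forall\tilde i.\mathsf{serv}^K(\tilde T)/U,\tilde v:\tilde T\vdash P\triangleleft K\Rightarrow\varphi;\Phi;\uparrow^{J_c}(!\Gamma),a:\forall\tilde i.\mathsf{serv}^K(\tilde T)/!\mathsf{in}^{[0,0]}_{J_c}.U\vdash\ !a(\tilde v).P\triangleleft[0,0]$; (och) $\Gamma',a:\mathsf{ch}(\tilde T)/V\vdash\tilde e:\tilde T$ and $\Gamma,a:\mathsf{ch}(\tilde T)/U\vdash P\triangleleft K\Rightarrow\uparrow^{J_c}(\Gamma\mid\Gamma'),a:\mathsf{ch}(\tilde T)/\mathsf{out}^{[0,0]}_{J_c}.(V\mid U)\vdash\bar a\langle\tilde e\rangle.P\triangleleft J_c;K$; (oserv) $\Gamma',a:\forall\tilde i.\mathsf{serv}^K(\tilde T)/V\vdash\tilde e:\tilde T[\tilde i:=\tilde I]$ and $\Gamma,a:\forall\tilde i.\mathsf{serv}^K(\tilde T)/U\vdash P\triangleleft K'\Rightarrow\uparrow^{J_c}(\Gamma\mid\Gamma'),a:\forall\tilde i.\mathsf{serv}^K(\tilde T)/\mathsf{out}^{[0,0]}_{J_c}.(V\mid U)\vdash\bar a\langle\tilde e\rangle.P\triangleleft J_c;(K'\sqcup K[\tilde i:=\tilde I])$; (case) $\Gamma\vdash e:\mathsf{Nat}[I,J]$, $\varphi;(\Phi,I\le0);\Gamma\vdash P\triangleleft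 K$, $\varphi;(\Phi,J\ge1);\Gamma,x:\mathsf{Nat}[I-1,J-1]\vdash Q\triangleleft K\Rightarrow\Gamma\vdash\mathsf{match}\ e\{0\mapsto P;s(x)\mapsto Q\}\triangleleft K$; (nu) $\Gamma,a:T\vdash P\triangleleft K$ with $T$ reliable $\Rightarrow\Gamma\vdash(\nu a)P\triangleleft K$; (subtype) $\Delta\vdash P\triangleleft K$, $\Gamma\le\Delta$, $K\subseteq K'\Rightarrow\Gamma\vdash P\triangleleft K'$. ($\Gamma,v:T$ means $v$ does not occur in $\Gamma$.) *)

(* Defs.v *)
From mathcomp Require Import all_boot.
From Stdlib Require Relation_Operators List.

Set Implicit Arguments.
Unset Strict Implicit.
Unset Printing Implicit Defensive.

(* Index variables and process variables are both de Bruijn indices, so that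
   all syntax is taken up to renaming of bound variables.  A set of [n] index
   variables is ['I_n]; in the scope [k + n], the variables in the image of
   [lshift] are the [k] innermost ones and those in the image of [rshift] are
   the [n] outer ones.  A process variable (an integer variable or a channel
   name) is a position in the typing context. *)

(* [sym k] is the type of function symbols of arity [k]. *)
Record signature := Signature {
  sym : nat -> Type;
  interp : forall k, sym k -> ('I_k -> nat) -> nat;
  sym_cst : nat -> sym 0;
  sym_add : sym 2;
  sym_mul : sym 2;
  sym_sub : sym 2;
  interp_cst : forall c t, interp (sym_cst c) t = c;
  interp_add : forall t, interp sym_add t = t ord0 + t ord_max;
  interp_mul : forall t, interp sym_mul t = t ord0 * t ord_max;
  interp_sub : forall t, interp sym_sub t = t ord0 - t ord_max
}.

(* [None] is infinity. *)
Definition enat := option nat.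

Definition ele (x y : enat) : bool :=
  match x, y with
  | _, None => true
  | None, Some _ => false
  | Some a, Some b => a <= b
  end.

Section Signature.

Variable S : signature.

Inductive fidx (n : nat) : Type :=
| IVar of 'I_n
| IFun k of sym S k & ('I_k -> fidx n).

Inductive index (n : nat) : Type :=
| Fin of fidx n
| Infty.

Arguments Infty {n}.

Fixpoint feval n (rho : 'I_n -> nat) (t : fidx n) : nat :=
  match t with
  | IVar i => rho i
  | IFun _ f args => interp f (fun j => feval rho (args j))
  end.

Definition ieval n (rho : 'I_n -> nat) (I : index n) : enat :=
  if I is Fin t then Some (feval rho t) else None.

Definition fcst n (c : nat) : fidx n :=
  IFun (sym_cst S c) (fun j => False_rect _ (notF (ltn_ord j))).

Definition fbin n (f : sym S 2) (a b : fidx n) : fidx n :=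
  IFun f (fun j => if j == ord0 then a else b).

Definition icst n (c : nat) : index n := Fin (fcst n c).

Definition iadd n (I J : index n) : index n :=
  match I, J with
  | Fin a, Fin b => Fin (fbin (sym_add S) a b)
  | _, _ => Infty
  end.

(* max(a, b) = a + (b - a) with truncated subtraction. *)
Definition imax n (I J : index n) : index n :=
  match I, J with
  | Fin a, Fin b => Fin (fbin (sym_add S) a (fbin (sym_sub S) b a))
  | _, _ => Infty
  end.

Definition ipred n (I : index n) : index n :=
  if I is Fin a then Fin (fbin (sym_sub S) a (fcst n 1)) else Infty.

Inductive cmp := CLe | CLt | CEq | CNe.

Record constr (n : nat) := Constr { crel : cmp; clhs : index n; crhs : index n }.

Definition csat n (rho : 'I_n -> nat) (C : constr n) : bool :=
  let x := ieval rho (clhs C) in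
  let y := ieval rho (crhs C) in
  match crel C with
  | CLe => ele x y
  | CLt => ~~ ele y x
  | CEq => x == y
  | CNe => x != y
  end.

Definition ile n (I J : index n) : constr n := Constr CLe I J.
Definition ieq n (I J : index n) : constr n := Constr CEq I J.

Definition entails n (Phi : seq (constr n)) (C : constr n) : Prop :=
  forall rho, all (csat rho) Phi -> csat rho C.

(* Substitution of index variables; its values are finite indices, since
   index variables range over [nat]. *)
Fixpoint fsubst n m (s : 'I_n -> fidx m) (t : fidx n) : fidx m :=
  match t with
  | IVar i => s i
  | IFun _ f args => IFun f (fun j => fsubst s (args j))
  end.

Definition isubst n m (s : 'I_n -> fidx m) (I : index n) : index m :=
  if I is Fin t then Fin (fsubst s t) else Infty.

Definition csubst n m (s : 'I_n -> fidx m) (C : constr n) : constr m :=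
  Constr (crel C) (isubst s (clhs C)) (isubst s (crhs C)).

Definition wk k n : 'I_n -> fidx (k + n) := fun i => IVar (rshift k i).

Definition up k n m (s : 'I_n -> fidx m) : 'I_(k + n) -> fidx (k + m) :=
  fun i => match split i with
           | inl j => IVar (lshift m j)
           | inr j => fsubst (@wk k m) (s j)
           end.

Arguments up k {n m} s i.

Definition inst k n (Is : 'I_k -> fidx n) : 'I_(k + n) -> fidx n :=
  fun i => match split i with
           | inl j => Is j
           | inr j => IVar j
           end.

Record itv (n : nat) := Itv { lo : index n; hi : index n }.

(* [CSingle J] is read as the interval from minus infinity to [J]. *)
Inductive capacity (n : nat) : Type :=
| CSingle of index n
| CItv of itv n.

Definition itv_subst n m (s : 'I_n -> fidx m) (A : itv n) : itv m :=
  Itv (isubst s (lo A)) (isubst s (hi A)).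

Definition cap_subst n m (s : 'I_n -> fidx m) (c : capacity n) : capacity m :=
  match c with
  | CSingle J => CSingle (isubst s J)
  | CItv A => CItv (itv_subst s A)
  end.

Definition itv_cst n (c : nat) : itv n := Itv (icst n c) (icst n c).

Definition itv_add n (A B : itv n) : itv n :=
  Itv (iadd (lo A) (lo B)) (iadd (hi A) (hi B)).

Definition itv_addc n (A : itv n) (c : capacity n) : itv n :=
  match c with
  | CSingle J => Itv (lo A) (iadd (hi A) J)
  | CItv B => itv_add A B
  end.

Definition itv_sqcup n (A B : itv n) : itv n :=
  Itv (imax (lo A) (lo B)) (imax (hi A) (hi B)).

(* The result need not be a well-formed interval. *)
Definition itv_oplus n (A : itv n) (c : capacity n) : itv n :=
  match c with
  | CSingle J => Itv (icst n 0) (iadd (lo A) J)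
  | CItv B => Itv (iadd (hi A) (lo B)) (iadd (lo A) (hi B))
  end.

(* Jc; K.  A well-formed interval capacity with an infinite lower bound also
   has an infinite upper bound, unless the constraints are unsatisfiable. *)
Definition cap_seq n (c : capacity n) (K : itv n) : itv n :=
  match c with
  | CSingle J => Itv (icst n 0) (iadd J (hi K))
  | CItv (Itv Infty _) => itv_cst n 0
  | CItv (Itv (Fin _) J) => Itv (icst n 0) (iadd J (hi K))
  end.

Definition itv_incl n (Phi : seq (constr n)) (A B : itv n) : Prop :=
  entails Phi (ile (lo B) (lo A)) /\ entails Phi (ile (hi A) (hi B)).

Definition itv_eq n (Phi : seq (constr n)) (A B : itv n) : Prop :=
  entails Phi (ieq (lo A) (lo B)) /\ entails Phi (ieq (hi A) (hi B)).

(* Inclusion of capacities read as intervals; no index is below minus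
   infinity, hence the third case. *)
Definition cap_incl n (Phi : seq (constr n)) (c d : capacity n) : Prop :=
  match c, d with
  | CSingle J, CSingle J' => entails Phi (ile J J')
  | CItv A, CSingle J => entails Phi (ile (hi A) J)
  | CSingle _, CItv _ => forall rho, ~~ all (csat rho) Phi
  | CItv A, CItv B => itv_incl Phi A B
  end.

Definition wf_itv n (Phi : seq (constr n)) (A : itv n) : Prop :=
  entails Phi (ile (lo A) (hi A)).

Definition wf_cap n (Phi : seq (constr n)) (c : capacity n) : Prop :=
  if c is CItv A then wf_itv Phi A else True.

Inductive action := AIn | AOut.

Inductive usage (n : nat) : Type :=
| UZero
| UPar of usage n & usage n
| UAct of action & itv n & capacity n & usage n
| URep of usage n
| USum of usage n & usage n.

Arguments UZero {n}.

Fixpoint usage_subst n m (s : 'I_n -> fidx m) (U : usage n) : usage m :=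
  match U with
  | UZero => UZero
  | UPar U V => UPar (usage_subst s U) (usage_subst s V)
  | UAct al A c U => UAct al (itv_subst s A) (cap_subst s c) (usage_subst s U)
  | URep U => URep (usage_subst s U)
  | USum U V => USum (usage_subst s U) (usage_subst s V)
  end.

Fixpoint wf_usage n (Phi : seq (constr n)) (U : usage n) : Prop :=
  match U with
  | UZero => True
  | UPar U V | USum U V => wf_usage Phi U /\ wf_usage Phi V
  | UAct _ A c U => [/\ wf_itv Phi A, wf_cap Phi c & wf_usage Phi U]
  | URep U => wf_usage Phi U
  end.

Inductive ucong n : usage n -> usage n -> Prop :=
| UC_refl U : ucong U U
| UC_sym U V : ucong U V -> ucong V U
| UC_trans U V W : ucong U V -> ucong V W -> ucong U W
| UC_par U U' V V' : ucong U U' -> ucong V V' -> ucong (UPar U V) (UPar U' V')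
| UC_act al A c U U' : ucong U U' -> ucong (UAct al A c U) (UAct al A c U')
| UC_rep U U' : ucong U U' -> ucong (URep U) (URep U')
| UC_sum U U' V V' : ucong U U' -> ucong V V' -> ucong (USum U V) (USum U' V')
| UC_par0 U : ucong (UPar U UZero) U
| UC_parC U V : ucong (UPar U V) (UPar V U)
| UC_parA U V W : ucong (UPar U (UPar V W)) (UPar (UPar U V) W)
| UC_rep0 : ucong (URep UZero) UZero
| UC_unfold U : ucong (URep U) (UPar (URep U) U)
| UC_rep_par U V : ucong (URep (UPar U V)) (UPar (URep U) (URep V))
| UC_rep_rep U : ucong (URep (URep U)) (URep U).

(* The delay by an interval A is [delay (CItv A)]; the delay by a single
   capacity J adds J to upper bounds only. *)
Fixpoint delay n (c : capacity n) (U : usage n) : usage n :=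
  match U with
  | UZero => UZero
  | UPar U V => UPar (delay c U) (delay c V)
  | UAct al B d U =>
      UAct al (if c is CItv A then itv_add A B else itv_addc B c) d U
  | URep U => URep (delay c U)
  | USum U V => USum (delay c U) (delay c V)
  end.

Inductive uresult (n : nat) : Type :=
| Ok of usage n
| Error.

Arguments Error {n}.

Definition compatible n (Phi : seq (constr n))
    (A : itv n) (c : capacity n) (B : itv n) (d : capacity n) : Prop :=
  itv_incl Phi B (itv_oplus A c) /\ itv_incl Phi A (itv_oplus B d).

Inductive ustep n (Phi : seq (constr n)) : usage n -> uresult n -> Prop :=
| US_comm A c U B d V :
    compatible Phi A c B d ->
    ustep Phi (UPar (UAct AIn A c U) (UAct AOut B d V))
              (Ok (delay (CItv (itv_sqcup A B)) (UPar U V)))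
| US_error A c U B d V :
    ~ compatible Phi A c B d ->
    ustep Phi (UPar (UAct AIn A c U) (UAct AOut B d V)) Error
| US_suml U V : ustep Phi (USum U V) (Ok U)
| US_sumr U V : ustep Phi (USum U V) (Ok V)
| US_par U U' V :
    ustep Phi U (Ok U') -> ustep Phi (UPar U V) (Ok (UPar U' V))
| US_par_error U V : ustep Phi U Error -> ustep Phi (UPar U V) Error
| US_cong U U1 V1 V :
    ucong U U1 -> ustep Phi U1 (Ok V1) -> ucong V1 V -> ustep Phi U (Ok V)
| US_cong_error U U1 : ucong U U1 -> ustep Phi U1 Error -> ustep Phi U Error.

Definition usteps n (Phi : seq (constr n)) : usage n -> usage n -> Prop :=
  Relation_Operators.clos_refl_trans _ (fun U V => ustep Phi U (Ok V)).

Definition reliable n (Phi : seq (constr n)) (U : usage n) : Prop :=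
  ~ exists2 V, usteps Phi U V & ustep Phi V Error.

(* The [wf] premises keep usages well-formed: from a well-formed usage only
   well-formed ones are reached. *)
Inductive subusage n (Phi : seq (constr n)) : usage n -> usage n -> Prop :=
| SU_zero U : subusage Phi U UZero
| SU_suml U V : subusage Phi (USum U V) U
| SU_sumr U V : subusage Phi (USum U V) V
| SU_compat_suml U U' V :
    subusage Phi U U' -> subusage Phi (USum U V) (USum U' V)
| SU_compat_sumr U V V' :
    subusage Phi V V' -> subusage Phi (USum U V) (USum U V')
| SU_compat_par U U' V :
    subusage Phi U U' -> subusage Phi (UPar U V) (UPar U' V)
| SU_compat_rep U U' : subusage Phi U U' -> subusage Phi (URep U) (URep U')
| SU_compat_act al A c U U' :
    subusage Phi U U' -> subusage Phi (UAct al A c U) (UAct al A c U')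
| SU_cong U U1 V1 V :
    ucong U U1 -> subusage Phi U1 V1 -> ucong V1 V -> subusage Phi U V
| SU_trans U V W : subusage Phi U V -> subusage Phi V W -> subusage Phi U W
| SU_act al A c B d U :
    wf_itv Phi B -> wf_cap Phi d ->
    itv_incl Phi B A -> cap_incl Phi c d ->
    subusage Phi (UAct al A c U) (UAct al B d U)
| SU_delay al A c U V :
    wf_usage Phi V ->
    subusage Phi (UPar (UAct al A c U) (delay (CItv (itv_addc A c)) V))
                 (UAct al A c (UPar U V)).

(* In [TServ k K Ts U] the [k] index variables are bound in [K] and [Ts] but
   not in [U]. *)
Inductive type (n : nat) : Type :=
| TNat of index n & index n
| TCh of seq (type n) & usage n
| TServ k of itv (k + n) & seq (type (k + n)) & usage n.

Fixpoint tsubst n m (s : 'I_n -> fidx m) (T : type n) : type m :=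
  match T with
  | TNat J1 J2 => TNat (isubst s J1) (isubst s J2)
  | TCh Ts U => TCh (map (tsubst s) Ts) (usage_subst s U)
  | TServ k K Ts U =>
      TServ (itv_subst (up k s) K) (map (tsubst (up k s)) Ts) (usage_subst s U)
  end.

Definition cwk k n (Phi : seq (constr n)) : seq (constr (k + n)) :=
  map (csubst (@wk k n)) Phi.

Inductive wf_type : forall n, seq (constr n) -> type n -> Prop :=
| WF_nat n (Phi : seq (constr n)) I J : wf_type Phi (TNat I J)
| WF_ch n (Phi : seq (constr n)) Ts U :
    List.Forall (wf_type Phi) Ts -> wf_usage Phi U -> wf_type Phi (TCh Ts U)
| WF_serv n (Phi : seq (constr n)) k (K : itv (k + n)) Ts U :
    wf_itv (cwk k Phi) K -> List.Forall (wf_type (cwk k Phi)) Ts ->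
    wf_usage Phi U -> wf_type Phi (TServ K Ts U).

Definition map_usage n (f : usage n -> usage n) (T : type n) : type n :=
  match T with
  | TNat J1 J2 => TNat J1 J2
  | TCh Ts U => TCh Ts (f U)
  | TServ k K Ts U => TServ K Ts (f U)
  end.

Definition reliable_type n (Phi : seq (constr n)) (T : type n) : Prop :=
  match T with
  | TNat _ _ => True
  | TCh _ U | TServ _ _ _ U => reliable Phi U
  end.

(* Parallel composition of types as a relation, because it is partial:
   [tpar T1 T2 T] says that T1 | T2 is defined and is T. *)
Inductive tpar n : type n -> type n -> type n -> Prop :=
| TP_nat I J : tpar (TNat I J) (TNat I J) (TNat I J)
| TP_ch Ts U V : tpar (TCh Ts U) (TCh Ts V) (TCh Ts (UPar U V))
| TP_serv k (K : itv (k + n)) Ts U V :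
    tpar (TServ K Ts U) (TServ K Ts V) (TServ K Ts (UPar U V)).

Inductive subtype : forall n, seq (constr n) -> type n -> type n -> Prop :=
| ST_nat n (Phi : seq (constr n)) I J I' J' :
    entails Phi (ile I' I) -> entails Phi (ile J J') ->
    subtype Phi (TNat I J) (TNat I' J')
| ST_ch n (Phi : seq (constr n)) Ts Ts' U V :
    subtypes Phi Ts Ts' -> subtypes Phi Ts' Ts -> subusage Phi U V ->
    subtype Phi (TCh Ts U) (TCh Ts' V)
| ST_serv n (Phi : seq (constr n)) k (K K' : itv (k + n)) Ts Ts' U V :
    subtypes (cwk k Phi) Ts Ts' -> subtypes (cwk k Phi) Ts' Ts ->
    itv_eq (cwk k Phi) K K' -> subusage Phi U V ->
    subtype Phi (TServ K Ts U) (TServ K' Ts' V)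
with subtypes : forall n, seq (constr n) -> seq (type n) -> seq (type n) -> Prop :=
| ST_nil n (Phi : seq (constr n)) : subtypes Phi [::] [::]
| ST_cons n (Phi : seq (constr n)) T T' Ts Ts' :
    subtype Phi T T' -> subtypes Phi Ts Ts' ->
    subtypes Phi (T :: Ts) (T' :: Ts').

Definition ctx (n : nat) := seq (type n).

Definition wf_ctx n (Phi : seq (constr n)) (Gamma : ctx n) : Prop :=
  List.Forall (wf_type Phi) Gamma.

Definition reliable_ctx n (Phi : seq (constr n)) (Gamma : ctx n) : Prop :=
  List.Forall (reliable_type Phi) Gamma.

Definition cdelay n (c : capacity n) (Gamma : ctx n) : ctx n :=
  map (map_usage (delay c)) Gamma.

Definition crep n (Gamma : ctx n) : ctx n := map (map_usage (@URep n)) Gamma.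

Inductive cpar n : ctx n -> ctx n -> ctx n -> Prop :=
| CP_nil : cpar [::] [::] [::]
| CP_cons T1 T2 T Gamma1 Gamma2 Gamma :
    tpar T1 T2 T -> cpar Gamma1 Gamma2 Gamma ->
    cpar (T1 :: Gamma1) (T2 :: Gamma2) (T :: Gamma).

(* [ins a T Gamma] is the context "Gamma, a : T", where Gamma has no entry for
   [a]: its entries after position [a] are moved one position further. *)
Definition ins n (a : nat) (T : type n) (Gamma : ctx n) : ctx n :=
  take a Gamma ++ T :: drop a Gamma.

Inductive ctx_steps n (Phi : seq (constr n)) : ctx n -> ctx n -> Prop :=
| CS_refl Gamma : ctx_steps Phi Gamma Gamma
| CS_ch Delta a Ts U U' :
    a <= size Delta -> usteps Phi U U' ->
    ctx_steps Phi (ins a (TCh Ts U) Delta) (ins a (TCh Ts U') Delta)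
| CS_serv Delta a k (K : itv (k + n)) Ts U U' :
    a <= size Delta -> usteps Phi U U' ->
    ctx_steps Phi (ins a (TServ K Ts U) Delta) (ins a (TServ K Ts U') Delta).

Inductive expr :=
| EVar of nat
| EZero
| ESucc of expr.

(* [PServ a k P] and [PIn a k P] bind [k] variables in [P]; [PNu P] binds one
   in [P]; [PMatch e P Q] binds one in [Q]. *)
Inductive proc :=
| PZero
| PPar of proc & proc
| PServ of nat & nat & proc
| PIn of nat & nat & proc
| POut of nat & seq expr & proc
| PNu of proc
| PTick of proc
| PMatch of expr & proc & proc
| PAnnot of nat & proc.

Fixpoint esubst (s : nat -> expr) (e : expr) : expr :=
  match e with
  | EVar x => s x
  | EZero => EZero
  | ESucc e => ESucc (esubst s e)
  end.

Definition upr k (r : nat -> nat) (x : nat) : nat :=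
  if x < k then x else k + r (x - k).

Definition ups k (s : nat -> expr) (x : nat) : expr :=
  if x < k then EVar x else esubst (fun y => EVar (k + y)) (s (x - k)).

Fixpoint pren (r : nat -> nat) (P : proc) : proc :=
  let eren := esubst (fun x => EVar (r x)) in
  match P with
  | PZero => PZero
  | PPar P Q => PPar (pren r P) (pren r Q)
  | PServ a k P => PServ (r a) k (pren (upr k r) P)
  | PIn a k P => PIn (r a) k (pren (upr k r) P)
  | POut a es P => POut (r a) (map eren es) (pren r P)
  | PNu P => PNu (pren (upr 1 r) P)
  | PTick P => PTick (pren r P)
  | PMatch e P Q => PMatch (eren e) (pren r P) (pren (upr 1 r) Q)
  | PAnnot m P => PAnnot m (pren r P)
  end.

(* Undefined when a name in subject position would be replaced by an
   expression that is not a name. *)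
Fixpoint psubst (s : nat -> expr) (P : proc) : option proc :=
  match P with
  | PZero => Some PZero
  | PPar P Q =>
      if (psubst s P, psubst s Q) is (Some P', Some Q')
      then Some (PPar P' Q') else None
  | PServ a k P =>
      if (s a, psubst (ups k s) P) is (EVar b, Some P')
      then Some (PServ b k P') else None
  | PIn a k P =>
      if (s a, psubst (ups k s) P) is (EVar b, Some P')
      then Some (PIn b k P') else None
  | POut a es P =>
      if (s a, psubst s P) is (EVar b, Some P')
      then Some (POut b (map (esubst s) es) P') else None
  | PNu P => omap PNu (psubst (ups 1 s) P)
  | PTick P => omap PTick (psubst s P)
  | PMatch e P Q =>
      if (psubst s P, psubst (ups 1 s) Q) is (Some P', Some Q')
      then Some (PMatch (esubst s e) P' Q') else None
  | PAnnot m P => omap (PAnnot m) (psubst s P)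
  end.

Definition einst (es : seq expr) (x : nat) : expr :=
  if x < size es then nth EZero es x else EVar (x - size es).

Definition swap01 (x : nat) : nat :=
  match x with 0 => 1 | 1 => 0 | _ => x end.

Inductive pcong : proc -> proc -> Prop :=
| PC_refl P : pcong P P
| PC_sym P Q : pcong P Q -> pcong Q P
| PC_trans P Q R : pcong P Q -> pcong Q R -> pcong P R
| PC_par P P' Q Q' : pcong P P' -> pcong Q Q' -> pcong (PPar P Q) (PPar P' Q')
| PC_serv a k P P' : pcong P P' -> pcong (PServ a k P) (PServ a k P')
| PC_in a k P P' : pcong P P' -> pcong (PIn a k P) (PIn a k P')
| PC_out a es P P' : pcong P P' -> pcong (POut a es P) (POut a es P')
| PC_nu P P' : pcong P P' -> pcong (PNu P) (PNu P')
| PC_tick P P' : pcong P P' -> pcong (PTick P) (PTick P')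
| PC_match e P P' Q Q' :
    pcong P P' -> pcong Q Q' -> pcong (PMatch e P Q) (PMatch e P' Q')
| PC_annot m P P' : pcong P P' -> pcong (PAnnot m P) (PAnnot m P')
| PC_par0 P : pcong (PPar P PZero) P
| PC_parC P Q : pcong (PPar P Q) (PPar Q P)
| PC_parA P Q R : pcong (PPar P (PPar Q R)) (PPar (PPar P Q) R)
| PC_nu_nu P : pcong (PNu (PNu P)) (PNu (PNu (pren swap01 P)))
| PC_nu_par P Q : pcong (PNu (PPar P (pren succn Q))) (PPar (PNu P) Q)
| PC_annot0 P : pcong (PAnnot 0 P) P
| PC_annot_par m P Q :
    pcong (PAnnot m (PPar P Q)) (PPar (PAnnot m P) (PAnnot m Q))
| PC_annot_nu m P : pcong (PAnnot m (PNu P)) (PNu (PAnnot m P))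
| PC_annot_annot m n P : pcong (PAnnot m (PAnnot n P)) (PAnnot (m + n) P).

Inductive pstep : proc -> proc -> Prop :=
| PS_comm n m a k P P' es Q :
    size es = k -> psubst (einst es) P = Some P' ->
    pstep (PPar (PAnnot n (PIn a k P)) (PAnnot m (POut a es Q)))
          (PAnnot (maxn m n) (PPar P' Q))
| PS_serv n m a k P P' es Q :
    size es = k -> psubst (einst es) P = Some P' ->
    pstep (PPar (PAnnot n (PServ a k P)) (PAnnot m (POut a es Q)))
          (PPar (PAnnot n (PServ a k P)) (PAnnot (maxn m n) (PPar P' Q)))
| PS_tick P : pstep (PTick P) (PAnnot 1 P)
| PS_match0 P Q : pstep (PMatch EZero P Q) P
| PS_matchS e P Q Q' :
    psubst (einst [:: e]) Q = Some Q' -> pstep (PMatch (ESucc e) P Q) Q'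
| PS_par P P' Q : pstep P P' -> pstep (PPar P Q) (PPar P' Q)
| PS_nu P P' : pstep P P' -> pstep (PNu P) (PNu P')
| PS_annot n P P' : pstep P P' -> pstep (PAnnot n P) (PAnnot n P')
| PS_cong P P1 Q1 Q : pcong P P1 -> pstep P1 Q1 -> pcong Q1 Q -> pstep P Q.

(* In both typing judgements the [wf] premises ensure that the contexts, types
   and complexity bounds of derivable judgements are well-formed, i.e. that
   every obligation, interval capacity and complexity [I, J] satisfies
   I <= J under the constraints. *)

Inductive etyping n (Phi : seq (constr n)) : ctx n -> expr -> type n -> Prop :=
| ET_var Gamma v T :
    wf_ctx Phi Gamma -> onth Gamma v = Some T -> etyping Phi Gamma (EVar v) T
| ET_zero Gamma :
    wf_ctx Phi Gamma -> etyping Phi Gamma EZero (TNat (icst n 0) (icst n 0))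
| ET_succ Gamma e I J :
    etyping Phi Gamma e (TNat I J) ->
    etyping Phi Gamma (ESucc e) (TNat (iadd I (icst n 1)) (iadd J (icst n 1)))
| ET_sub Gamma Delta e T T' :
    wf_ctx Phi Gamma -> wf_type Phi T ->
    etyping Phi Delta e T' -> subtypes Phi Gamma Delta -> subtype Phi T' T ->
    etyping Phi Gamma e T.

(* In a tuple of expressions, the usages of the context are shared out among
   the components. *)
Inductive etypings n (Phi : seq (constr n)) :
    ctx n -> seq expr -> seq (type n) -> Prop :=
| ETS_nil Gamma : wf_ctx Phi Gamma -> etypings Phi Gamma [::] [::]
| ETS_cons Gamma1 Gamma2 Gamma e es T Ts :
    cpar Gamma1 Gamma2 Gamma ->
    etyping Phi Gamma1 e T -> etypings Phi Gamma2 es Ts ->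
    etypings Phi Gamma (e :: es) (T :: Ts).

Inductive typing : forall n, seq (constr n) -> ctx n -> proc -> itv n -> Prop :=
| Ty_zero n (Phi : seq (constr n)) Gamma :
    wf_ctx Phi Gamma -> typing Phi Gamma PZero (itv_cst n 0)
| Ty_par n (Phi : seq (constr n)) Gamma Delta Theta P Q K1 K2 :
    cpar Gamma Delta Theta -> typing Phi Gamma P K1 -> typing Phi Delta Q K2 ->
    typing Phi Theta (PPar P Q) (itv_sqcup K1 K2)
| Ty_tick n (Phi : seq (constr n)) Gamma P K :
    typing Phi Gamma P K ->
    typing Phi (cdelay (CItv (itv_cst n 1)) Gamma) (PTick P)
      (itv_add K (itv_cst n 1))
| Ty_annot n (Phi : seq (constr n)) Gamma m P K :
    typing Phi Gamma P K ->
    typing Phi (cdelay (CItv (itv_cst n m)) Gamma) (PAnnot m P)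
      (itv_add K (itv_cst n m))
| Ty_ich n (Phi : seq (constr n)) Gamma a Ts U Jc P K :
    a <= size Gamma -> wf_cap Phi Jc ->
    typing Phi (Ts ++ ins a (TCh Ts U) Gamma) P K ->
    typing Phi
      (ins a (TCh Ts (UAct AIn (itv_cst n 0) Jc U)) (cdelay Jc Gamma))
      (PIn a (size Ts) P) (cap_seq Jc K)
| Ty_iserv n (Phi : seq (constr n)) Gamma a k (K : itv (k + n)) Ts U Jc P :
    a <= size Gamma -> wf_cap Phi Jc ->
    typing (cwk k Phi)
      (Ts ++ map (tsubst (@wk k n)) (ins a (TServ K Ts U) Gamma)) P K ->
    typing Phi
      (ins a (TServ K Ts (URep (UAct AIn (itv_cst n 0) Jc U)))
         (cdelay Jc (crep Gamma)))
      (PServ a (size Ts) P) (itv_cst n 0)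
| Ty_och n (Phi : seq (constr n)) Gamma Gamma' Delta a Ts V U Jc es P K :
    a <= size Delta -> wf_cap Phi Jc -> cpar Gamma Gamma' Delta ->
    etypings Phi (ins a (TCh Ts V) Gamma') es Ts ->
    typing Phi (ins a (TCh Ts U) Gamma) P K ->
    typing Phi
      (ins a (TCh Ts (UAct AOut (itv_cst n 0) Jc (UPar V U))) (cdelay Jc Delta))
      (POut a es P) (cap_seq Jc K)
| Ty_oserv n (Phi : seq (constr n)) Gamma Gamma' Delta a
    k (K : itv (k + n)) Ts V U (Is : 'I_k -> fidx n) Jc es P K' :
    a <= size Delta -> wf_cap Phi Jc -> cpar Gamma Gamma' Delta ->
    etypings Phi (ins a (TServ K Ts V) Gamma') es (map (tsubst (inst Is)) Ts) ->
    typing Phi (ins a (TServ K Ts U) Gamma) P K' ->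
    typing Phi
      (ins a (TServ K Ts (UAct AOut (itv_cst n 0) Jc (UPar V U)))
         (cdelay Jc Delta))
      (POut a es P) (cap_seq Jc (itv_sqcup K' (itv_subst (inst Is) K)))
| Ty_case n (Phi : seq (constr n)) Gamma e I J P Q K :
    wf_itv Phi K ->
    etyping Phi Gamma e (TNat I J) ->
    typing (ile I (icst n 0) :: Phi) Gamma P K ->
    typing (ile (icst n 1) J :: Phi) (TNat (ipred I) (ipred J) :: Gamma) Q K ->
    typing Phi Gamma (PMatch e P Q) K
| Ty_nu n (Phi : seq (constr n)) Gamma T P K :
    reliable_type Phi T -> typing Phi (T :: Gamma) P K ->
    typing Phi Gamma (PNu P) K
| Ty_sub n (Phi : seq (constr n)) Gamma Delta P K K' :
    wf_ctx Phi Gamma ->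
    typing Phi Delta P K -> subtypes Phi Gamma Delta -> itv_incl Phi K K' ->
    typing Phi Gamma P K'.

End Signature.

Arguments Infty {S n}.
Arguments UZero {S n}.
Arguments Error {S n}.

(* Main.v *)
(** Usages.  Subusage is a simulation: if [U] is a subusage of [V] and [V] offers
    an action, then [U] offers one with a larger obligation and a smaller
    capacity, and the remaining usages are related once a compatible partner has
    been met.  Hence reliability is inherited along subusage, and likewise along
    delays by a constant (in both directions) and along index substitution.

    Types.  A typing context splits into its types with the usages erased, which
    subtyping relates symmetrically except for the bounds of [Nat], and a usage
    for each variable.  Typing is equivalent to a syntax-directed judgement in
    which subtyping is built into each rule.  A process substitution acts on the
    usages by sending that of a name [b] to the composition of the usages of all
    variables mapped to [b]; the rule that moves a delayed usage under a prefix
    makes the typing of a prefix survive such a merging of names.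

    Reduction.  In a communication between an input delayed by [n] and an output
    delayed by [m], reliability makes the two prefixes compatible, so both fire
    within their capacity at time [max m n]; this bounds both the delays of the
    other names and the complexities of the two continuations. *)

From mathcomp Require Import all_boot zify.
From Stdlib Require Import FunctionalExtensionality Classical.
From Stdlib Require Import Relation_Operators.
Require Import Defs.

Set Implicit Arguments.
Unset Strict Implicit.
Unset Printing Implicit Defensive.

(** * Semantics of indices and intervals *)

(** [subusage] and [ustep] are closed under congruence, and [subusage] also under transitivity, so a
    case analysis on the last rule tells little about the shape of the usages. Prefixes are
    therefore exposed by [extract], which follows the syntax, and congruence is dealt with there
    once and for all. The delicate axiom is [SU_delay]: what stands beside a prefix on the left may
    stand behind it on the right. Putting it back is sound only if the prefix fires within its
    capacity, which is known only for a compatible partner; this is why the simulations carry a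
    condition on the partner and transfer reliability rather than bare reductions. Usages are kept
    in a function [nat -> usage] beside the context because substitution may identify names. Merging
    is then a finite composition of values of that function, whereas composing contexts with [cpar]
    would require argument types to be identical, and those of merged names agree only up to
    subtyping. The judgement [ty] is a fixpoint on processes that quantifies over the index scope,
    since the body of a server lives in an extended scope. *)

Section IndexSemantics.
Variable S : signature.

Definition eadd (x y : enat) : enat :=
  match x, y with Some a, Some b => Some (a + b) | _, _ => None end.
Definition emax (x y : enat) : enat :=
  match x, y with Some a, Some b => Some (maxn a b) | _, _ => None end.
Definition epred (x : enat) : enat := omap predn x.

Lemma ieval_cst n rho c : ieval rho (icst S n c) = Some c.
Proof. by rewrite /= interp_cst. Qed.

Lemma ieval_add n rho (I J : index S n) :
  ieval rho (iadd I J) = eadd (ieval rho I) (ieval rho J).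
Proof. by case: I J => [a|] [b|] //=; rewrite interp_add. Qed.

Lemma ieval_max n rho (I J : index S n) :
  ieval rho (imax I J) = emax (ieval rho I) (ieval rho J).
Proof. by case: I J => [a|] [b|] //=; rewrite interp_add /= interp_sub /= maxnE. Qed.

Lemma ieval_pred n rho (I : index S n) : ieval rho (ipred I) = epred (ieval rho I).
Proof. by case: I => [a|] //=; rewrite interp_sub /= interp_cst subn1. Qed.

Lemma feval_subst n m (s : 'I_n -> fidx S m) rho t :
  feval rho (fsubst s t) = feval (fun i => feval rho (s i)) t.
Proof.
elim: t => //= k f args IH; congr interp.
by apply: functional_extensionality => j.
Qed.

Lemma ieval_subst n m (s : 'I_n -> fidx S m) rho I :
  ieval rho (isubst s I) = ieval (fun i => feval rho (s i)) I.
Proof. by case: I => //= t; rewrite feval_subst. Qed.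

Lemma ieval_infty n (rho : 'I_n -> nat) : ieval rho (@Infty S n) = None.
Proof. by []. Qed.

End IndexSemantics.

Definition ievalE := (ieval_infty, ieval_cst, ieval_add, ieval_max, ieval_pred, ieval_subst).

Lemma csat_ile S n rho (I J : index S n) :
  csat rho (ile I J) = ele (ieval rho I) (ieval rho J).
Proof. by []. Qed.

Lemma csat_ieq S n rho (I J : index S n) :
  csat rho (ieq I J) = (ieval rho I == ieval rho J).
Proof. by []. Qed.

(** Entailment is semantic, so it suffices to argue at one valuation: index operations are evaluated
    to operations on [enat], and a split into finite and infinite values leaves linear arithmetic
    over [nat]. *)
Ltac index_arith_open := 
  repeat match goal with
  | c : capacity _ _ |- _ => destruct c as [?|[? ?]]
  | A : itv _ _ |- _ => destruct A as [? ?]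
  end;
  cbv beta iota delta [compatible itv_incl itv_eq wf_itv wf_cap cap_incl entails
    itv_oplus itv_add itv_addc itv_sqcup itv_cst itv_subst cap_subst lo hi] in *;
  repeat match goal with
  | h : _ /\ _ |- _ => destruct h
  | h : and3 _ _ _ |- _ => destruct h
  | |- _ /\ _ => split
  | |- and3 _ _ _ => split
  end;
  try (let rho := fresh "rho" in let hr := fresh "hr" in
  intros rho hr;
  repeat match goal with
  | h : forall r, is_true (all (csat r) _) -> _ |- _ => specialize (h rho hr)
  (* Inclusion of a single capacity in an interval says that no valuation satisfies the constraints,
     which refutes the current one. *)
  | h : forall r, is_true (~~ all (csat r) _) |- _ =>
     specialize (h rho); rewrite hr in h
  end; clear hr);
  repeat match goal with h : is_true _ |- _ => revert h end;
  rewrite ?csat_ile ?csat_ieq ?ievalE.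

Ltac index_arith_clean :=
  cbn [ele eadd emax epred omap Option.map Option.bind Option.apply] in *;
  repeat match goal with
  | h : is_true false |- _ => discriminate h
  | h : is_true true |- _ => clear h
  end.

Ltac index_arith_cases :=
  intros;
  repeat match goal with
  | h : context [ieval ?r ?X] |- _ =>
      destruct (ieval r X) in *; index_arith_clean
  | |- context [ieval ?r ?X] =>
      destruct (ieval r X) in *; index_arith_clean
  end; rewrite ?eqE /=; try (by []); try lia.

Ltac index_arith := index_arith_open; index_arith_cases.

(** The arithmetic behind [SU_delay]: a prefix with obligation [A] and a partner [C] within
    [itv_oplus A c] fires at [itv_sqcup A C], which stays within [itv_addc A c]. For an interval
    capacity the lower bound uses [lo A <= hi A], since [itv_oplus] starts from [hi A]. *)
Lemma compat_sqcup S n (Phi : seq (constr S n)) A c C :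
  wf_itv Phi A -> wf_itv Phi C -> itv_incl Phi C (itv_oplus A c) ->
  itv_incl Phi (itv_sqcup A C) (itv_addc A c).
Proof. move=> h1 h2 h3. index_arith. Qed.


Section Intervals.
Variable S : signature.
Variables (n : nat) (Phi : seq (constr S n)).
Implicit Types A B C : itv S n.

Lemma itv_incl_refl A : itv_incl Phi A A.
Proof. index_arith. Qed.

Lemma itv_incl_trans A B C : itv_incl Phi A B -> itv_incl Phi B C -> itv_incl Phi A C.
Proof. move=> h1 h2. index_arith. Qed.

Lemma cap_incl_refl c : cap_incl Phi c c.
Proof. index_arith. Qed.

Lemma cap_incl_trans c d e : cap_incl Phi c d -> cap_incl Phi d e -> cap_incl Phi c e.
Proof. move=> h1 h2. case: c d e h1 h2 => [?|?] [?|?] [?|?] h1 h2; index_arith. Qed.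

(** [itv_oplus] reads the ends of the obligation crosswise, hence shrinks when the obligation
    grows. *)
Lemma itv_oplus_mono A A' c c' :
  itv_incl Phi A A' -> cap_incl Phi c' c ->
  itv_incl Phi (itv_oplus A' c') (itv_oplus A c).
Proof. move=> h1 h2. index_arith. Qed.

Lemma compat_mono A c B d A' c' B' d' :
  itv_incl Phi A A' -> itv_incl Phi B B' -> cap_incl Phi c' c -> cap_incl Phi d' d ->
  compatible Phi A' c' B' d' -> compatible Phi A c B d.
Proof.
move=> hA hB hc hd [h1 h2]; split.
  apply: itv_incl_trans hB (itv_incl_trans h1 _); exact: itv_oplus_mono.
apply: itv_incl_trans hA (itv_incl_trans h2 _); exact: itv_oplus_mono.
Qed.

Lemma itv_incl_wf A B : wf_itv Phi A -> itv_incl Phi A B -> wf_itv Phi B.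
Proof. move=> h1 h2. index_arith. Qed.

Lemma sqcup_wf A B : wf_itv Phi A -> wf_itv Phi B -> wf_itv Phi (itv_sqcup A B).
Proof. move=> h1 h2. index_arith. Qed.

Lemma sqcup_incl A A' B B' :
  itv_incl Phi A A' -> itv_incl Phi B B' ->
  itv_incl Phi (itv_sqcup A B) (itv_sqcup A' B').
Proof. move=> h1 h2. index_arith. Qed.

Lemma sqcupC_incl A B : itv_incl Phi (itv_sqcup A B) (itv_sqcup B A).
Proof. index_arith. Qed.

End Intervals.

(** * Usages and subusage *)

Section Usages.
Variable S : signature.
Variable n : nat.
Implicit Types (A B C : itv S n) (U V W X : usage S n) (c d : capacity S n).

(** Delay generalized to any function on head obligations. Two nested delays are not syntactically
    one delay, but they are one [map_obl] of a composite function and can be compared pointwise by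
    [map_obl_le]. *)
Fixpoint map_obl (F : itv S n -> itv S n) U : usage S n :=
  match U with
  | UZero => UZero
  | UPar U V => UPar (map_obl F U) (map_obl F V)
  | UAct al B d U => UAct al (F B) d U
  | URep U => URep (map_obl F U)
  | USum U V => USum (map_obl F U) (map_obl F V)
  end.

Definition itv_shift c B := if c is CItv A then itv_add A B else itv_addc B c.

Lemma delayE c U : delay c U = map_obl (itv_shift c) U.
Proof. by elim: U => //= [U -> V ->|U ->|U -> V ->]. Qed.

Lemma map_obl_comp F G U : map_obl F (map_obl G U) = map_obl (F \o G) U.
Proof. by elim: U => //= [U -> V ->|U ->|U -> V ->]. Qed.

Lemma delay_comp c d U : delay c (delay d U) = map_obl (itv_shift c \o itv_shift d) U.
Proof. by rewrite !delayE map_obl_comp. Qed.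

Lemma map_obl_id U : map_obl id U = U.
Proof. by elim: U => //= [U -> V ->|U ->|U -> V ->]. Qed.

Lemma map_obl_ucong F U V : ucong U V -> ucong (map_obl F U) (map_obl F V).
Proof. by elim=> /=; eauto using ucong. Qed.

Lemma delay_ucong c U V : ucong U V -> ucong (delay c U) (delay c V).
Proof. rewrite !delayE; exact: map_obl_ucong. Qed.

(** Unfold the outer replication of [URep (URep U)], which is congruent to [URep U]. *)
Lemma URep_dup U : ucong (URep U) (UPar (URep U) (URep U)).
Proof.
apply: UC_trans (UC_sym (UC_rep_rep _)) _.
apply: UC_trans (UC_unfold _) _.
apply: UC_par (UC_refl _); exact: UC_rep_rep.
Qed.

Lemma UPar0l U : ucong (UPar UZero U) U.
Proof. exact: UC_trans (UC_parC _ _) (UC_par0 _). Qed.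

Lemma UParACA U V W X :
  ucong (UPar (UPar U V) (UPar W X)) (UPar (UPar U W) (UPar V X)).
Proof.
apply: UC_trans (UC_parA _ _ _) _; apply: UC_trans _ (UC_sym (UC_parA _ _ _)).
apply: UC_par (UC_refl _).
apply: UC_trans (UC_sym (UC_parA _ _ _)) _; apply: UC_trans _ (UC_parA _ _ _).
apply: UC_par (UC_refl _) _; exact: UC_parC.
Qed.

Lemma UParAC U V W : ucong (UPar (UPar U V) W) (UPar (UPar U W) V).
Proof.
apply: UC_trans (UC_sym (UC_parA _ _ _)) _; apply: UC_trans _ (UC_parA _ _ _).
exact: UC_par (UC_refl _) (UC_parC _ _).
Qed.

Section Subusage.
Variable Phi : seq (constr S n).
Local Notation "U <<= V" := (subusage Phi U V) (at level 70).
Local Notation wf := (wf_usage Phi).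

Lemma subusage_refl U : U <<= U.
Proof. by elim: U => *; constructor. Qed.

Lemma ucong_sub U V : ucong U V -> U <<= V.
Proof. move=> h; exact: SU_cong h (subusage_refl _) (UC_refl _). Qed.

Lemma ucong_sub_r U V : ucong U V -> V <<= U.
Proof. move=> h; apply: ucong_sub; exact: UC_sym. Qed.

Lemma subusage_par U U' V V' : U <<= U' -> V <<= V' -> UPar U V <<= UPar U' V'.
Proof.
move=> hU hV; apply: (SU_trans (SU_compat_par V hU)).
apply: SU_cong (UC_parC _ _) _ (UC_parC _ _); exact: SU_compat_par.
Qed.

Lemma subusage_parl U V : UPar U V <<= U.
Proof.
apply: (SU_trans (subusage_par (subusage_refl U) (SU_zero _ V))).
exact/ucong_sub/UC_par0.
Qed.

Lemma wf_map_obl F U : (forall A, wf_itv Phi A -> wf_itv Phi (F A)) ->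
  wf U -> wf (map_obl F U).
Proof.
move=> hF; elim: U => //= [U IU V IV [/IU hU /IV hV]|al A c U _ [hA hc hU]|U IU V IV [/IU hU /IV hV]] //.
split=> //; exact: hF.
Qed.

Lemma wf_shift c A : wf_cap Phi c -> wf_itv Phi A -> wf_itv Phi (itv_shift c A).
Proof. case: c => [J|B] /= h1 h2; index_arith. Qed.

Lemma wf_delay c U : wf_cap Phi c -> wf U -> wf (delay c U).
Proof. move=> hc; rewrite delayE; apply: wf_map_obl => A; exact: wf_shift. Qed.

Lemma ucong_wf U V : ucong U V -> wf U <-> wf V.
Proof.
elim=> /=; try by intuition.
by move=> al A c U0 U' _ IH; split=> -[? ? /IH ?].
Qed.

Lemma map_obl_le F G U :
  (forall A, wf_itv Phi A -> wf_itv Phi (G A) /\ itv_incl Phi (G A) (F A)) ->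
  wf U -> map_obl F U <<= map_obl G U.
Proof.
move=> hFG; elim: U => /= [|U IU V IV [/IU hU /IV hV]|al A c U _ [hA hc hU]|U IU /IU hU|U IU V IV [/IU hU /IV hV]].
- by move=> _; exact: SU_zero.
- exact: subusage_par.
- have [h1 h2] := hFG _ hA; apply: SU_act => //; exact: cap_incl_refl.
- exact: SU_compat_rep.
- exact: SU_trans (SU_compat_suml _ hU) (SU_compat_sumr _ hV).
Qed.

Lemma subusage_wf U V : U <<= V -> wf U -> wf V.
Proof.
elim=> {U V} //=; try by intuition.
- by move=> al A c U U' _ IH [? ? /IH ?].
- move=> U U1 V1 V hU _ IH hV wU; apply/(ucong_wf hV)/IH; exact/(ucong_wf hU).
- by move=> al A c B d U hB hd _ _ [].
- by move=> al A c U V hV [[]].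
Qed.

(** The last condition on [F] is what [SU_delay] requires: the part that it moves under the prefix
    was delayed by [itv_addc A c] before [F] was applied, and has to be comparable with a delay by
    [itv_addc (F A) c] afterwards. *)
Lemma map_obl_sub F U V : wf U ->
  (forall A, wf_itv Phi A -> wf_itv Phi (F A)) ->
  (forall A B, wf_itv Phi A -> wf_itv Phi B -> itv_incl Phi A B -> itv_incl Phi (F A) (F B)) ->
  (forall A B c, wf_itv Phi A -> wf_itv Phi B -> wf_cap Phi c ->
    itv_incl Phi (itv_add (itv_addc (F A) c) B) (F (itv_add (itv_addc A c) B))) ->
  U <<= V -> map_obl F U <<= map_obl F V.
Proof.
move=> hwf h1 h2 h3 hUV.
elim: hUV hwf => {U V} /=.
- by move=> *; exact: SU_zero.
- by move=> *; exact: SU_suml.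
- by move=> *; exact: SU_sumr.
- by move=> U U' V _ IH [wU _]; apply: SU_compat_suml; exact: IH.
- by move=> U U' V _ IH [_ wU]; apply: SU_compat_sumr; exact: IH.
- by move=> U U' V _ IH [wU _]; apply: SU_compat_par; exact: IH.
- by move=> U U' _ IH wU; apply: SU_compat_rep; exact: IH.
- by move=> al A c U U' hU IH _; exact: SU_compat_act.
- move=> U U1 V1 V hU hUV IH hV wU; apply: SU_cong (map_obl_ucong _ hU) _ (map_obl_ucong _ hV).
  by apply/IH/(ucong_wf hU).
- move=> U V W hUV IH1 hVW IH2 wU; apply: SU_trans (IH1 wU) (IH2 _).
  exact: subusage_wf hUV wU.
- move=> al A c B d U hB hd hBA hcd [wA _ _]; apply: SU_act => //; [exact: h1|exact: h2].
- move=> al A c U V wV [[wA wc wU] _].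
  apply: SU_trans (SU_delay _ _ _ _ _) => //; apply: subusage_par (subusage_refl _) _.
  rewrite !delayE map_obl_comp; apply: map_obl_le => // B wB; split.
    apply: (@wf_shift (CItv _)) => //=; case: c wc => [J|D] wc; have := h1 _ wA; move: (F A) => A' wA'; index_arith.
  exact: h3.
Qed.

Lemma delay_sub c U V : wf_cap Phi c -> wf U -> U <<= V -> delay c U <<= delay c V.
Proof.
move=> wc wU; rewrite !delayE; apply: map_obl_sub => //.
- by move=> A; exact: wf_shift.
- by move=> A B _ _ h; case: c wc => [J|D] wc; rewrite /itv_shift; index_arith.
- by move=> A B d wA wB wd; case: c wc => [J|D] wc; case: d wd => [J'|D'] wd; rewrite /itv_shift; index_arith.
Qed.
End Subusage.
End Usages.

(** * Subusage is a simulation *)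

Section Reliability.
Variable S : signature.

Section Wpick.
Variable n : nat.
Implicit Types (A B C : itv S n) (U V W X : usage S n) (c d : capacity S n).

(* [extract U al A c U0 R]: after resolving some choices, [U] is congruent to
   [UPar (UAct al A c U0) R]. *)
Inductive extract : usage S n -> action -> itv S n -> capacity S n -> usage S n -> usage S n -> Prop :=
| WP_act al A c U : extract (UAct al A c U) al A c U UZero
| WP_suml U V al A c U0 R : extract U al A c U0 R -> extract (USum U V) al A c U0 R
| WP_sumr U V al A c U0 R : extract V al A c U0 R -> extract (USum U V) al A c U0 R
| WP_parl U V al A c U0 R : extract U al A c U0 R -> extract (UPar U V) al A c U0 (UPar R V)
| WP_parr U V al A c U0 R : extract V al A c U0 R -> extract (UPar U V) al A c U0 (UPar U R)
| WP_rep U al A c U0 R : extract U al A c U0 R -> extract (URep U) al A c U0 (UPar (URep U) R).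

Lemma wpickE U al A c U0 R : extract U al A c U0 R ->
  match U with
  | UZero => False
  | UAct al' A' c' U' => [/\ al = al', A = A', c = c', U0 = U' & R = UZero]
  | USum U V => extract U al A c U0 R \/ extract V al A c U0 R
  | UPar U V => (exists2 R', R = UPar R' V & extract U al A c U0 R') \/
                (exists2 R', R = UPar U R' & extract V al A c U0 R')
  | URep U => exists2 R', R = UPar (URep U) R' & extract U al A c U0 R'
  end.
Proof. by case=> *; eauto. Qed.

Definition extract_le U V := forall al A c U0 R, extract U al A c U0 R ->
  exists U0' R', [/\ extract V al A c U0' R', ucong U0 U0' & ucong R R'].

(** Both directions are proved together, so that [UC_sym] is immediate. A copy extracted from a
    replication leaves the replication itself in the residual, so the cases of replication amount to
    folding or unfolding one copy there. *)
Lemma extract_ucong U V : ucong U V -> extract_le U V /\ extract_le V U.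
Proof.
elim=> {U V}.
- by move=> U; split=> al A c U0 R h; exists U0, R; split=> //; exact: UC_refl.
- by move=> U V _ [].
- move=> U V W _ [h1 h1'] _ [h2 h2']; split=> al A c U0 R.
    move=> /h1 [U1 [R1 [/h2 [U2 [R2 [? ? ?]]] ? ?]]]; exists U2, R2; split; eauto using UC_trans.
  move=> /h2' [U1 [R1 [/h1' [U2 [R2 [? ? ?]]] ? ?]]]; exists U2, R2; split; eauto using UC_trans.
- move=> U U' V V' eU [h1 h1'] eV [h2 h2']; split=> al A c U0 R /wpickE [] [R0 ->].
  + move=> /h1 [U1 [R1 [? ? ?]]]; exists U1, (UPar R1 V'); split; eauto using extract, ucong.
  + move=> /h2 [U1 [R1 [? ? ?]]]; exists U1, (UPar U' R1); split; eauto using extract, ucong.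
  + move=> /h1' [U1 [R1 [? ? ?]]]; exists U1, (UPar R1 V); split; eauto using extract, ucong.
  + move=> /h2' [U1 [R1 [? ? ?]]]; exists U1, (UPar U R1); split; eauto using extract, ucong.
- move=> al A c U U' e _; split=> al0 A0 c0 U0 R /wpickE [-> -> -> -> ->].
    exists U', UZero; split; eauto using extract, ucong.
  exists U, UZero; split; eauto using extract, ucong.
- move=> U U' e [h h']; split=> al A c U0 R /wpickE [R0 ->].
  + move=> /h [U1 [R1 [? ? ?]]]; exists U1, (UPar (URep U') R1); split; eauto using extract, ucong.
  + move=> /h' [U1 [R1 [? ? ?]]]; exists U1, (UPar (URep U) R1); split; eauto using extract, ucong.
- move=> U U' V V' eU [h1 h1'] eV [h2 h2']; split=> al A c U0 R /wpickE [].
  + move=> /h1 [U1 [R1 [? ? ?]]]; exists U1, R1; split; eauto using extract, ucong.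
  + move=> /h2 [U1 [R1 [? ? ?]]]; exists U1, R1; split; eauto using extract, ucong.
  + move=> /h1' [U1 [R1 [? ? ?]]]; exists U1, R1; split; eauto using extract, ucong.
  + move=> /h2' [U1 [R1 [? ? ?]]]; exists U1, R1; split; eauto using extract, ucong.
- move=> U; split=> al A c U0 R.
    move=> /wpickE [] [R0 ->] h; last by have := wpickE h.
    exists U0, R0; split; eauto using extract, ucong.
  move=> h; exists U0, (UPar R UZero); split; eauto using extract, ucong.
- move=> U V; split=> al A c U0 R /wpickE [] [R0 ->] h.
  + exists U0, (UPar V R0); split; eauto using extract, ucong.
  + exists U0, (UPar R0 U); split; eauto using extract, ucong.
  + exists U0, (UPar U R0); split; eauto using extract, ucong.
  + exists U0, (UPar R0 V); split; eauto using extract, ucong.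
- move=> U V W; split=> al A c U0 R /wpickE [] [R0 ->].
  + move=> h; exists U0, (UPar (UPar R0 V) W); split; eauto using extract, ucong.
  + move=> /wpickE [] [R1 ->] h.
      exists U0, (UPar (UPar U R1) W); split; eauto using extract, ucong.
    exists U0, (UPar (UPar U V) R1); split; eauto using extract, ucong.
  + move=> /wpickE [] [R1 ->] h.
      exists U0, (UPar R1 (UPar V W)); split; eauto using extract, ucong.
    exists U0, (UPar U (UPar R1 W)); split; eauto using extract, ucong.
  + move=> h; exists U0, (UPar U (UPar V R0)); split; eauto using extract, ucong.
- split=> al A c U0 R /wpickE.
    by case=> R0 _ /wpickE.
  by [].
- move=> U; split=> al A c U0 R.
    move=> /wpickE [R0 ->] h; exists U0, (UPar (URep U) R0); split; eauto using extract, ucong.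
  move=> /wpickE [] [R0 ->].
    move=> /wpickE [R1 ->] h; exists U0, (UPar (URep U) R1); split; eauto using extract, ucong.
    apply: UC_trans (UParAC _ _ _) _; apply: UC_par (UC_refl _).
    exact: UC_sym (UC_unfold _).
  move=> h; exists U0, (UPar (URep U) R0); split; eauto using extract, ucong.
- move=> U V; split=> al A c U0 R.
    move=> /wpickE [R0 ->] /wpickE [] [R1 ->] h.
      exists U0, (UPar (UPar (URep U) R1) (URep V)); split; eauto using extract, ucong.
      apply: UC_trans (UC_par (UC_rep_par _ _) (UC_refl _)) _.
      apply: UC_trans (UParACA _ _ _ _) _; apply: UC_par (UC_refl _) _.
      exact: UC_sym (UC_unfold _).
    exists U0, (UPar (URep U) (UPar (URep V) R1)); split; eauto using extract, ucong.
    apply: UC_trans (UC_par (UC_rep_par _ _) (UC_refl _)) _.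
    apply: UC_trans (UParACA _ _ _ _) _; apply: UC_par _ (UC_refl _).
    exact: UC_sym (UC_unfold _).
  move=> /wpickE [] [R0 ->] /wpickE [R1 ->] h.
    exists U0, (UPar (URep (UPar U V)) (UPar R1 V)); split; eauto using extract, ucong.
    apply: UC_sym; apply: UC_trans (UC_par (UC_rep_par _ _) (UC_refl _)) _.
    apply: UC_trans (UParACA _ _ _ _) _; apply: UC_par (UC_refl _) _.
    exact: UC_sym (UC_unfold _).
  exists U0, (UPar (URep (UPar U V)) (UPar U R1)); split; eauto using extract, ucong.
  apply: UC_sym; apply: UC_trans (UC_par (UC_rep_par _ _) (UC_refl _)) _.
  apply: UC_trans (UParACA _ _ _ _) _; apply: UC_par _ (UC_refl _).
  exact: UC_sym (UC_unfold _).
- move=> U; split=> al A c U0 R.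
    move=> /wpickE [R0 ->] /wpickE [R1 ->] h.
    exists U0, (UPar (URep U) R1); split; eauto using extract, ucong.
  move=> /wpickE [R0 ->] h.
  exists U0, (UPar (URep (URep U)) (UPar (URep U) R0)); split; eauto using extract, ucong.
  apply: UC_sym; apply: UC_trans (UC_parA _ _ _) _; apply: UC_par _ (UC_refl _).
  apply: UC_trans (UC_par (UC_rep_rep _) (UC_refl _)) _.
  exact: UC_sym (URep_dup _).
Qed.

Lemma extract_map_obl F U al A c U0 R : extract U al A c U0 R ->
  extract (map_obl F U) al (F A) c U0 (map_obl F R).
Proof. by elim=> *; constructor. Qed.

Lemma extract_map_obl_inv F U al A c U0 R : extract (map_obl F U) al A c U0 R ->
  exists A' R', [/\ A = F A', R = map_obl F R' & extract U al A' c U0 R'].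
Proof.
elim: U al A c U0 R => /= [|U IU V IV|al A c U IU|U IU|U IU V IV] al' A' c' U0 R /wpickE //.
- case=> [] [R0 ->].
    by move=> /IU [B [R1 [-> -> h]]]; exists B, (UPar R1 V); split=> //; constructor.
  by move=> /IV [B [R1 [-> -> h]]]; exists B, (UPar U R1); split=> //; constructor.
- by case=> -> -> -> -> ->; exists A, UZero; split=> //; constructor.
- by case=> R0 -> /IU [B [R1 [-> -> h]]]; exists B, (UPar (URep U) R1); split=> //; constructor.
- case=> [/IU|/IV] [B [R1 [-> -> h]]]; exists B, R1; split=> //; constructor=> //; exact: h.
Qed.

Section Sim.
Variable Phi : seq (constr S n).
Local Notation "U <<= V" := (subusage Phi U V) (at level 70).
Local Notation wf := (wf_usage Phi).

Lemma extract_wf U al A c U0 R : extract U al A c U0 R -> wf U ->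
  [/\ wf_itv Phi A, wf_cap Phi c, wf U0 & wf R].
Proof.
elim=> {U al A c U0 R} /=.
- by move=> al A c U [].
- by move=> U V al A c U0 R _ IH [/IH []].
- by move=> U V al A c U0 R _ IH [_ /IH []].
- by move=> U V al A c U0 R _ IH [/IH [] ? ? ? ? ?].
- by move=> U V al A c U0 R _ IH [? /IH [] ? ? ? ?].
- by move=> U al A c U0 R _ IH wU; have [? ? ? ?] := IH wU.
Qed.

(* [C] is the obligation of the partner in a synchronization.  [D] is the part of
   the continuation [V0] that [SU_delay] has moved out of the prefix; it is put
   back, suitably delayed, when the prefix fires. *)
Definition head_sim U V := forall al A c V0 R, extract V al A c V0 R ->
  exists A' c' U0 R' D, [/\ extract U al A' c' U0 R', R' <<= UPar R D,
    itv_incl Phi A A', cap_incl Phi c' c &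
    forall C, wf_itv Phi C -> itv_incl Phi C (itv_oplus A' c') ->
      UPar (delay (CItv (itv_sqcup A' C)) U0) D <<=
      delay (CItv (itv_sqcup A C)) V0].

Lemma head_sim_refl_cong U V : ucong U V -> head_sim U V.
Proof.
move=> /extract_ucong [_ h] al A c V0 R /h [U0 [R' [hp h0 hR]]].
exists A, c, U0, R', UZero; split=> //.
- apply: ucong_sub; apply: UC_trans (UC_sym hR) _; exact: UC_sym (UC_par0 _).
- exact: itv_incl_refl.
- exact: cap_incl_refl.
- move=> C _ _; apply: SU_trans (subusage_parl _ _ _) _.
  apply/ucong_sub/delay_ucong; exact: UC_sym.
Qed.

Lemma head_sim_trans U V W : head_sim U V -> head_sim V W -> head_sim U W.
Proof.
move=> h1 h2 al A c W0 R /h2 [A1 [c1 [V0 [R1 [D1 [/h1 [A2 [c2 [U0 [R2 [D2 [hp hR2 hA2 hc2 hl2]]]]]] hR1 hA1 hc1 hl1]]]]]].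
exists A2, c2, U0, R2, (UPar D1 D2); split=> //.
- apply: (SU_trans hR2); apply: SU_trans (SU_compat_par _ hR1) _.
  exact/ucong_sub/UC_sym/UC_parA.
- exact: itv_incl_trans hA1 hA2.
- exact: cap_incl_trans hc2 hc1.
- move=> C wC hC.
  apply: SU_trans _ (hl1 C wC _); last exact: itv_incl_trans hC (itv_oplus_mono _ _).
  apply: SU_trans _ (SU_compat_par _ (hl2 C wC hC)).
  apply: ucong_sub; apply: UC_trans (UC_parA _ _ _) _; exact: UParAC.
Qed.

Lemma wf_addc A c : wf_itv Phi A -> wf_cap Phi c -> wf_itv Phi (itv_addc A c).
Proof. move=> wA wc; index_arith. Qed.

Lemma delay_itv_le A B U : wf_itv Phi A -> wf_itv Phi B -> wf U ->
  itv_incl Phi B A -> delay (CItv A) U <<= delay (CItv B) U.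
Proof.
move=> wA wB wU h; rewrite !delayE; apply: map_obl_le => // C wC; rewrite /itv_shift; split.
  index_arith.
index_arith.
Qed.

Lemma subusage_head_sim U V : U <<= V -> wf U -> head_sim U V.
Proof.
elim=> {U V} /=.
- by move=> U _ al A c V0 R /wpickE.
- move=> U V [wU wV] al A c V0 R h.
  have [A' [c' [U0 [R' [D [? ? ? ? ?]]]]]] := head_sim_refl_cong (UC_refl U) h.
  by exists A', c', U0, R', D; split=> //; constructor.
- move=> U V [wU wV] al A c V0 R h.
  have [A' [c' [U0 [R' [D [? ? ? ? ?]]]]]] := head_sim_refl_cong (UC_refl V) h.
  by exists A', c', U0, R', D; split=> //; apply: WP_sumr.
- move=> U U' V _ IH [wU wV] al A c V0 R /wpickE [] h.
    have [A' [c' [U0 [R' [D [? ? ? ? ?]]]]]] := IH wU _ _ _ _ _ h.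
    by exists A', c', U0, R', D; split=> //; constructor.
  have [A' [c' [U0 [R' [D [? ? ? ? ?]]]]]] := head_sim_refl_cong (UC_refl V) h.
  by exists A', c', U0, R', D; split=> //; apply: WP_sumr.
- move=> U V V' _ IH [wU wV] al A c V0 R /wpickE [] h.
    have [A' [c' [U0 [R' [D [? ? ? ? ?]]]]]] := head_sim_refl_cong (UC_refl U) h.
    by exists A', c', U0, R', D; split=> //; constructor.
  have [A' [c' [U0 [R' [D [? ? ? ? ?]]]]]] := IH wV _ _ _ _ _ h.
  by exists A', c', U0, R', D; split=> //; apply: WP_sumr.
- move=> U U' V hU IH [wU wV] al A c V0 R /wpickE [] [R0 ->] h.
    have [A' [c' [U0 [R' [D [? hR ? ? ?]]]]]] := IH wU _ _ _ _ _ h.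
    exists A', c', U0, (UPar R' V), D; split=> //; first by constructor.
    apply: SU_trans (SU_compat_par _ hR) _; exact/ucong_sub/UParAC.
  have [A' [c' [U0 [R' [D [? hR ? ? ?]]]]]] := head_sim_refl_cong (UC_refl V) h.
  exists A', c', U0, (UPar U R'), D; split=> //; first by constructor.
  apply: SU_trans (subusage_par hU hR) _; exact/ucong_sub/UC_parA.
- move=> U U' hU IH wU al A c V0 R /wpickE [R0 ->] h.
  have [A' [c' [U0 [R' [D [? hR ? ? ?]]]]]] := IH wU _ _ _ _ _ h.
  exists A', c', U0, (UPar (URep U) R'), D; split=> //; first by constructor.
  apply: SU_trans (subusage_par (SU_compat_rep hU) hR) _; exact/ucong_sub/UC_parA.
- move=> al A c U U' hU IH [wA wc wU] al' A' c' V0 R /wpickE [-> -> -> -> ->].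
  exists A, c, U, UZero, UZero; split.
  + by constructor.
  + exact/ucong_sub/UC_sym/UC_par0.
  + exact: itv_incl_refl.
  + exact: cap_incl_refl.
  + move=> C wC hC; apply: SU_trans (subusage_parl _ _ _) _.
    apply: delay_sub => //=; exact: sqcup_wf.
- move=> U U1 V1 V hU hUV IH hV wU.
  apply: (head_sim_trans (head_sim_refl_cong hU)).
  apply: (head_sim_trans _ (head_sim_refl_cong hV)).
  by apply/IH/(ucong_wf _ hU).
- move=> U V W hUV IH1 hVW IH2 wU.
  apply: (head_sim_trans (IH1 wU)); apply: IH2; exact: subusage_wf hUV wU.
- move=> al A c B d U wB wd hBA hcd [wA wc wU] al' A' c' V0 R /wpickE [-> -> -> -> ->].
  exists A, c, U, UZero, UZero; split=> //.
  + by constructor.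
  + exact/ucong_sub/UC_sym/UC_par0.
  + move=> C wC hC; apply: SU_trans (subusage_parl _ _ _) _.
    apply: delay_itv_le => //; try exact: sqcup_wf.
    apply: sqcup_incl => //; exact: itv_incl_refl.
(* Here the delayed [V] is both the residual on the left and the part [D] to be put back;
   [compat_sqcup] compares its delay with the firing interval. *)
- move=> al A c U V wV [[wA wc wU] _] al' A' c' V0 R /wpickE [-> -> -> -> ->].
  exists A, c, U, (UPar UZero (delay (CItv (itv_addc A c)) V)), (delay (CItv (itv_addc A c)) V); split=> //.
  + by constructor; constructor.
  + exact: subusage_refl.
  + exact: itv_incl_refl.
  + exact: cap_incl_refl.
  + move=> C wC hC; apply: subusage_par (subusage_refl _ _) _.
    apply: delay_itv_le => //; [by apply: wf_addc|exact: sqcup_wf|].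
    exact: compat_sqcup.
Qed.

End Sim.
End Wpick.
End Reliability.

(** * Reliability *)

Section Sync.
Variable S : signature.
Section Fixed.
Variables (n : nat) (Phi : seq (constr S n)).
Implicit Types (A B C : itv S n) (U V W X R : usage S n) (c d : capacity S n).
Local Notation "U <<= V" := (subusage Phi U V) (at level 70).
Local Notation wf := (wf_usage Phi).

Definition after A B U1 U2 R :=
  UPar (delay (CItv (itv_sqcup A B)) (UPar U1 U2)) R.

Definition sync U A c U1 B d U2 R :=
  exists2 R1, extract U AIn A c U1 R1 & extract R1 AOut B d U2 R.

Definition sync_res A c U1 B d U2 R (r : uresult S n) :=
  match r with
  | Ok V => compatible Phi A c B d /\ ucong (after A B U1 U2 R) V
  | Error => ~ compatible Phi A c B d
  end.

Lemma after_cong A B U1 U2 R U1' U2' R' :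
  ucong U1 U1' -> ucong U2 U2' -> ucong R R' ->
  ucong (after A B U1 U2 R) (after A B U1' U2' R').
Proof. by move=> h1 h2 h3; apply: UC_par h3; apply: delay_ucong; apply: UC_par. Qed.

Lemma sync_cong U V A c U1 B d U2 R : ucong U V -> sync U A c U1 B d U2 R ->
  exists U1' U2' R', [/\ sync V A c U1' B d U2' R', ucong U1 U1', ucong U2 U2' & ucong R R'].
Proof.
move=> /extract_ucong [h _] [R1 /h [U1' [R1' [p1 e1 /extract_ucong [h' _]]]] /h' [U2' [R' [p2 e2 e]]]].
by exists U1', U2', R'; split=> //; exists R1'.
Qed.

(** A choice is a subusage step, so a relation closed under subusage has only synchronizations to
    follow. Errors come from incompatible synchronizations alone. *)
Lemma ustep_inv U r : ustep Phi U r ->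
  (exists A c U1 B d U2 R, sync U A c U1 B d U2 R /\ sync_res A c U1 B d U2 R r) \/
  (exists2 V, r = Ok V & U <<= V).
Proof.
elim=> {U r}.
- move=> A c U B d V h; left; exists A, c, U, B, d, V, (UPar UZero UZero); split.
    exists (UPar UZero (UAct AOut B d V)); by repeat constructor.
  split=> //; apply: UC_trans (UC_par (UC_refl _) (UC_par0 _)) _; exact: UC_par0.
- move=> A c U B d V h; left; exists A, c, U, B, d, V, (UPar UZero UZero); split=> //.
  exists (UPar UZero (UAct AOut B d V)); by repeat constructor.
- by move=> U V; right; exists U => //; constructor.
- by move=> U V; right; exists V => //; constructor.
- move=> U U' V _ [[A [c [U1 [B [d [U2 [R [[R1 p1 p2] [hc e]]]]]]]]]|[V' [->] h]]; last first.
    by right; exists (UPar V' V) => //; apply: SU_compat_par.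
  left; exists A, c, U1, B, d, U2, (UPar R V); split.
    by exists (UPar R1 V); constructor.
  split=> //; apply: UC_trans (UC_parA _ _ _) _; exact: UC_par (UC_refl _).
- move=> U V _ [[A [c [U1 [B [d [U2 [R [[R1 p1 p2] hc]]]]]]]]|[] //].
  left; exists A, c, U1, B, d, U2, (UPar R V); split=> //.
  by exists (UPar R1 V); constructor.
- move=> U U1 V1 V eU _ [[A [c [X1 [B [d [X2 [R [hs [hc e]]]]]]]]]|[V' [->] h]] eV; last first.
    by right; exists V => //; apply: SU_cong eU h eV.
  have [X1' [X2' [R' [hs' e1 e2 e3]]]] := sync_cong (UC_sym eU) hs.
  left; exists A, c, X1', B, d, X2', R'; split=> //; split=> //.
  apply: UC_trans eV; apply: UC_trans e; apply: UC_sym; exact: after_cong.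
- move=> U U1 eU _ [[A [c [X1 [B [d [X2 [R [hs hc]]]]]]]]|[] //].
  have [X1' [X2' [R' [hs' e1 e2 e3]]]] := sync_cong (UC_sym eU) hs.
  by left; exists A, c, X1', B, d, X2', R'.
Qed.

Lemma usteps_parl U U' V : usteps Phi U U' -> usteps Phi (UPar U V) (UPar U' V).
Proof.
elim=> {U U'}.
- by move=> U U' h; apply: rt_step; exact: US_par.
- by move=> U; exact: rt_refl.
- by move=> U W X _ h1 _ h2; exact: rt_trans h1 h2.
Qed.

Lemma usteps_parr U U' V : usteps Phi U U' -> usteps Phi (UPar V U) (UPar V U').
Proof.
elim=> {U U'}.
- move=> U U' h; apply: rt_step; apply: US_cong (UC_parC _ _) _ (UC_parC _ _); exact: US_par.
- by move=> U; exact: rt_refl.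
- by move=> U W X _ h1 _ h2; exact: rt_trans h1 h2.
Qed.

(** The target is reached up to congruence only, because an empty sequence of steps cannot turn [U]
    into [V]. *)
Lemma usteps_cong U V W : ucong U V -> usteps Phi V W ->
  exists2 W', usteps Phi U W' & ucong W' W.
Proof.
move=> + h; elim: h U => {V W}.
- move=> V W h U e; exists W; last exact: UC_refl.
  apply: rt_step; exact: US_cong e h (UC_refl _).
- by move=> V U e; exists U => //; exact: rt_refl.
- move=> V W X _ IH1 _ IH2 U /IH1 [W' h1 /IH2 [X' h2 e]]; exists X' => //.
  exact: rt_trans h1 h2.
Qed.

Lemma extract_usteps U al A c U0 R : extract U al A c U0 R ->
  exists2 W, usteps Phi U W & ucong W (UPar (UAct al A c U0) R).
Proof.
elim=> {U al A c U0 R}.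
- move=> al A c U; exists (UAct al A c U); first exact: rt_refl.
  exact: UC_sym (UC_par0 _).
- move=> U V al A c U0 R _ [W h e]; exists W => //.
  apply: rt_trans h; apply: rt_step; exact: US_suml.
- move=> U V al A c U0 R _ [W h e]; exists W => //.
  apply: rt_trans h; apply: rt_step; exact: US_sumr.
- move=> U V al A c U0 R _ [W h e]; exists (UPar W V); first exact: usteps_parl.
  apply: UC_trans (UC_par e (UC_refl _)) _; exact: UC_sym (UC_parA _ _ _).
- move=> U V al A c U0 R _ [W h e]; exists (UPar U W); first exact: usteps_parr.
  apply: UC_trans (UC_par (UC_refl _) e) _.
  apply: UC_trans (UC_parA _ _ _) _; apply: UC_trans _ (UC_sym (UC_parA _ _ _)).
  exact: UC_par (UC_parC _ _) (UC_refl _).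
- move=> U al A c U0 R _ [W h e].
  have [W' h' e'] := usteps_cong (UC_unfold U) (usteps_parr (URep U) h).
  exists W' => //; apply: UC_trans e' _.
  apply: UC_trans (UC_par (UC_refl _) e) _.
  apply: UC_trans (UC_parA _ _ _) _; apply: UC_trans _ (UC_sym (UC_parA _ _ _)).
  exact: UC_par (UC_parC _ _) (UC_refl _).
Qed.

Lemma sync_usteps U A c U1 B d U2 R : sync U A c U1 B d U2 R ->
  exists2 W, usteps Phi U W & ucong W (UPar (UPar (UAct AIn A c U1) (UAct AOut B d U2)) R).
Proof.
case=> R1 /extract_usteps [W h e] /extract_usteps [W' h' e'].
have [W2 h2 e2] := usteps_cong e (usteps_parr (UAct AIn A c U1) h').
exists W2; first exact: rt_trans h h2.
apply: UC_trans e2 _; apply: UC_trans (UC_par (UC_refl _) e') _; exact: UC_parA.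
Qed.

Lemma sync_fire U A c U1 B d U2 R : sync U A c U1 B d U2 R ->
  compatible Phi A c B d -> usteps Phi U (after A B U1 U2 R).
Proof.
move=> /sync_usteps [W h e] hc; apply: rt_trans h _; apply: rt_step.
apply: US_cong e _ (UC_refl _); apply: US_par; exact: US_comm.
Qed.

Lemma reliable_sync U A c U1 B d U2 R : reliable Phi U ->
  sync U A c U1 B d U2 R -> compatible Phi A c B d.
Proof.
move=> hr /sync_usteps [W h e]; apply: NNPP => hc; apply: hr; exists W => //.
apply: US_cong_error e _; apply: US_par_error; exact: US_error.
Qed.

Lemma reliable_usteps U U' : usteps Phi U U' -> reliable Phi U -> reliable Phi U'.
Proof. move=> h hr [V h' e]; apply: hr; exists V => //; exact: rt_trans h h'. Qed.

Lemma sync_wf U A c U1 B d U2 R : sync U A c U1 B d U2 R -> wf U ->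
  [/\ wf_itv Phi A, wf_cap Phi c & wf U1] /\ [/\ wf_itv Phi B, wf_cap Phi d, wf U2 & wf R].
Proof. by case=> R1 p1 p2 /(extract_wf p1) [? ? ? /(extract_wf p2) [? ? ? ?]]. Qed.

Lemma after_wf A B U1 U2 R : wf_itv Phi A -> wf_itv Phi B -> wf U1 -> wf U2 -> wf R ->
  wf (after A B U1 U2 R).
Proof. by move=> *; split=> //; apply: wf_delay => //; exact: sqcup_wf. Qed.

(** [subusage_head_sim] is applied to the input and then, in its residual, to the output. The part
    [D] to be put back behind the input waits in parallel while the output is extracted. Each half
    of compatibility is the condition on the partner of one of the prefixes. *)
Lemma sync_sub U V A c V1 B d V2 R : U <<= V -> wf U -> sync V A c V1 B d V2 R ->
  exists A' c' U1 B' d' U2 R', [/\ sync U A' c' U1 B' d' U2 R',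
    compatible Phi A' c' B' d' -> compatible Phi A c B d &
    compatible Phi A' c' B' d' -> after A' B' U1 U2 R' <<= after A B V1 V2 R].
Proof.
move=> hUV wU [R1 p1 p2]; have wV := subusage_wf hUV wU.
have [wA wc wV1 wR1] := extract_wf p1 wV.
have [wB wd wV2 wR] := extract_wf p2 wR1.
have [A' [c' [U1 [R1' [D [q1 hR1 hA hc l1]]]]]] := subusage_head_sim hUV wU p1.
have [wA' wc' wU1 wR1'] := extract_wf q1 wU.
have [B' [d' [U2 [R' [D2 [q2 hR hB hd l2]]]]]] := subusage_head_sim hR1 wR1' (WP_parl D p2).
have [wB' wd' wU2 wR'] := extract_wf q2 wR1'.
exists A', c', U1, B', d', U2, R'; split.
- by exists R1'.
- exact: compat_mono.
- case=> hB' hA'; have {}l1 := l1 _ wB' hB'; have {}l2 := l2 _ wA' hA'.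
  rewrite /after /=.
  apply: (SU_trans (subusage_par (subusage_refl _ _) hR)).
  have le1 : delay (CItv (itv_sqcup A B')) V1 <<= delay (CItv (itv_sqcup A B)) V1.
    apply: delay_itv_le => //; try exact: sqcup_wf.
    apply: sqcup_incl => //; exact: itv_incl_refl.
  have le2 : delay (CItv (itv_sqcup B A')) V2 <<= delay (CItv (itv_sqcup A B)) V2.
    apply: delay_itv_le => //; try exact: sqcup_wf.
    apply: itv_incl_trans (sqcupC_incl _ _ _) _.
    apply: sqcup_incl => //; exact: itv_incl_refl.
  have le3 : delay (CItv (itv_sqcup A' B')) U2 <<= delay (CItv (itv_sqcup B' A')) U2.
    apply: delay_itv_le => //; try exact: sqcup_wf; exact: sqcupC_incl.
  have {}l1 := SU_trans l1 le1; have {}l2 := SU_trans (SU_compat_par _ le3) (SU_trans l2 le2).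
  apply: SU_trans _ (subusage_par (subusage_par l1 l2) (subusage_refl _ R)).
  apply: ucong_sub.
  apply: UC_trans _ (UC_par (UParACA _ _ _ _) (UC_refl _)).
  apply: UC_trans _ (UC_parA _ _ _); apply: UC_par (UC_refl _) _.
  apply: UC_trans (UC_sym (UC_parA _ _ _)) _.
  by apply: UC_trans (UC_parC _ _) _; apply: UC_refl.
Qed.

End Fixed.

(** * Transfer of reliability along simulations *)

Section Simulation.
Variables (n n' : nat) (Phi : seq (constr S n)) (Phi' : seq (constr S n')).
Variable Rel : usage S n -> usage S n' -> Prop.

(* The usages on the left may only be simulated while they are reliable:
   compatibility on the left is then available, and is transferred to the right. *)
Definition simrel :=
  (forall U W W', Rel U W -> subusage Phi' W W' -> Rel U W') /\
  (forall U W A c W1 B d W2 R, Rel U W -> sync W A c W1 B d W2 R ->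
   exists A' c' U1 B' d' U2 R', [/\ sync U A' c' U1 B' d' U2 R',
     compatible Phi A' c' B' d' -> compatible Phi' A c B d &
     compatible Phi A' c' B' d' ->
       Rel (after A' B' U1 U2 R') (after A B W1 W2 R)]).

Hypothesis simRel : simrel.

(** Reliability of the left side makes its synchronization compatible, which excludes an error on
    the right. A choice on the right is matched by no step on the left. *)
Lemma simrel_step U W r : Rel U W -> reliable Phi U -> ustep Phi' W r ->
  exists W' U', [/\ r = Ok W', usteps Phi U U' & Rel U' W'].
Proof.
case: simRel => hsub hsync hUW rU /ustep_inv [[A [c [W1 [B [d [W2 [R [hs hr]]]]]]]]|[W' -> h]].
  have [A' [c' [U1 [B' [d' [U2 [R' [hs' h1 h2]]]]]]]] := hsync _ _ _ _ _ _ _ _ _ hUW hs.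
  have hc := reliable_sync rU hs'.
  case: r hr => [W'|] /=; last by move/(_ (h1 hc)).
  case=> _ e; exists W', (after A' B' U1 U2 R'); split=> //; first exact: sync_fire hs' hc.
  apply: hsub (h2 hc) _; exact: ucong_sub.
exists W', U; split=> //; [exact: rt_refl|exact: hsub h].
Qed.

Lemma simrel_steps U W W' : Rel U W -> reliable Phi U -> usteps Phi' W W' ->
  exists2 U', usteps Phi U U' & Rel U' W'.
Proof.
move=> + + h; elim: h U => {W W'}.
- move=> W W' h U hU rU; have [_ [U' [[<-] h1 h2]]] := simrel_step hU rU h.
  by exists U'.
- by move=> W U; exists U => //; exact: rt_refl.
- move=> W W1 W2 _ IH1 _ IH2 U hU rU.
  have [U1 h1 r1] := IH1 U hU rU.
  have [U2 h2 r2] := IH2 U1 r1 (reliable_usteps h1 rU).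
  exists U2 => //; exact: rt_trans h1 h2.
Qed.

Lemma simrel_reliable U W : Rel U W -> reliable Phi U -> reliable Phi' W.
Proof.
move=> hU rU [W' hW he]; have [U' hU' hr] := simrel_steps hU rU hW.
by have [? [? []]] := simrel_step hr (reliable_usteps hU' rU) he.
Qed.

End Simulation.

(** * Reliability under subusage and constant delays *)

Section Instances.
Variables (n : nat) (Phi : seq (constr S n)).
Implicit Types (A B C : itv S n) (U V W X R : usage S n) (c d : capacity S n).
Local Notation "U <<= V" := (subusage Phi U V) (at level 70).
Local Notation wf := (wf_usage Phi).

Lemma simrel_sub : simrel Phi Phi (fun U V => wf U /\ U <<= V).
Proof.
split; first by move=> U W W' [wU h] h'; split=> //; exact: SU_trans h h'.
move=> U W A c W1 B d W2 R [wU h] hs.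
have [A' [c' [U1 [B' [d' [U2 [R' [hs' h1 h2]]]]]]]] := sync_sub h wU hs.
exists A', c', U1, B', d', U2, R'; split=> // hc; split; last exact: h2.
by have [[? ? ?] [? ? ? ?]] := sync_wf hs' wU; exact: after_wf.
Qed.

Lemma reliable_sub U V : wf U -> U <<= V -> reliable Phi U -> reliable Phi V.
Proof. by move=> wU h; exact: (simrel_reliable simrel_sub). Qed.

Lemma sync_delay e U A c U1 B d U2 R : sync U A c U1 B d U2 R ->
  sync (delay e U) (itv_shift e A) c U1 (itv_shift e B) d U2 (delay e R).
Proof.
case=> R1 /(extract_map_obl (itv_shift e)) p1 /(extract_map_obl (itv_shift e)) p2.
by rewrite !delayE; exists (map_obl (itv_shift e) R1).
Qed.

Lemma sync_delay_inv e U A c U1 B d U2 R : sync (delay e U) A c U1 B d U2 R ->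
  exists A' B' R', [/\ A = itv_shift e A', B = itv_shift e B', R = delay e R' &
    sync U A' c U1 B' d U2 R'].
Proof.
rewrite delayE => -[R1 /extract_map_obl_inv [A' [R1' [-> -> p1]]] /extract_map_obl_inv [B' [R' [-> -> p2]]]].
by exists A', B', R'; rewrite delayE; split=> //; exists R1'.
Qed.

Local Notation shift m := (itv_shift (CItv (itv_cst S n m))).

(** Both partners move by the same constant. In [itv_oplus A c] every bound that depends on [A]
    moves along, and the only other one is a lower bound 0. *)
Lemma compat_shift m A c B d :
  compatible Phi (shift m A) c (shift m B) d <-> compatible Phi A c B d.
Proof. rewrite /itv_shift; split=> h; index_arith. Qed.

Lemma after_shift m A B U1 U2 R : wf_itv Phi A -> wf_itv Phi B -> wf U1 -> wf U2 ->
  delay (CItv (itv_cst S n m)) (after A B U1 U2 R) <<=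
  after (shift m A) (shift m B) U1 U2 (delay (CItv (itv_cst S n m)) R).
Proof.
move=> wA wB w1 w2.
change (UPar (delay (CItv (itv_cst S n m)) (delay (CItv (itv_sqcup A B)) (UPar U1 U2)))
   (delay (CItv (itv_cst S n m)) R) <<= after (shift m A) (shift m B) U1 U2 (delay (CItv (itv_cst S n m)) R)).
apply: subusage_par (subusage_refl _ _).
rewrite delay_comp delayE; apply: map_obl_le => // C wC; rewrite /itv_shift /=; split; index_arith.
Qed.

Lemma after_shift_r m A B U1 U2 R : wf_itv Phi A -> wf_itv Phi B -> wf U1 -> wf U2 ->
  after (shift m A) (shift m B) U1 U2 (delay (CItv (itv_cst S n m)) R) <<=
  delay (CItv (itv_cst S n m)) (after A B U1 U2 R).
Proof.
move=> wA wB w1 w2.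
change (after (shift m A) (shift m B) U1 U2 (delay (CItv (itv_cst S n m)) R) <<=
   UPar (delay (CItv (itv_cst S n m)) (delay (CItv (itv_sqcup A B)) (UPar U1 U2)))
   (delay (CItv (itv_cst S n m)) R)).
apply: subusage_par (subusage_refl _ _).
rewrite delay_comp delayE; apply: map_obl_le => // C wC; rewrite /itv_shift /=; split; index_arith.
Qed.

Lemma wf_itv_cst m : wf_itv Phi (itv_cst S n m).
Proof. index_arith. Qed.

Lemma wf_delay_cst m U : wf U -> wf (delay (CItv (itv_cst S n m)) U).
Proof. apply: wf_delay; exact: wf_itv_cst. Qed.

(** The synchronizations of a delayed usage are those of the usage itself with shifted obligations,
    and [max (p + m) (q + m) = max p q + m], so delaying commutes with firing. *)
Lemma simrel_delay m :
  simrel Phi Phi (fun U V => wf U /\ delay (CItv (itv_cst S n m)) U <<= V).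
Proof.
split; first by move=> U W W' [wU h] h'; split=> //; exact: SU_trans h h'.
move=> U W A c W1 B d W2 R [wU h] hs.
have [A' [c' [U1 [B' [d' [U2 [R' [hs' h1 h2]]]]]]]] := sync_sub h (wf_delay_cst m wU) hs.
have [A0 [B0 [R0 [eA eB eR hs0]]]] := sync_delay_inv hs'.
rewrite {}eA {}eB {}eR in hs' h1 h2.
have [[? ? ?] [? ? ? ?]] := sync_wf hs0 wU.
exists A0, c', U1, B0, d', U2, R0; split=> // /(compat_shift m) hc; first exact: h1.
split; first exact: after_wf.
apply: SU_trans _ (h2 hc); exact: after_shift.
Qed.

(** The converse of [simrel_delay]. It replays a reduction under an annotation in the context
    outside it, and yields reliability when a restriction is moved under an annotation. *)
Lemma simrel_undelay m :
  simrel Phi Phi (fun V U => [/\ wf V, wf U & V <<= delay (CItv (itv_cst S n m)) U]).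
Proof.
split.
  move=> V W W' [wV wW h] h'; split=> //; first exact: subusage_wf h' wW.
  apply: SU_trans h _; apply: delay_sub => //; exact: wf_itv_cst.
move=> U W A c W1 B d W2 R [wU wW h] hs.
have [A' [c' [U1 [B' [d' [U2 [R' [hs' h1 h2]]]]]]]] := sync_sub h wU (sync_delay (CItv (itv_cst S n m)) hs).
have [[? ? ?] [? ? ? ?]] := sync_wf hs' wU.
have [[? ? ?] [? ? ? ?]] := sync_wf hs wW.
exists A', c', U1, B', d', U2, R'; split=> // hc; first exact/(compat_shift m)/h1.
split; [exact: after_wf|exact: after_wf|].
apply: SU_trans (h2 hc) _; exact: after_shift_r.
Qed.

End Instances.
End Sync.

(** * Substitution of indices *)

Arguments fcst : simpl never.
Arguments fbin : simpl never.
Arguments icst : simpl never.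

Section IndexSubst.
Variable S : signature.

Lemma fsubst_comp n m p (s : 'I_m -> fidx S p) (t : 'I_n -> fidx S m) a :
  fsubst s (fsubst t a) = fsubst (fun i => fsubst s (t i)) a.
Proof.
elim: a => //= k f args IH; congr (IFun f _).
by apply: functional_extensionality => j.
Qed.

Lemma fsubst_id n (a : fidx S n) : fsubst (@IVar S n) a = a.
Proof.
elim: a => //= k f args IH; congr (IFun f _).
by apply: functional_extensionality => j.
Qed.

Lemma isubst_comp n m p (s : 'I_m -> fidx S p) (t : 'I_n -> fidx S m) I :
  isubst s (isubst t I) = isubst (fun i => fsubst s (t i)) I.
Proof. by case: I => //= a; rewrite fsubst_comp. Qed.

Lemma isubst_id n (I : Defs.index S n) : isubst (@IVar S n) I = I.
Proof. by case: I => //= a; rewrite fsubst_id. Qed.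

Lemma itv_subst_comp n m p (s : 'I_m -> fidx S p) (t : 'I_n -> fidx S m) A :
  itv_subst s (itv_subst t A) = itv_subst (fun i => fsubst s (t i)) A.
Proof. by rewrite /itv_subst /= !isubst_comp. Qed.

Lemma itv_subst_id n (A : itv S n) : itv_subst (@IVar S n) A = A.
Proof. by case: A => I J; rewrite /itv_subst /= !isubst_id. Qed.

Lemma cap_subst_comp n m p (s : 'I_m -> fidx S p) (t : 'I_n -> fidx S m) c :
  cap_subst s (cap_subst t c) = cap_subst (fun i => fsubst s (t i)) c.
Proof. by case: c => [I|A] /=; rewrite ?isubst_comp ?itv_subst_comp. Qed.

Lemma cap_subst_id n (c : capacity S n) : cap_subst (@IVar S n) c = c.
Proof. by case: c => [I|A] /=; rewrite ?isubst_id ?itv_subst_id. Qed.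

Lemma usage_subst_comp n m p (s : 'I_m -> fidx S p) (t : 'I_n -> fidx S m) U :
  usage_subst s (usage_subst t U) = usage_subst (fun i => fsubst s (t i)) U.
Proof.
by elim: U => //= [U -> V ->|al A c U ->|U ->|U -> V ->] //; rewrite itv_subst_comp cap_subst_comp.
Qed.

Lemma usage_subst_id n (U : usage S n) : usage_subst (@IVar S n) U = U.
Proof.
by elim: U => //= [U -> V ->|al A c U ->|U ->|U -> V ->] //; rewrite itv_subst_id cap_subst_id.
Qed.

Lemma up_lshift k n m (s : 'I_n -> fidx S m) (j : 'I_k) :
  up s (lshift n j) = IVar S (lshift m j).
Proof. by rewrite /up (unsplitK (inl j)). Qed.

Lemma up_rshift k n m (s : 'I_n -> fidx S m) (j : 'I_n) :
  up s (rshift k j) = fsubst (@wk S k m) (s j).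
Proof. by rewrite /up (unsplitK (inr j)). Qed.

Lemma inst_lshift k n (Is : 'I_k -> fidx S n) (j : 'I_k) : inst Is (lshift n j) = Is j.
Proof. by rewrite /inst (unsplitK (inl j)). Qed.

Lemma inst_rshift k n (Is : 'I_k -> fidx S n) (j : 'I_n) :
  inst Is (rshift k j) = IVar S j.
Proof. by rewrite /inst (unsplitK (inr j)). Qed.

Lemma up_comp k n m p (s : 'I_m -> fidx S p) (t : 'I_n -> fidx S m) :
  (fun i => fsubst (up (k := k) s) (up t i)) = up (fun i => fsubst s (t i)).
Proof.
apply: functional_extensionality => i; rewrite -(splitK i).
case: (split i) => j /=; rewrite ?up_lshift ?up_rshift /= ?up_lshift // !fsubst_comp.
by congr (fsubst _ _); apply: functional_extensionality => x /=; rewrite up_rshift.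
Qed.

Lemma up_id k n : up (@IVar S n) = @IVar S (k + n).
Proof.
apply: functional_extensionality => i; rewrite -{2}(splitK i) /up.
by case: (split i).
Qed.

Lemma fsubst_bin n m (s : 'I_n -> fidx S m) f a b :
  fsubst s (fbin f a b) = fbin f (fsubst s a) (fsubst s b).
Proof.
congr (IFun f _); apply: functional_extensionality => j; by case: ifP.
Qed.

Lemma fsubst_cst n m (s : 'I_n -> fidx S m) c : fsubst s (fcst S n c) = fcst S m c.
Proof. congr (IFun _ _); apply: functional_extensionality => j; by case: j. Qed.

Lemma isubst_cst n m (s : 'I_n -> fidx S m) c : isubst s (icst S n c) = icst S m c.
Proof. by congr Fin; exact: fsubst_cst. Qed.

Lemma isubst_add n m (s : 'I_n -> fidx S m) I J :
  isubst s (iadd I J) = iadd (isubst s I) (isubst s J).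
Proof. by case: I J => [a|] [b|] //; congr Fin; exact: fsubst_bin. Qed.

Lemma isubst_max n m (s : 'I_n -> fidx S m) I J :
  isubst s (imax I J) = imax (isubst s I) (isubst s J).
Proof.
case: I J => [a|] [b|] //; congr Fin; apply: etrans (fsubst_bin _ _ _ _) _.
by rewrite fsubst_bin.
Qed.

Lemma isubst_pred n m (s : 'I_n -> fidx S m) I :
  isubst s (ipred I) = ipred (isubst s I).
Proof.
case: I => [a|] //; congr Fin; apply: etrans (fsubst_bin _ _ _ _) _.
by rewrite fsubst_cst.
Qed.

Lemma itv_subst_cst n m (s : 'I_n -> fidx S m) c :
  itv_subst s (itv_cst S n c) = itv_cst S m c.
Proof. by rewrite /itv_subst !isubst_cst. Qed.

Lemma itv_subst_add n m (s : 'I_n -> fidx S m) A B :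
  itv_subst s (itv_add A B) = itv_add (itv_subst s A) (itv_subst s B).
Proof. by rewrite /itv_subst /itv_add /= !isubst_add. Qed.

Lemma itv_subst_addc n m (s : 'I_n -> fidx S m) A c :
  itv_subst s (itv_addc A c) = itv_addc (itv_subst s A) (cap_subst s c).
Proof. by case: c => [J|B]; rewrite /itv_addc ?itv_subst_add // /itv_subst [LHS]/= isubst_add. Qed.

Lemma itv_subst_sqcup n m (s : 'I_n -> fidx S m) A B :
  itv_subst s (itv_sqcup A B) = itv_sqcup (itv_subst s A) (itv_subst s B).
Proof. by rewrite /itv_subst /itv_sqcup /= !isubst_max. Qed.

Lemma itv_subst_oplus n m (s : 'I_n -> fidx S m) A c :
  itv_subst s (itv_oplus A c) = itv_oplus (itv_subst s A) (cap_subst s c).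
Proof.
by case: c => [J|B]; rewrite /itv_subst /itv_oplus [lo _]/= [hi _]/= !isubst_add ?isubst_cst.
Qed.

Lemma cap_subst_seq n m (s : 'I_n -> fidx S m) c K :
  itv_subst s (cap_seq c K) = cap_seq (cap_subst s c) (itv_subst s K).
Proof.
have e J J' : itv_subst s (Itv (icst S n 0) (iadd J J')) =
    Itv (icst S m 0) (iadd (isubst s J) (isubst s J')).
  by rewrite /itv_subst [lo _]/= [hi _]/= isubst_cst isubst_add.
by case: c => [J|[[a|] J]]; [exact: e|exact: e|exact: itv_subst_cst].
Qed.

Lemma usage_subst_delay n m (s : 'I_n -> fidx S m) c U :
  usage_subst s (delay c U) = delay (cap_subst s c) (usage_subst s U).
Proof.
elim: U => //= [U -> V ->|al A d U _|U ->|U -> V ->] //.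
by case: c => [J|B]; rewrite ?itv_subst_add ?itv_subst_addc.
Qed.

Lemma ucong_subst n m (s : 'I_n -> fidx S m) U V :
  ucong U V -> ucong (usage_subst s U) (usage_subst s V).
Proof. by elim=> /=; eauto using ucong. Qed.

Lemma extract_subst n m (s : 'I_n -> fidx S m) U al A c U0 R :
  extract (usage_subst s U) al A c U0 R ->
  exists A' c' U0' R', [/\ A = itv_subst s A', c = cap_subst s c', U0 = usage_subst s U0' &
    R = usage_subst s R' /\ extract U al A' c' U0' R'].
Proof.
elim: U al A c U0 R => /= [|U IU V IV|al A c U IU|U IU|U IU V IV] al' A' c' U0 R /wpickE //.
- case=> [] [R0 ->].
    move=> /IU [B [d [U1 [R1 [-> -> -> [-> h]]]]]]; exists B, d, U1, (UPar R1 V).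
    by split=> //; split=> //; constructor.
  move=> /IV [B [d [U1 [R1 [-> -> -> [-> h]]]]]]; exists B, d, U1, (UPar U R1).
  by split=> //; split=> //; constructor.
- by case=> -> -> -> -> ->; exists A, c, U, UZero; split=> //; split=> //; constructor.
- case=> R0 -> /IU [B [d [U1 [R1 [-> -> -> [-> h]]]]]]; exists B, d, U1, (UPar (URep U) R1).
  by split=> //; split=> //; constructor.
- case=> [/IU|/IV] [B [d [U1 [R1 [-> -> -> [-> h]]]]]]; exists B, d, U1, R1.
    by split=> //; split=> //; constructor.
  by split=> //; split=> //; apply: WP_sumr.
Qed.

(* [s] maps the valuations that satisfy [Phi'] to valuations that satisfy [Phi]. *)
Definition val_mor n m (s : 'I_n -> fidx S m) (Phi : seq (constr S n)) (Phi' : seq (constr S m)) :=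
  forall rho, all (csat rho) Phi' -> all (csat (fun i => feval rho (s i))) Phi.

Lemma csat_subst n m (s : 'I_n -> fidx S m) rho (C : constr S n) :
  csat rho (csubst s C) = csat (fun i => feval rho (s i)) C.
Proof. by case: C => r I J; rewrite /csat /= !ieval_subst. Qed.

Lemma val_mor_cwk k n (Phi : seq (constr S n)) : val_mor (@wk S k n) Phi (cwk k Phi).
Proof. by move=> rho; rewrite /cwk all_map => h; apply: sub_all h => C /=; rewrite csat_subst. Qed.

Lemma val_mor_up k n m (s : 'I_n -> fidx S m) Phi Phi' :
  val_mor s Phi Phi' -> val_mor (up s) (cwk k Phi) (cwk k Phi').
Proof.
move=> h rho; rewrite /cwk !all_map => h1.
have /h : all (csat (fun i => feval rho (@wk S k m i))) Phi'.
  by apply: sub_all h1 => C /=; rewrite csat_subst.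
apply: sub_all => C /=; rewrite csat_subst /= => hC.
rewrite [X in csat X](_ : _ = fun i => feval (fun i => feval rho (wk S k i)) (s i)) //.
by apply: functional_extensionality => i; rewrite up_rshift feval_subst.
Qed.

Lemma val_mor_inst k n (Is : 'I_k -> fidx S n) Phi : val_mor (inst Is) (cwk k Phi) Phi.
Proof.
move=> rho; rewrite /cwk all_map; apply: sub_all => C /=; rewrite csat_subst /= => hC.
rewrite [X in csat X](_ : _ = rho) //.
by apply: functional_extensionality => i; rewrite inst_rshift.
Qed.

(** Passing to stronger constraints is the case of the identity substitution, so weakening needs no
    separate induction. *)
Lemma val_mor_id n (Phi Phi' : seq (constr S n)) :
  (forall rho, all (csat rho) Phi' -> all (csat rho) Phi) -> val_mor (@IVar S n) Phi Phi'.
Proof. by []. Qed.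

Lemma val_mor_cons n m (s : 'I_n -> fidx S m) Phi Phi' C :
  val_mor s Phi Phi' -> val_mor s (C :: Phi) (csubst s C :: Phi').
Proof. by move=> h rho /= /andP [h1 /h ->]; rewrite -csat_subst h1. Qed.

Section Mor.
Variables (n m : nat) (s : 'I_n -> fidx S m).
Variables (Phi : seq (constr S n)) (Phi' : seq (constr S m)).
Hypothesis hs : val_mor s Phi Phi'.

Lemma entails_subst C : entails Phi C -> entails Phi' (csubst s C).
Proof. by move=> h rho /hs /h; rewrite csat_subst. Qed.

Lemma itv_incl_subst A B : itv_incl Phi A B -> itv_incl Phi' (itv_subst s A) (itv_subst s B).
Proof. by case=> /entails_subst h1 /entails_subst h2. Qed.

Lemma itv_eq_subst A B : itv_eq Phi A B -> itv_eq Phi' (itv_subst s A) (itv_subst s B).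
Proof. by case=> /entails_subst h1 /entails_subst h2. Qed.

Lemma wf_itv_subst A : wf_itv Phi A -> wf_itv Phi' (itv_subst s A).
Proof. exact: entails_subst. Qed.

Lemma wf_cap_subst c : wf_cap Phi c -> wf_cap Phi' (cap_subst s c).
Proof. by case: c => //= A; exact: wf_itv_subst. Qed.

Lemma cap_incl_subst c d : cap_incl Phi c d -> cap_incl Phi' (cap_subst s c) (cap_subst s d).
Proof.
case: c d => [I|A] [J|B] /=; try exact: entails_subst; last exact: itv_incl_subst.
by move=> h rho; apply/negP => /hs; apply/negP.
Qed.

Lemma compatible_subst A c B d : compatible Phi A c B d ->
  compatible Phi' (itv_subst s A) (cap_subst s c) (itv_subst s B) (cap_subst s d).
Proof. by case=> /itv_incl_subst h1 /itv_incl_subst h2; split; rewrite -itv_subst_oplus. Qed.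

Lemma wf_usage_subst U : wf_usage Phi U -> wf_usage Phi' (usage_subst s U).
Proof.
elim: U => //= [U IU V IV [/IU ? /IV ?]|al A c U IU [wA wc /IU ?]|U IU V IV [/IU ? /IV ?]] //.
by split=> //; [exact: wf_itv_subst|exact: wf_cap_subst].
Qed.

Lemma subusage_subst U V : subusage Phi U V ->
  subusage Phi' (usage_subst s U) (usage_subst s V).
Proof.
elim=> {U V} /=; try by constructor.
- by move=> U U1 V1 V hU _ IH hV; apply: SU_cong (ucong_subst _ hU) IH (ucong_subst _ hV).
- by move=> U V W _ h1 _; exact: SU_trans.
- move=> al A c B d U wB wd h1 h2; apply: SU_act;
    [exact: wf_itv_subst|exact: wf_cap_subst|exact: itv_incl_subst|exact: cap_incl_subst].
- move=> al A c U V wV; rewrite usage_subst_delay /= itv_subst_addc.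
  apply: SU_delay; exact: wf_usage_subst.
Qed.

(** Substitution reflects extraction, which depends only on the shape of a usage. Compatibility,
    being an entailment, is preserved by substitution; this direction is enough, because
    compatibility is what the reliability of [U] provides. *)
Lemma simrel_subst :
  simrel Phi Phi' (fun U W => wf_usage Phi U /\ subusage Phi' (usage_subst s U) W).
Proof.
split; first by move=> U W W' [wU h] h'; split=> //; exact: SU_trans h h'.
move=> U W A c W1 B d W2 R [wU h] hW.
have [A' [c' [U1 [B' [d' [U2 [R' [[R1 p1 p2] h1 h2]]]]]]]] := sync_sub h (wf_usage_subst wU) hW.
have [A0 [c0 [V1 [R1' [eA ec eU [eR q1]]]]]] := extract_subst p1.
rewrite {}eR in p2.
have [B0 [d0 [V2 [R0 [eB ed eV [eR' q2]]]]]] := extract_subst p2.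
rewrite {}eA {}ec {}eU {}eB {}ed {}eV {}eR' in h1 h2.
have hs' : sync U A0 c0 V1 B0 d0 V2 R0 by exists R1'.
exists A0, c0, V1, B0, d0, V2, R0; split=> // /compatible_subst hc; first exact: h1.
have [[? ? ?] [? ? ? ?]] := sync_wf hs' wU.
split; first exact: after_wf.
apply: SU_trans _ (h2 hc); rewrite /after /= !usage_subst_delay /= itv_subst_sqcup.
exact: subusage_refl.
Qed.

Lemma reliable_subst U : wf_usage Phi U -> reliable Phi U -> reliable Phi' (usage_subst s U).
Proof. by move=> wU; apply: (simrel_reliable simrel_subst); split=> //; exact: subusage_refl. Qed.

End Mor.
End IndexSubst.

(** * Types and subtyping *)

Scheme subtype_minind := Minimality for subtype Sort Prop
  with subtypes_minind := Minimality for subtypes Sort Prop.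
Combined Scheme subtype_mutind from subtype_minind, subtypes_minind.

Section Types.
Variable S : signature.

Section TypeInd.
Variable P : forall n, type S n -> Prop.
Hypothesis P_nat : forall n (I J : Defs.index S n), P (TNat I J).
Hypothesis P_ch : forall n (Ts : seq (type S n)) U, List.Forall (@P n) Ts -> P (TCh Ts U).
Hypothesis P_serv : forall n k (K : itv S (k + n)) Ts U, List.Forall (@P (k + n)) Ts -> P (TServ K Ts U).

(** The scope [n] changes inside a server type and argument types sit in lists, so the principle is
    written by hand, with [P] over all scopes and an inner fixpoint for lists. *)
Fixpoint type_nested_ind n (T : type S n) : P T :=
  let fix all_ind m (Ts : seq (type S m)) : List.Forall (@P m) Ts :=
    match Ts with
    | [::] => List.Forall_nil _
    | T :: Ts => List.Forall_cons _ (type_nested_ind T) (all_ind m Ts)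
    end in
  match T with
  | TNat J1 J2 => P_nat J1 J2
  | TCh Ts U => P_ch U (all_ind n Ts)
  | TServ k K Ts U => P_serv K U (all_ind (k + n) Ts)
  end.
End TypeInd.

Lemma Forall_map_eq T1 T2 (f g : T1 -> T2) l :
  List.Forall (fun x => f x = g x) l -> map f l = map g l.
Proof. by elim=> //= x s -> _ ->. Qed.

Lemma tsubst_comp n (T : type S n) m p (s : 'I_m -> fidx S p) (t : 'I_n -> fidx S m) :
  tsubst s (tsubst t T) = tsubst (fun i => fsubst s (t i)) T.
Proof.
elim/type_nested_ind: T m p s t => {n} [n I J|n Ts U IH|n k K Ts U IH] m p s t /=.
- by rewrite !isubst_comp.
- rewrite usage_subst_comp -map_comp; congr TCh.
  by apply: Forall_map_eq; elim: IH => //= T l e _ h; constructor.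
- rewrite usage_subst_comp itv_subst_comp -map_comp -up_comp; congr TServ.
  by apply: Forall_map_eq; elim: IH => //= T l e _ h; constructor.
Qed.

Lemma tsubst_id n (T : type S n) : tsubst (@IVar S n) T = T.
Proof.
elim/type_nested_ind: T => {n} [n I J|n Ts U IH|n k K Ts U IH] /=.
- by rewrite !isubst_id.
- rewrite usage_subst_id; congr TCh; rewrite -[RHS]map_id; exact: Forall_map_eq.
- rewrite usage_subst_id up_id itv_subst_id; congr TServ; rewrite -[RHS]map_id; exact: Forall_map_eq.
Qed.

Lemma inst_wk k n (Is : 'I_k -> fidx S n) (T : type S n) : tsubst (inst Is) (tsubst (@wk S k n) T) = T.
Proof.
rewrite tsubst_comp -[RHS]tsubst_id; congr tsubst.
by apply: functional_extensionality => i /=; rewrite inst_rshift.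
Qed.

Lemma usage_inst_wk k n (Is : 'I_k -> fidx S n) U : usage_subst (inst Is) (usage_subst (@wk S k n) U) = U.
Proof.
rewrite usage_subst_comp -[RHS]usage_subst_id; congr usage_subst.
by apply: functional_extensionality => i /=; rewrite inst_rshift.
Qed.

Lemma up_wk k n m (s : 'I_n -> fidx S m) T :
  tsubst (up s) (tsubst (@wk S k n) T) = tsubst (@wk S k m) (tsubst s T).
Proof.
rewrite !tsubst_comp; congr tsubst.
by apply: functional_extensionality => i /=; rewrite up_rshift.
Qed.

Lemma usage_up_wk k n m (s : 'I_n -> fidx S m) U :
  usage_subst (up s) (usage_subst (@wk S k n) U) = usage_subst (@wk S k m) (usage_subst s U).
Proof.
rewrite !usage_subst_comp; congr usage_subst.
by apply: functional_extensionality => i /=; rewrite up_rshift.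
Qed.

Lemma fsubst_inst k n m (s : 'I_n -> fidx S m) (Is : 'I_k -> fidx S n) :
  (fun i => fsubst s (inst Is i)) =
  (fun i => fsubst (inst (fun j => fsubst s (Is j))) (up s i)).
Proof.
apply: functional_extensionality => i; rewrite -(splitK i).
case: (split i) => j /=; rewrite ?inst_lshift ?inst_rshift ?up_lshift ?up_rshift /= ?inst_lshift //.
rewrite fsubst_comp -[LHS]fsubst_id; congr (fsubst _ _).
by apply: functional_extensionality => x /=; rewrite inst_rshift.
Qed.

Lemma tsubst_inst k n m (s : 'I_n -> fidx S m) (Is : 'I_k -> fidx S n) T :
  tsubst s (tsubst (inst Is) T) = tsubst (inst (fun j => fsubst s (Is j))) (tsubst (up s) T).
Proof. by rewrite !tsubst_comp fsubst_inst. Qed.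

Lemma itv_subst_inst k n m (s : 'I_n -> fidx S m) (Is : 'I_k -> fidx S n) K :
  itv_subst s (itv_subst (inst Is) K) = itv_subst (inst (fun j => fsubst s (Is j))) (itv_subst (up s) K).
Proof. by rewrite !itv_subst_comp fsubst_inst. Qed.

Definition usage_of n (T : type S n) : usage S n :=
  match T with TNat _ _ => UZero | TCh _ U | TServ _ _ _ U => U end.
Definition set_usage n (U : usage S n) (T : type S n) := map_usage (fun _ => U) T.
Definition skel n (Phi : seq (constr S n)) (T T' : type S n) :=
  subtype Phi (set_usage UZero T) (set_usage UZero T').
(** As a default for [nth] it has no usage, so that a context acts as a function with value [UZero]
    outside its range. *)
Definition nat0 n : type S n := TNat (icst S n 0) (icst S n 0).

Lemma subtype_inv n (Phi : seq (constr S n)) T T' : subtype Phi T T' ->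
  match T with
  | TNat J1 J2 => exists I' J', [/\ T' = TNat I' J', entails Phi (ile I' J1) & entails Phi (ile J2 J')]
  | TCh Ts U => exists Ts' V, [/\ T' = TCh Ts' V, subtypes Phi Ts Ts', subtypes Phi Ts' Ts & subusage Phi U V]
  | TServ k K Ts U => exists K' Ts' V, [/\ T' = TServ K' Ts' V, subtypes (cwk k Phi) Ts Ts',
      subtypes (cwk k Phi) Ts' Ts, itv_eq (cwk k Phi) K K' & subusage Phi U V]
  end.
Proof.
case=> {n Phi T T'} [n Phi I J I' J' h1 h2|n Phi Ts Ts' U V h1 h2 h3|n Phi k K K' Ts Ts' U V h1 h2 h3 h4].
- by exists I', J'.
- by exists Ts', V.
- by exists K', Ts', V.
Qed.

Lemma subtypes_inv n (Phi : seq (constr S n)) Ts Ts' : subtypes Phi Ts Ts' ->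
  match Ts, Ts' with
  | [::], [::] => True
  | T :: Ts, T' :: Ts' => subtype Phi T T' /\ subtypes Phi Ts Ts'
  | _, _ => False
  end.
Proof. by case=> {n Phi Ts Ts'}. Qed.

Lemma subtype_invr n (Phi : seq (constr S n)) T T' : subtype Phi T T' ->
  match T' with
  | TNat I' J' => exists I J, [/\ T = TNat I J, entails Phi (ile I' I) & entails Phi (ile J J')]
  | TCh Ts' V => exists Ts U, [/\ T = TCh Ts U, subtypes Phi Ts Ts', subtypes Phi Ts' Ts & subusage Phi U V]
  | TServ k K' Ts' V => exists K Ts U, [/\ T = TServ K Ts U, subtypes (cwk k Phi) Ts Ts',
      subtypes (cwk k Phi) Ts' Ts, itv_eq (cwk k Phi) K K' & subusage Phi U V]
  end.
Proof.
case=> {n Phi T T'} [n Phi I J I' J' h1 h2|n Phi Ts Ts' U V h1 h2 h3|n Phi k K K' Ts Ts' U V h1 h2 h3 h4].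
- by exists I, J.
- by exists Ts, U.
- by exists K, Ts, U.
Qed.

Lemma subtypesP n (Phi : seq (constr S n)) Ts Ts' : subtypes Phi Ts Ts' <->
  size Ts = size Ts' /\ forall i, i < size Ts -> subtype Phi (nth (nat0 n) Ts i) (nth (nat0 n) Ts' i).
Proof.
split.
  elim: Ts Ts' => [|T Ts IH] [|T' Ts'] /subtypes_inv //= [h /IH [-> h']].
  by split=> // -[|i] //; exact: h'.
elim: Ts Ts' => [|T Ts IH] [|T' Ts'] //= [] //; first by constructor.
move=> [e] h; constructor; first exact: (h 0).
by apply: IH; split=> // i; exact: (h i.+1).
Qed.

Lemma ForallP n (P : type S n -> Prop) Ts : List.Forall P Ts <->
  forall i, i < size Ts -> P (nth (nat0 n) Ts i).
Proof.
split; first by elim=> //= T l h _ IH [|i] //; exact: IH.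
elim: Ts => [|T Ts IH] h; constructor; first exact: (h 0).
by apply: IH => i; exact: (h i.+1).
Qed.

Lemma itv_eq_refl n (Phi : seq (constr S n)) A : itv_eq Phi A A.
Proof. by split=> rho _; rewrite /csat /=. Qed.

Lemma itv_eq_trans n (Phi : seq (constr S n)) A B C :
  itv_eq Phi A B -> itv_eq Phi B C -> itv_eq Phi A C.
Proof.
move=> [h1 h2] [h3 h4]; split=> rho hr.
  by move: (h1 _ hr) (h3 _ hr); rewrite !csat_ieq => /eqP ->.
by move: (h2 _ hr) (h4 _ hr); rewrite !csat_ieq => /eqP ->.
Qed.

Lemma itv_eq_sym n (Phi : seq (constr S n)) A B : itv_eq Phi A B -> itv_eq Phi B A.
Proof.
move=> [h1 h2]; split=> rho hr.
  by move: (h1 _ hr); rewrite !csat_ieq eq_sym.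
by move: (h2 _ hr); rewrite !csat_ieq eq_sym.
Qed.

Lemma itv_eq_incl n (Phi : seq (constr S n)) A B : itv_eq Phi A B -> itv_incl Phi A B.
Proof.
move=> [h1 h2]; split=> rho hr.
  move: (h1 _ hr); rewrite csat_ieq csat_ile => /eqP ->; by case: ieval => /=.
move: (h2 _ hr); rewrite csat_ieq csat_ile => /eqP ->; by case: ieval => /=.
Qed.

Lemma ile_refl n (Phi : seq (constr S n)) I : entails Phi (ile I I).
Proof. by move=> rho _; rewrite csat_ile; case: ieval => /=. Qed.

Lemma ile_trans n (Phi : seq (constr S n)) I J K :
  entails Phi (ile I J) -> entails Phi (ile J K) -> entails Phi (ile I K).
Proof. move=> h1 h2. index_arith. Qed.

Lemma subtype_refl n (T : type S n) (Phi : seq (constr S n)) : subtype Phi T T.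
Proof.
elim/type_nested_ind: T Phi => {n} [n I J|n Ts U IH|n k K Ts U IH] Phi.
- constructor; exact: ile_refl.
- have h : subtypes Phi Ts Ts by elim: IH => [|T l h _ h']; constructor.
  constructor=> //; exact: subusage_refl.
- have h : subtypes (cwk k Phi) Ts Ts by elim: IH => [|T l h _ h']; constructor.
  constructor=> //; [exact: itv_eq_refl|exact: subusage_refl].
Qed.

Lemma subtypes_refl n (Ts : seq (type S n)) (Phi : seq (constr S n)) : subtypes Phi Ts Ts.
Proof. by elim: Ts => [|T l IH]; constructor=> //; exact: subtype_refl. Qed.

Lemma subtype_trans n (T2 : type S n) (Phi : seq (constr S n)) T1 T3 :
  subtype Phi T1 T2 -> subtype Phi T2 T3 -> subtype Phi T1 T3.
Proof.
have seqs m (l2 : seq (type S m)) :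
    List.Forall (fun T2 => forall Phi T1 T3, subtype Phi T1 T2 -> subtype Phi T2 T3 -> subtype Phi T1 T3) l2 ->
    forall Phi l1 l3, subtypes Phi l1 l2 -> subtypes Phi l2 l3 -> subtypes Phi l1 l3.
  elim=> [|T l h _ IH] Psi [|T1' l1] [|T3' l3] /subtypes_inv // h1 /subtypes_inv //.
  case: h1 => h1 h2 [h3 h4]; constructor; [exact: h h1 h3|exact: IH h2 h4].
elim/type_nested_ind: T2 Phi T1 T3 => {n} [n I J|n Ts U IH|n k K Ts U IH] Phi T1 T3.
- move=> /subtype_invr [I1 [J1 [-> h1 h2]]] /subtype_inv [I3 [J3 [-> h3 h4]]].
  by constructor; [exact: ile_trans h3 h1|exact: ile_trans h2 h4].
- move=> /subtype_invr [Ts1 [U1 [-> h1 h2 h3]]] /subtype_inv [Ts3 [U3 [-> h4 h5 h6]]].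
  constructor; [exact: seqs h1 h4|exact: seqs h5 h2|exact: SU_trans h3 h6].
- move=> /subtype_invr [K1 [Ts1 [U1 [-> h1 h2 e h3]]]] /subtype_inv [K3 [Ts3 [U3 [-> h4 h5 e' h6]]]].
  constructor; [exact: seqs h1 h4|exact: seqs h5 h2|exact: itv_eq_trans e e'|exact: SU_trans h3 h6].
Qed.

Lemma wf_type_inv n (Phi : seq (constr S n)) T : wf_type Phi T ->
  match T with
  | TNat _ _ => True
  | TCh Ts U => List.Forall (wf_type Phi) Ts /\ wf_usage Phi U
  | TServ k K Ts U => [/\ wf_itv (cwk k Phi) K, List.Forall (wf_type (cwk k Phi)) Ts & wf_usage Phi U]
  end.
Proof. by case. Qed.

Lemma setuK n (T : type S n) U : set_usage (usage_of T) (set_usage U T) = T.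
Proof. by case: T. Qed.

Lemma set_usage_set_usage n (T : type S n) U V : set_usage U (set_usage V T) = set_usage U T.
Proof. by case: T. Qed.

Lemma subtypeE n (Phi : seq (constr S n)) T T' :
  subtype Phi T T' <-> skel Phi T T' /\ subusage Phi (usage_of T) (usage_of T').
Proof.
rewrite /skel; split.
  case: T => [I J|Ts U|k K Ts U] /subtype_inv.
  + move=> [I' [J' [-> h1 h2]]]; split; [by constructor|exact: subusage_refl].
  + move=> [Ts' [V [-> h1 h2 h3]]]; split=> //=; constructor=> //; exact: subusage_refl.
  + move=> [K' [Ts' [V [-> h1 h2 h3 h4]]]]; split=> //=; constructor=> //; exact: subusage_refl.
case; move: (setuK T' UZero); rewrite /skel.
move: (set_usage UZero T') (usage_of T') => T'' V' <-.
case: T => [I J|Ts U|k K Ts U] /= /subtype_inv.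
+ move=> [I' [J' [-> h1 h2]]] _; by constructor.
+ move=> [Ts' [V [-> h1 h2 _]]]; by constructor.
+ move=> [K' [Ts' [V [-> h1 h2 h3 _]]]]; by constructor.
Qed.

Lemma skel_refl n (Phi : seq (constr S n)) T : skel Phi T T.
Proof. exact: subtype_refl. Qed.

Lemma skel_trans n (Phi : seq (constr S n)) T1 T2 T3 :
  skel Phi T1 T2 -> skel Phi T2 T3 -> skel Phi T1 T3.
Proof. exact: subtype_trans. Qed.

Lemma subtype_skel n (Phi : seq (constr S n)) T T' : subtype Phi T T' -> skel Phi T T'.
Proof. by move/subtypeE => []. Qed.

Lemma skel_set_usage n (Phi : seq (constr S n)) U T : skel Phi T (set_usage U T) /\ skel Phi (set_usage U T) T.
Proof. by rewrite /skel set_usage_set_usage; split; exact: subtype_refl. Qed.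

Lemma set_usage_strip n (T T' : type S n) : set_usage UZero T = set_usage UZero T' ->
  forall Phi, skel Phi T T'.
Proof. by rewrite /skel => -> Phi; exact: subtype_refl. Qed.

Lemma subtype_subst_mut :
  (forall n (Phi : seq (constr S n)) T T', subtype Phi T T' ->
    forall m (s : 'I_n -> fidx S m) Phi', val_mor s Phi Phi' -> subtype Phi' (tsubst s T) (tsubst s T')) /\
  (forall n (Phi : seq (constr S n)) Ts Ts', subtypes Phi Ts Ts' ->
    forall m (s : 'I_n -> fidx S m) Phi', val_mor s Phi Phi' -> subtypes Phi' (map (tsubst s) Ts) (map (tsubst s) Ts')).
Proof.
apply: subtype_mutind.
- move=> n Phi I J I' J' h1 h2 m s Phi' hs /=.
  by constructor; [exact: (entails_subst hs h1)|exact: (entails_subst hs h2)].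
- move=> n Phi Ts Ts' U V _ h1 _ h2 h3 m s Phi' hs /=.
  by constructor; [exact: h1|exact: h2|exact: subusage_subst h3].
- move=> n Phi k K K' Ts Ts' U V _ h1 _ h2 h3 h4 m s Phi' hs /=.
  have hu := val_mor_up (k := k) hs.
  by constructor; [exact: h1|exact: h2|exact: itv_eq_subst h3|exact: subusage_subst h4].
- by move=> n Phi m s Phi' hs; constructor.
- by move=> n Phi T T' Ts Ts' _ h1 _ h2 m s Phi' hs /=; constructor; [exact: h1|exact: h2].
Qed.

Section Mor.
Variables (n m : nat) (s : 'I_n -> fidx S m).
Variables (Phi : seq (constr S n)) (Phi' : seq (constr S m)).
Hypothesis hs : val_mor s Phi Phi'.

Lemma subtype_subst T T' : subtype Phi T T' -> subtype Phi' (tsubst s T) (tsubst s T').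
Proof. by move=> h; apply: (proj1 subtype_subst_mut _ _ _ _ h). Qed.

Lemma subtypes_subst Ts Ts' : subtypes Phi Ts Ts' ->
  subtypes Phi' (map (tsubst s) Ts) (map (tsubst s) Ts').
Proof. by move=> h; apply: (proj2 subtype_subst_mut _ _ _ _ h). Qed.

Lemma tsubst_set_usage U T : tsubst s (set_usage U T) = set_usage (usage_subst s U) (tsubst s T).
Proof. by case: T. Qed.

Lemma usage_of_subst T : usage_of (tsubst s T) = usage_subst s (usage_of T).
Proof. by case: T. Qed.

Lemma skel_subst T T' : skel Phi T T' -> skel Phi' (tsubst s T) (tsubst s T').
Proof. by move/subtype_subst; rewrite !tsubst_set_usage. Qed.

End Mor.

Lemma wf_type_subst n (T : type S n) m (s : 'I_n -> fidx S m) Phi Phi' :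
  val_mor s Phi Phi' -> wf_type Phi T -> wf_type Phi' (tsubst s T).
Proof.
elim/type_nested_ind: T m s Phi Phi' => {n} [n I J|n Ts U IH|n k K Ts U IH] m s Phi Phi' hs /wf_type_inv /=.
- by constructor.
- move=> [w1 w2]; constructor; last exact: wf_usage_subst w2.
  elim: IH w1 => [|T l h _ IH] w; first by constructor.
  by inversion_clear w; constructor; [exact: h hs _|exact: IH].
- move=> [w0 w1 w2]; have hu := val_mor_up (k := k) hs.
  constructor; [exact: wf_itv_subst w0| |exact: wf_usage_subst w2].
  elim: IH w1 => [|T l h _ IH] w; first by constructor.
  by inversion_clear w; constructor; [exact: h hu _|exact: IH].
Qed.

Lemma wf_ctx_subst n m (s : 'I_n -> fidx S m) Phi Phi' (G : ctx S n) :
  val_mor s Phi Phi' -> wf_ctx Phi G -> wf_ctx Phi' (map (tsubst s) G).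
Proof. by move=> hs; elim=> /= [|T l h _ IH]; constructor=> //; exact: wf_type_subst h. Qed.

(** Instantiating the [k] new index variables, here by 0, undoes the weakening. This recovers
    well-formedness outside a server from that of its body. *)
Lemma wf_ctx_wk k n (Phi : seq (constr S n)) (G : ctx S n) :
  wf_ctx (cwk k Phi) (map (tsubst (@wk S k n)) G) -> wf_ctx Phi G.
Proof.
move/(wf_ctx_subst (val_mor_inst (fun _ => fcst S n 0) (Phi := Phi))).
by rewrite -map_comp (_ : map _ G = G) // -[RHS]map_id; apply: eq_map => T /=; exact: inst_wk.
Qed.

End Types.

(** * Sharing of usages among expressions *)

Section Distribution.
Variable S : signature.

(** Only an expression that is itself a variable can carry a usage; under [ESucc] the type is a
    [TNat]. *)
Definition contrib n (e : expr) (U : usage S n) (b : nat) : usage S n :=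
  if e is EVar v then if v == b then U else UZero else UZero.

(* The usage of [b] needed by a tuple [s 0, ..., s N.-1] of expressions whose
   components have the usages [f 0, ..., f N.-1]. *)
Fixpoint usage_sum n (N : nat) (s : nat -> expr) (f : nat -> usage S n) (b : nat) : usage S n :=
  if N is N'.+1 then UPar (usage_sum N' s f b) (contrib (s N') (f N') b) else UZero.

Section Psum.
Variables (n : nat) (Phi : seq (constr S n)).
Implicit Types (f g : nat -> usage S n) (s : nat -> expr).
Local Notation "U <<= V" := (subusage Phi U V) (at level 70).

Lemma contribE e (U : usage S n) b : e = EVar b -> contrib e U b = U.
Proof. by move=> -> /=; rewrite eqxx. Qed.

Lemma contribN e (U : usage S n) b : e <> EVar b -> contrib e U b = UZero.
Proof. by case: e => //= v h; case: eqP => // e; case: h; rewrite e. Qed.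

Lemma EVar_dec e b : e = EVar b \/ e <> EVar b.
Proof. exact: classic. Qed.

Lemma usage_sum_mono N s f g b :
  (forall v, v < N -> s v = EVar b -> f v <<= g v) -> usage_sum N s f b <<= usage_sum N s g b.
Proof.
elim: N => [|N IH] h /=; first exact: subusage_refl.
apply: subusage_par; first by apply: IH => v hv; apply: h; apply: ltnW.
case: (EVar_dec (s N) b) => e; last by rewrite !contribN //; exact: subusage_refl.
by rewrite !contribE //; apply: h.
Qed.

Lemma usage_sum_ext N s t f g b :
  (forall v, v < N -> s v = t v) -> (forall v, v < N -> s v = EVar b -> f v = g v) ->
  usage_sum N s f b = usage_sum N t g b.
Proof.
elim: N => [|N IH] h1 h2 //=; congr UPar.
  by apply: IH => v hv; [apply: h1|apply: h2]; apply: ltnW.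
rewrite -h1 //; case: (EVar_dec (s N) b) => e; last by rewrite !contribN.
by rewrite !contribE //; apply: h2.
Qed.

Lemma usage_sum_zero N s f b : (forall v, v < N -> s v = EVar b -> ucong (f v) UZero) ->
  ucong (usage_sum N s f b) UZero.
Proof.
elim: N => [|N IH] h /=; first exact: UC_refl.
apply: UC_trans (UC_par (IH _) _) (UC_par0 _); first by move=> v hv; apply: h; apply: ltnW.
case: (EVar_dec (s N) b) => e; last by rewrite contribN //; exact: UC_refl.
by rewrite contribE //; apply: h.
Qed.

Lemma usage_sum_delay N s f b c : delay c (usage_sum N s f b) = usage_sum N s (fun v => delay c (f v)) b.
Proof.
elim: N => //= N ->; congr UPar.
by case: (s N) => //= v; case: eqP.
Qed.

Lemma usage_sum_par N s f g b :
  ucong (usage_sum N s (fun v => UPar (f v) (g v)) b) (UPar (usage_sum N s f b) (usage_sum N s g b)).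
Proof.
elim: N => /= [|N IH]; first exact: UC_sym (UC_par0 _).
apply: UC_trans (UC_par IH _) (UParACA _ _ _ _).
case: (EVar_dec (s N) b) => e; last by rewrite !contribN //; exact: UC_sym (UC_par0 _).
by rewrite !contribE //; exact: UC_refl.
Qed.

Lemma usage_sum_rep N s f b :
  ucong (usage_sum N s (fun v => URep (f v)) b) (URep (usage_sum N s f b)).
Proof.
elim: N => /= [|N IH]; first exact: UC_sym (UC_rep0 _ _).
apply: UC_trans (UC_par IH _) (UC_sym (UC_rep_par _ _)).
case: (EVar_dec (s N) b) => e; last by rewrite !contribN //; exact: UC_sym (UC_rep0 _ _).
by rewrite !contribE //; exact: UC_refl.
Qed.

Lemma usage_sum_pick N s f b v : v < N -> s v = EVar b ->
  ucong (usage_sum N s f b) (UPar (f v) (usage_sum N s (fun w => if w == v then UZero else f w) b)).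
Proof.
elim: N => //= N IH; rewrite ltnS leq_eqVlt => /orP [/eqP ->|hv] e.
  rewrite eqxx !contribE // (_ : usage_sum N s f b = usage_sum N s (fun w => if w == N then UZero else f w) b).
    apply: UC_trans (UC_parC _ _) (UC_par (UC_refl _) _); exact: UC_sym (UC_par0 _).
  by apply: usage_sum_ext => // w hw _; rewrite (ltn_eqF hw).
apply: UC_trans (UC_par (IH hv e) (UC_refl _)) _.
by rewrite (gtn_eqF hv); apply: UC_sym (UC_parA _ _ _).
Qed.

Lemma usage_sum_single N s f b v : v < N -> s v = EVar b ->
  (forall w, w < N -> w <> v -> s w <> EVar b) -> ucong (usage_sum N s f b) (f v).
Proof.
move=> hv e hw; apply: UC_trans (usage_sum_pick _ hv e) _.
apply: UC_trans (UC_par (UC_refl _) (usage_sum_zero _)) (UC_par0 _).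
move=> w lw ew; case: eqP => [_|/(hw _ lw)] //; exact: UC_refl.
Qed.

Lemma usage_sum_le1 N s f b v : v < N -> s v = EVar b -> usage_sum N s f b <<= f v.
Proof. move=> hv e; exact: SU_trans (ucong_sub _ (usage_sum_pick _ hv e)) (subusage_parl _ _ _). Qed.

Lemma usage_sum_add k N s f b :
  ucong (usage_sum (k + N) s f b)
    (UPar (usage_sum k s f b) (usage_sum N (fun v => s (k + v)) (fun v => f (k + v)) b)).
Proof.
elim: N => [|N IH]; first by rewrite addn0; exact: UC_sym (UC_par0 _).
rewrite addnS /=; apply: UC_trans (UC_par IH (UC_refl _)) _.
exact: UC_sym (UC_parA _ _ _).
Qed.

Lemma usage_sum_wf N s f b : (forall v, v < N -> wf_usage Phi (f v)) -> wf_usage Phi (usage_sum N s f b).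
Proof.
elim: N => //= N IH h; split; first by apply: IH => v hv; apply: h; apply: ltnW.
by case: (s N) => //= v; case: eqP => // _; apply: h.
Qed.

(** A usage travels from position [i] to the variable [t i] and then along [s]; the hypothesis keeps
    the intermediate variable within the range of the outer sum. *)
Lemma usage_sum_comp N M s t f b : (forall i v, i < M -> t i = EVar v -> v < N) ->
  usage_sum N s (usage_sum M t f) b <<= usage_sum M (fun i => esubst s (t i)) f b.
Proof.
elim: M => /= [|M IH] h; first exact: SU_zero.
apply: (SU_trans (ucong_sub _ (usage_sum_par _ _ _ _ _))).
apply: subusage_par; first by apply: IH => i v hi; apply: h; apply: ltnW.
case: (EVar_dec (esubst s (t M)) b) => e; last by rewrite [X in _ <<= X]contribN //; exact: SU_zero.
rewrite [X in _ <<= X]contribE //; case E: (t M) e => [v||e'] //= e.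
apply: (SU_trans (usage_sum_le1 _ (h _ _ (ltnSn _) E) e)); rewrite /= eqxx; exact: subusage_refl.
Qed.

(** [SU_delay] speaks of delays by intervals and the typing rules of delays by capacities; a
    capacity delays like the interval obtained by adding it to [[0, 0]]. *)
Lemma delay_cap_le c U : wf_cap Phi c -> wf_usage Phi U ->
  delay c U <<= delay (CItv (itv_addc (itv_cst S n 0) c)) U.
Proof.
move=> wc wU; rewrite !delayE; apply: map_obl_le => // A wA.
by case: c wc => [J|B] wc; rewrite /itv_shift; split; index_arith.
Qed.

(* If [a] and other variables are all mapped to [b0], their usages merge into a
   prefix followed by the merged usages of the continuation, thanks to [SU_delay]. *)
Section Prefix.
Variables (N : nat) (s : nat -> expr) (f f1 : nat -> usage S n) (a b0 : nat).
Variables (al : action) (c : capacity S n).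
Hypotheses (ha : a < N) (sa : s a = EVar b0) (wc : wf_cap Phi c).
Hypothesis wf1 : forall v, wf_usage Phi (f1 v).

Let g v := if v == a then UZero else f1 v.

Let usage_sum_g b : usage_sum N s (fun w => if w == a then UZero else delay c (f1 w)) b =
  delay c (usage_sum N s g b).
Proof. by rewrite usage_sum_delay; apply: usage_sum_ext => // v _ _; rewrite /g; case: eqP. Qed.

Let wf_g b : wf_usage Phi (usage_sum N s g b).
Proof. by apply: usage_sum_wf => v _; rewrite /g; case: eqP. Qed.

Lemma usage_sum_prefix :
  f a <<= UAct al (itv_cst S n 0) c (f1 a) -> (forall v, v <> a -> f v <<= delay c (f1 v)) ->
  usage_sum N s f b0 <<= UAct al (itv_cst S n 0) c (usage_sum N s f1 b0) /\
  forall b, b <> b0 -> usage_sum N s f b <<= delay c (usage_sum N s f1 b).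
Proof.
move=> h1 h2; split.
  apply: (SU_trans (ucong_sub _ (usage_sum_pick _ ha sa))).
  apply: (@SU_trans _ _ _ _ (UPar (UAct al (itv_cst S n 0) c (f1 a))
     (delay (CItv (itv_addc (itv_cst S n 0) c)) (usage_sum N s g b0)))).
    apply: subusage_par h1 _; apply: SU_trans _ (delay_cap_le wc (wf_g b0)).
    rewrite -usage_sum_g; apply: usage_sum_mono => v hv ev; case: eqP => [_|/h2 //]; exact: subusage_refl.
  apply: (SU_trans (SU_delay _ _ _ _ (wf_g b0))).
  apply/ucong_sub/UC_act/UC_sym; exact: usage_sum_pick.
move=> b hb; rewrite usage_sum_delay; apply: usage_sum_mono => v hv ev; apply: h2 => e.
by case: hb; move: ev; rewrite e sa => -[].
Qed.

(** Replication distributes over composition, so the replicated usages of the other variables join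
    the prefix under a single [URep], where [SU_delay] applies as before. *)
Lemma usage_sum_rep_prefix :
  f a <<= URep (UAct al (itv_cst S n 0) c (f1 a)) ->
  (forall v, v <> a -> f v <<= delay c (URep (f1 v))) ->
  usage_sum N s f b0 <<= URep (UAct al (itv_cst S n 0) c (usage_sum N s f1 b0)) /\
  forall b, b <> b0 -> usage_sum N s f b <<= delay c (URep (usage_sum N s f1 b)).
Proof.
move=> h1 h2; split.
  apply: (SU_trans (ucong_sub _ (usage_sum_pick _ ha sa))).
  apply: (@SU_trans _ _ _ _ (UPar (URep (UAct al (itv_cst S n 0) c (f1 a)))
     (URep (delay (CItv (itv_addc (itv_cst S n 0) c)) (usage_sum N s g b0))))).
    apply: subusage_par h1 _; apply: SU_trans _ (SU_compat_rep (delay_cap_le wc (wf_g b0))).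
    rewrite -usage_sum_g; apply: SU_trans _ (ucong_sub _ (usage_sum_rep _ _ _ _)).
    apply: usage_sum_mono => v hv ev; case: eqP => [_|/h2 //].
    exact/ucong_sub/UC_sym/UC_rep0.
  apply: (SU_trans (ucong_sub_r _ (UC_rep_par _ _))); apply: SU_compat_rep.
  apply: (SU_trans (SU_delay _ _ _ _ (wf_g b0))).
  apply/ucong_sub/UC_act/UC_sym; exact: usage_sum_pick.
move=> b hb.
apply: SU_trans _ (ucong_sub _ (delay_ucong _ (usage_sum_rep _ _ _ _))); rewrite usage_sum_delay.
apply: usage_sum_mono => v hv ev; apply: h2 => e.
by case: hb; move: ev; rewrite e sa => -[].
Qed.

End Prefix.
End Psum.

Lemma usage_sum_subst n m (sg : 'I_n -> fidx S m) N s (f : nat -> usage S n) b :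
  usage_subst sg (usage_sum N s f b) = usage_sum N s (fun v => usage_subst sg (f v)) b.
Proof.
elim: N => //= N ->; congr UPar.
by case: (s N) => //= v; case: eqP.
Qed.

Fixpoint fve (e : expr) (x : nat) : bool :=
  match e with EVar v => v == x | EZero => false | ESucc e => fve e x end.

(** The substitution lemma asks for well-typed images at free variables only. Strengthening depends
    on this, as it sends the dropped variable to an expression that is not a name. *)
Fixpoint fvp (P : proc) (x : nat) : bool :=
  match P with
  | PZero => false
  | PPar P Q => fvp P x || fvp Q x
  | PServ a k P | PIn a k P => (a == x) || fvp P (k + x)
  | POut a es P => [|| a == x, has (fve^~ x) es | fvp P x]
  | PNu P => fvp P (1 + x)
  | PTick P | PAnnot _ P => fvp P x
  | PMatch e P Q => [|| fve e x, fvp P x | fvp Q (1 + x)]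
  end.

(** The part of expression typing that ignores head usages; those are accounted for by [contrib]. *)
Fixpoint expr_ok n (Phi : seq (constr S n)) (G : ctx S n) (e : expr) (T : type S n) : Prop :=
  match e with
  | EVar v => v < size G /\ skel Phi (nth (nat0 S n) G v) T
  | EZero => skel Phi (TNat (icst S n 0) (icst S n 0)) T
  | ESucc e => exists I J, expr_ok Phi G e (TNat I J) /\
      skel Phi (TNat (iadd I (icst S n 1)) (iadd J (icst S n 1))) T
  end.

Section Vok.
Variables (n : nat) (Phi : seq (constr S n)).
Implicit Types (G : ctx S n) (T : type S n).

Lemma expr_ok_skel G e T T' : expr_ok Phi G e T -> skel Phi T T' -> expr_ok Phi G e T'.
Proof.
case: e => [v||e] /=.
- by move=> [h1 h2] h; split=> //; exact: skel_trans h2 h.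
- exact: skel_trans.
- by move=> [I [J [h1 h2]]] h; exists I, J; split=> //; exact: skel_trans h2 h.
Qed.

Lemma expr_ok_subst G G' s e T : expr_ok Phi G e T ->
  (forall v, v < size G -> fve e v -> expr_ok Phi G' (s v) (nth (nat0 S n) G v)) ->
  expr_ok Phi G' (esubst s e) T.
Proof.
elim: e T => [v||e IH] T //=.
  by move=> [h1 h2] h; apply: expr_ok_skel h2; apply: h.
by move=> [I [J [h1 h2]]] h; exists I, J; split=> //; exact: IH.
Qed.

Lemma expr_ok_sub G G' e T : expr_ok Phi G e T -> size G' = size G ->
  (forall v, v < size G -> skel Phi (nth (nat0 S n) G' v) (nth (nat0 S n) G v)) ->
  expr_ok Phi G' e T.
Proof.
move=> h hs hG; have -> : e = esubst EVar e by elim: e {h} => //= e <-.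
by apply: expr_ok_subst h _ => v hv _ /=; rewrite hs; split=> //; exact: hG.
Qed.

Lemma expr_ok_cat Ts G e T : expr_ok Phi G e T ->
  expr_ok Phi (Ts ++ G) (esubst (fun y => EVar (size Ts + y)) e) T.
Proof.
move=> h; apply: (expr_ok_subst h) => v hv _ /=.
rewrite size_cat ltn_add2l hv nth_cat ltnNge leq_addr /= addKn; split=> //; exact: skel_refl.
Qed.
End Vok.

Lemma nth_tsubst n m (sg : 'I_n -> fidx S m) (G : ctx S n) v : v < size G ->
  nth (nat0 S m) (map (tsubst sg) G) v = tsubst sg (nth (nat0 S n) G v).
Proof. by move=> h; rewrite (nth_map (nat0 S n)). Qed.

Lemma expr_ok_isubst n m (sg : 'I_n -> fidx S m) Phi Phi' (G : ctx S n) e T :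
  val_mor sg Phi Phi' -> expr_ok Phi G e T -> expr_ok Phi' (map (tsubst sg) G) e (tsubst sg T).
Proof.
move=> hs; elim: e T => [v||e IH] T.
- move=> [h1 h2]; split; first by rewrite size_map.
  by rewrite nth_tsubst //; exact: skel_subst h2.
- by move/(skel_subst hs); rewrite [tsubst sg (TNat _ _)]/tsubst !isubst_cst.
- move=> [I [J [h1 /(skel_subst hs)]]].
  rewrite [tsubst sg (TNat _ _)]/tsubst !isubst_add !isubst_cst => h2.
  exists (isubst sg I), (isubst sg J); split=> //; exact: (IH _ h1).
Qed.

End Distribution.

(** * Syntax-directed typing *)

Section SyntaxDirected.
Variable S : signature.

Definition wf_env n (Phi : seq (constr S n)) (G : ctx S n) (f : nat -> usage S n) :=
  wf_ctx Phi G /\ forall b, wf_usage Phi (f b).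

(** The usages of newly bound variables are prescribed by their types; only the outer variables take
    theirs from [f]. *)
Definition cat_usages n (Ts : seq (type S n)) (f : nat -> usage S n) (i : nat) : usage S n :=
  if i < size Ts then usage_of (nth (nat0 S n) Ts i) else f (i - size Ts).

Definition args_usage n (es : seq expr) (Ts : seq (type S n)) (b : nat) : usage S n :=
  usage_sum (size Ts) (nth EZero es) (fun i => usage_of (nth (nat0 S n) Ts i)) b.

(** Treats outputs to channels and to servers alike: [K1] is the complexity of the continuation and
    [K2] the argument of [cap_seq], which for a server includes the instantiated complexity of its
    body. *)
Definition out_type n (T : type S n) (K1 : itv S n) (Ts : seq (type S n)) (K2 : itv S n) : Prop :=
  match T with
  | TNat _ _ => False
  | TCh Ts' _ => Ts = Ts' /\ K2 = K1
  | TServ k K Ts' _ => exists Is : 'I_k -> fidx S n,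
      Ts = map (tsubst (inst Is)) Ts' /\ K2 = itv_sqcup K1 (itv_subst (inst Is) K)
  end.

(* The judgement [typing] with [Ty_sub] built into the other rules.  In
   [ty P Phi G f K] the usages that occur at the head of the types of [G] are
   ignored: the usage of the variable [b] is [f b]. *)
Fixpoint ty (P : proc) : forall n, seq (constr S n) -> ctx S n -> (nat -> usage S n) -> itv S n -> Prop :=
  fun n Phi G f K => wf_env Phi G f /\
  match P with
  | PZero => itv_incl Phi (itv_cst S n 0) K
  | PPar P Q => exists f1 f2 K1 K2,
      [/\ forall b, subusage Phi (f b) (UPar (f1 b) (f2 b)),
          ty P Phi G f1 K1, ty Q Phi G f2 K2 & itv_incl Phi (itv_sqcup K1 K2) K]
  | PTick P => exists f1 K1,
      [/\ forall b, subusage Phi (f b) (delay (CItv (itv_cst S n 1)) (f1 b)),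
          ty P Phi G f1 K1 & itv_incl Phi (itv_add K1 (itv_cst S n 1)) K]
  | PAnnot m P => exists f1 K1,
      [/\ forall b, subusage Phi (f b) (delay (CItv (itv_cst S n m)) (f1 b)),
          ty P Phi G f1 K1 & itv_incl Phi (itv_add K1 (itv_cst S n m)) K]
  | PIn a k P => exists Ts U c f1 K1,
      [/\ [/\ a < size G, nth (nat0 S n) G a = TCh Ts U, size Ts = k & wf_cap Phi c],
          subusage Phi (f a) (UAct AIn (itv_cst S n 0) c (f1 a)),
          forall b, b <> a -> subusage Phi (f b) (delay c (f1 b)),
          ty P Phi (Ts ++ G) (cat_usages Ts f1) K1 & itv_incl Phi (cap_seq c K1) K]
  | PServ a k P => exists j (K1 : itv S (j + n)) Ts U c f1,
      [/\ [/\ a < size G, nth (nat0 S n) G a = TServ K1 Ts U, size Ts = k & wf_cap Phi c],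
          subusage Phi (f a) (URep (UAct AIn (itv_cst S n 0) c (f1 a))),
          forall b, b <> a -> subusage Phi (f b) (delay c (URep (f1 b))),
          ty P (cwk j Phi) (Ts ++ map (tsubst (@wk S j n)) G)
             (cat_usages Ts (fun b => usage_subst (@wk S j n) (f1 b))) K1
        & (forall b, wf_usage Phi (f1 b)) /\ itv_incl Phi (itv_cst S n 0) K]
  | POut a es P => exists Ts c f1 K1 K2,
      [/\ [/\ a < size G, out_type (nth (nat0 S n) G a) K1 Ts K2, size es = size Ts & wf_cap Phi c],
          (forall i, i < size Ts -> expr_ok Phi G (nth EZero es i) (nth (nat0 S n) Ts i)) /\
          subusage Phi (f a) (UAct AOut (itv_cst S n 0) c (UPar (args_usage es Ts a) (f1 a))),
          forall b, b <> a -> subusage Phi (f b) (delay c (UPar (args_usage es Ts b) (f1 b))),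
          ty P Phi G f1 K1 & itv_incl Phi (cap_seq c K2) K]
  | PNu P => exists T, [/\ reliable Phi (usage_of T) & ty P Phi (T :: G) (cat_usages [:: T] f) K]
  | PMatch e P Q => wf_itv Phi K /\ exists J1 J2,
      [/\ expr_ok Phi G e (TNat J1 J2), ty P (ile J1 (icst S n 0) :: Phi) G f K &
          ty Q (ile (icst S n 1) J2 :: Phi) (TNat (ipred J1) (ipred J2) :: G)
             (cat_usages [:: TNat (ipred J1) (ipred J2)] f) K]
  end.

Lemma ty_wf_env P n (Phi : seq (constr S n)) G f K : ty P Phi G f K -> wf_env Phi G f.
Proof. by case: P => [|??|???|???|???|?|?|???|??] []. Qed.

Section Weaken.
Variables (n : nat) (Phi Phi' : seq (constr S n)).
Hypothesis weak : forall rho, all (csat rho) Phi' -> all (csat rho) Phi.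

Lemma entails_weak C : entails Phi C -> entails Phi' C.
Proof. by move=> h rho /weak /h. Qed.

Lemma itv_incl_weak A B : itv_incl Phi A B -> itv_incl Phi' A B.
Proof. by case=> /entails_weak h1 /entails_weak h2. Qed.

Lemma subusage_weak U V : subusage Phi U V -> subusage Phi' U V.
Proof. by move/(subusage_subst (val_mor_id weak)); rewrite !usage_subst_id. Qed.

Lemma wf_usage_weak U : wf_usage Phi U -> wf_usage Phi' U.
Proof. by move/(wf_usage_subst (val_mor_id weak)); rewrite !usage_subst_id. Qed.

Lemma wf_env_weak G f : wf_env Phi G f -> wf_env Phi' G f.
Proof.
case=> h1 h2; split; last by move=> b; exact: wf_usage_weak.
move/(wf_ctx_subst (val_mor_id weak)): h1; by rewrite (eq_map (@tsubst_id S n)) map_id.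
Qed.

Lemma expr_ok_weak G e T : expr_ok Phi G e T -> expr_ok Phi' G e T.
Proof.
by move/(expr_ok_isubst (val_mor_id weak)); rewrite (eq_map (@tsubst_id S n)) map_id tsubst_id.
Qed.
End Weaken.

Lemma weak_cons n (Phi : seq (constr S n)) C rho : all (csat rho) (C :: Phi) -> all (csat rho) Phi.
Proof. by move=> /= /andP []. Qed.

Lemma cap_seq_mono n (Phi : seq (constr S n)) c K K' : itv_incl Phi K K' ->
  itv_incl Phi (cap_seq c K) (cap_seq c K').
Proof. by case: c => [J|[[a|] J]] h; rewrite /cap_seq; index_arith. Qed.

Lemma out_type_skel n (Phi : seq (constr S n)) T' T K1 Ts K2 :
  skel Phi T' T -> out_type T K1 Ts K2 -> exists Ts' K2',
    [/\ out_type T' K1 Ts' K2', subtypes Phi Ts' Ts, subtypes Phi Ts Ts' & itv_incl Phi K2' K2].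
Proof.
rewrite /skel; move: (setuK T' UZero); move: (set_usage UZero T') (usage_of T') => T'' V' <-.
case: T => [J1 J2|Ts1 U|k K Ts1 U] //= /subtype_invr.
  move=> [Ts' [V [-> h1 h2 _]]] [-> ->]; exists Ts', K1; split=> //; exact: itv_incl_refl.
move=> [K' [Ts' [V [-> h1 h2 h3 _]]]] [Is [-> ->]].
have hI := val_mor_inst Is (Phi := Phi).
exists (map (tsubst (inst Is)) Ts'), (itv_sqcup K1 (itv_subst (inst Is) K')); split=> /=.
- by exists Is.
- exact: subtypes_subst hI _ _ h1.
- exact: subtypes_subst hI _ _ h2.
- apply: sqcup_incl; first exact: itv_incl_refl.
  exact: itv_eq_incl (itv_eq_subst hI h3).
Qed.

Lemma ty_K P n (Phi : seq (constr S n)) G f K K' :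
  ty P Phi G f K -> itv_incl Phi K K' -> ty P Phi G f K'.
Proof.
elim: P n Phi G f K K' => [|P IHP Q IHQ|a k P IHP|a k P IHP|a es P IHP|P IHP|P IHP|e P IHP Q IHQ|m P IHP] n Phi G f K K' /=.
- by case=> h1 h2 h; split=> //; exact: itv_incl_trans h2 h.
- case=> w [f1 [f2 [K1 [K2 [h1 h2 h3 h4]]]]] h; split=> //; exists f1, f2, K1, K2; split=> //.
  exact: itv_incl_trans h4 h.
- case=> w [j [K1 [Ts [U [c [f1 [h1 h2 h3 h4 [h5 h6]]]]]]]] h; split=> //; exists j, K1, Ts, U, c, f1.
  by split=> //; split=> //; exact: itv_incl_trans h6 h.
- case=> w [Ts [U [c [f1 [K1 [h1 h2 h3 h4 h5]]]]]] h; split=> //; exists Ts, U, c, f1, K1; split=> //.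
  exact: itv_incl_trans h5 h.
- case=> w [Ts [c [f1 [K1 [K2 [h1 h2 h3 h4 h5]]]]]] h; split=> //; exists Ts, c, f1, K1, K2; split=> //.
  exact: itv_incl_trans h5 h.
- by case=> w [T [h1 h2]] h; split=> //; exists T; split=> //; exact: IHP h2 h.
- case=> w [f1 [K1 [h1 h2 h3]]] h; split=> //; exists f1, K1; split=> //; exact: itv_incl_trans h3 h.
- case=> w [wK [J1 [J2 [h1 h2 h3]]]] h; split=> //; split; first exact: itv_incl_wf wK h.
  exists J1, J2; split=> //.
    exact: IHP h2 (itv_incl_weak (@weak_cons _ _ _) h).
  exact: IHQ h3 (itv_incl_weak (@weak_cons _ _ _) h).
- case=> w [f1 [K1 [h1 h2 h3]]] h; split=> //; exists f1, K1; split=> //; exact: itv_incl_trans h3 h.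
Qed.

Lemma cat_usages_lt n (Ts : seq (type S n)) f i : i < size Ts -> cat_usages Ts f i = usage_of (nth (nat0 S n) Ts i).
Proof. by rewrite /cat_usages => ->. Qed.

Lemma cat_usages_add n (Ts : seq (type S n)) f i : cat_usages Ts f (size Ts + i) = f i.
Proof. by rewrite /cat_usages ltnNge leq_addr /= addKn. Qed.

Lemma wf_ctx_cat n (Phi : seq (constr S n)) G1 G2 : wf_ctx Phi (G1 ++ G2) <-> wf_ctx Phi G1 /\ wf_ctx Phi G2.
Proof.
elim: G1 => [|T G IH] /=; first by split=> [h|[]] //; split=> //; constructor.
split=> [h|[h1 h2]]; inversion_clear h || inversion_clear h1.
  by have [h1 h2] := proj1 IH H0; split=> //; constructor.
by constructor=> //; apply/IH.
Qed.

Lemma wf_type_usage_of n (Phi : seq (constr S n)) T : wf_type Phi T -> wf_usage Phi (usage_of T).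
Proof. by case: T => [J1 J2|Ts U|k K Ts U] /wf_type_inv //= []. Qed.

Lemma wf_ctx_nth n (Phi : seq (constr S n)) G i : wf_ctx Phi G -> wf_type Phi (nth (nat0 S n) G i).
Proof.
move=> h; case: (ltnP i (size G)) => hi; first by move/ForallP: h; apply.
rewrite nth_default //; constructor.
Qed.

Lemma wf_env_cat n (Phi : seq (constr S n)) Ts G f :
  wf_env Phi (Ts ++ G) (cat_usages Ts f) <-> wf_ctx Phi Ts /\ wf_env Phi G f.
Proof.
split.
  case=> /wf_ctx_cat [h1 h2] h; split=> //; split=> // b.
  by have := h (size Ts + b); rewrite cat_usages_add.
case=> h1 [h2 h3]; split; first exact/wf_ctx_cat.
move=> b; rewrite /cat_usages; case: ifP => // _; apply: wf_type_usage_of; exact: wf_ctx_nth.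
Qed.

Lemma ups_add k s v : ups k s (k + v) = esubst (fun y => EVar (k + y)) (s v).
Proof. by rewrite /ups ltnNge leq_addr /= addKn. Qed.

Lemma ups_expr_ok n (Phi : seq (constr S n)) Ts' Ts G G' s (p : nat -> bool) :
  subtypes Phi Ts' Ts ->
  (forall v, v < size G -> p (size Ts + v) -> expr_ok Phi G' (s v) (nth (nat0 S n) G v)) ->
  forall v, v < size (Ts ++ G) -> p v ->
    expr_ok Phi (Ts' ++ G') (ups (size Ts) s v) (nth (nat0 S n) (Ts ++ G) v).
Proof.
move=> /subtypesP [e h] h1 v hv pv; rewrite nth_cat; case: ltnP => hvT.
  rewrite /ups hvT /= nth_cat size_cat e hvT (leq_trans hvT (leq_addr _ _)); split=> //.
  by apply: subtype_skel; apply: h; rewrite e.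
have ev : v = size Ts + (v - size Ts) by rewrite subnKC.
have h2 : expr_ok Phi G' (s (v - size Ts)) (nth (nat0 S n) G (v - size Ts)).
  apply: h1; last by rewrite -ev.
  by move: hv; rewrite {1}ev size_cat ltn_add2l.
by move: (expr_ok_cat Ts' h2); rewrite e -ups_add -ev.
Qed.

Lemma esubst_shift k e b : esubst (fun y => EVar (k + y)) e = EVar b ->
  exists2 v, e = EVar v & b = k + v.
Proof. by case: e => //= v [<-]; exists v. Qed.

(** A lifted substitution fixes the bound variables and sends no outer variable to one of them, so
    the sum splits at [size Ts] and one of the two halves vanishes for each [b]. *)
Lemma ups_usage_sum n (Phi : seq (constr S n)) Ts' Ts N s f' f :
  subtypes Phi Ts' Ts ->
  (forall b, subusage Phi (f' b) (usage_sum N s f b)) ->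
  forall b, subusage Phi (cat_usages Ts' f' b) (usage_sum (size Ts + N) (ups (size Ts) s) (cat_usages Ts f) b).
Proof.
move=> /subtypesP [e h] hf b.
apply: SU_trans _ (ucong_sub_r _ (usage_sum_add _ _ _ _ _)).
have psumE : usage_sum N (fun v => ups (size Ts) s (size Ts + v)) (fun v => cat_usages Ts f (size Ts + v)) b =
    usage_sum N (fun v => esubst (fun y => EVar (size Ts + y)) (s v)) f b.
  by apply: usage_sum_ext => v _; [rewrite ups_add|rewrite cat_usages_add].
rewrite psumE; case: (ltnP b (size Ts')) => hb.
  rewrite cat_usages_lt //; have hb' := hb; rewrite e in hb'.
  apply: SU_trans (ucong_sub_r _ (UC_par0 _)) _; apply: subusage_par.
    apply: SU_trans (ucong_sub_r _ (usage_sum_single (v := b) _ hb' _ _)).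
    - by rewrite cat_usages_lt //; have /subtypeE [] := h _ hb.
    - by rewrite /ups hb'.
    - by move=> w hw nw; rewrite /ups hw => -[].
  apply: ucong_sub_r; apply: usage_sum_zero => v _ /esubst_shift [w _ eb].
  by move: hb'; rewrite eb ltnNge leq_addr.
have eb : b = size Ts + (b - size Ts) by rewrite -e subnKC.
rewrite {1}eb -e cat_usages_add e; apply: (SU_trans (hf _)).
apply: SU_trans (ucong_sub_r _ (UPar0l _)) _; apply: subusage_par.
  apply: ucong_sub_r; apply: usage_sum_zero => v hv.
  by rewrite /ups hv => -[ev]; move: hb; rewrite -e in hv; rewrite -ev leqNgt hv.
set b1 := b - size Ts in eb *; rewrite {}eb.
elim: N {hf psumE} => /= [|N IH]; first exact: subusage_refl.
apply: subusage_par IH _; case: (s N) => /= [v||e'] ; try exact: subusage_refl.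
rewrite eqn_add2l; exact: subusage_refl.
Qed.

End SyntaxDirected.

(** * Process substitution preserves typing *)

Section Substitution.
Variable S : signature.

Lemma skel_TCh n (Phi : seq (constr S n)) T' Ts U : skel Phi T' (TCh Ts U) ->
  exists Ts' V, [/\ T' = TCh Ts' V, subtypes Phi Ts' Ts & subtypes Phi Ts Ts'].
Proof.
rewrite /skel; move: (setuK T' UZero); move: (set_usage UZero T') (usage_of T') => T'' V' <-.
by move=> /subtype_invr [Ts' [V [-> h1 h2 _]]]; exists Ts', V'.
Qed.

Lemma skel_TServ n k (Phi : seq (constr S n)) T' (K : itv S (k + n)) Ts U : skel Phi T' (TServ K Ts U) ->
  exists K' Ts' V, [/\ T' = TServ K' Ts' V, subtypes (cwk k Phi) Ts' Ts, subtypes (cwk k Phi) Ts Ts' &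
    itv_eq (cwk k Phi) K' K].
Proof.
rewrite /skel; move: (setuK T' UZero); move: (set_usage UZero T') (usage_of T') => T'' V' <-.
by move=> /subtype_invr [K' [Ts' [V [-> h1 h2 h3 _]]]]; exists K', Ts', V'.
Qed.

Lemma wf_ctx_ch n (Phi : seq (constr S n)) G a Ts U : wf_ctx Phi G ->
  nth (nat0 S n) G a = TCh Ts U -> wf_ctx Phi Ts.
Proof. by move=> /(wf_ctx_nth (Phi := Phi) a) + e; rewrite e => /wf_type_inv []. Qed.

Lemma wf_ctx_serv n k (Phi : seq (constr S n)) G a (K : itv S (k + n)) Ts U : wf_ctx Phi G ->
  nth (nat0 S n) G a = TServ K Ts U -> wf_ctx (cwk k Phi) Ts.
Proof. by move=> /(wf_ctx_nth (Phi := Phi) a) + e; rewrite e => /wf_type_inv []. Qed.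

Lemma out_type_wf n (Phi : seq (constr S n)) G a K1 Ts K2 : wf_ctx Phi G ->
  out_type (nth (nat0 S n) G a) K1 Ts K2 -> wf_ctx Phi Ts.
Proof.
move=> /(wf_ctx_nth (Phi := Phi) a); case: (nth _ _ _) => //= [Ts' U|k K Ts' U] /wf_type_inv.
  by move=> [h _] [-> _].
move=> [_ h _] [Is [-> _]]; apply: wf_ctx_subst h; exact: val_mor_inst.
Qed.

Lemma args_usage_wf n (Phi : seq (constr S n)) es Ts b : wf_ctx Phi Ts -> wf_usage Phi (args_usage es Ts b).
Proof. by move=> h; apply: usage_sum_wf => v _; apply: wf_type_usage_of; exact: wf_ctx_nth. Qed.

Lemma psubst_subject e (o : option proc) (F : nat -> proc -> proc) P' :
  (if (e, o) is (EVar b, Some Q) then Some (F b Q) else None) = Some P' ->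
  exists b Q, [/\ e = EVar b, o = Some Q & P' = F b Q].
Proof. by case: e o => // b [Q|] // [<-]; exists b, Q. Qed.

Lemma expr_ok_nth_size n (Phi : seq (constr S n)) G es Ts (i v : nat) :
  (forall i, i < size Ts -> expr_ok Phi G (nth EZero es i) (nth (nat0 S n) Ts i)) ->
  i < size Ts -> nth EZero es i = EVar v -> v < size G.
Proof. by move=> h hi e; have := h i hi; rewrite e => -[]. Qed.

(** Several variables may be sent to one name, so [f' b] has to cover the composition of all their
    usages; [usage_sum_prefix] and [usage_sum_rep_prefix] restore the prefix form that the rules for
    inputs and outputs demand. Subsumption, renaming, weakening, strengthening and parameter passing
    are all instances. *)
Lemma ty_subst P : forall n (Phi : seq (constr S n)) G f K s P' G' f',
  ty P Phi G f K -> psubst s P = Some P' -> wf_env Phi G' f' ->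
  (forall v, v < size G -> fvp P v -> expr_ok Phi G' (s v) (nth (nat0 S n) G v)) ->
  (forall b, subusage Phi (f' b) (usage_sum (size G) s f b)) -> ty P' Phi G' f' K.
Proof.
elim: P => [|P IHP Q IHQ|a k P IHP|a k P IHP|a es P IHP|P IHP|P IHP|e P IHP Q IHQ|m P IHP] n Phi G f K s P' G' f' /=.
- by move=> [_ h] [<-].
- case=> w [f1 [f2 [K1 [K2 [h1 h2 h3 h4]]]]].
  case EP: (psubst s P) => [P1|//]; case EQ: (psubst s Q) => [Q1|//] [<-] w' hv hf /=.
  have [_ wf1] := ty_wf_env h2; have [_ wf2] := ty_wf_env h3.
  split=> //; exists (usage_sum (size G) s f1), (usage_sum (size G) s f2), K1, K2; split=> //.
  + move=> b; apply: (SU_trans (hf b)).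
    apply: SU_trans _ (ucong_sub _ (usage_sum_par _ _ _ _ _)); apply: usage_sum_mono => v _ _; exact: h1.
  + apply: (IHP _ _ _ _ _ _ _ _ _ h2 EP).
    * by split; [exact: w'.1|move=> b; exact: usage_sum_wf].
    * by move=> v hv1 fv; apply: hv => //; rewrite fv.
    * move=> b; exact: subusage_refl.
  + apply: (IHQ _ _ _ _ _ _ _ _ _ h3 EQ).
    * by split; [exact: w'.1|move=> b; exact: usage_sum_wf].
    * by move=> v hv1 fv; apply: hv => //; rewrite fv orbT.
    * move=> b; exact: subusage_refl.
- case=> w [j [K1 [Ts [U [c [f1 [[ha ea sk wc] h2 h3 h4 [h5 h6]]]]]]]].
  move=> /psubst_subject [b0 [P1 [sa EP ->]]] w' hv hf /=.
  have := hv a ha; rewrite eqxx ea sa => /(_ isT) [hb0 /skel_TServ [K1' [Ts' [V [eb hT hT' eK]]]]].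
  have hsz : size Ts' = size Ts by case/subtypesP: hT.
  have [q1 q2] := usage_sum_rep_prefix ha sa wc h5 h2 h3.
  split=> //; exists j, K1', Ts', V, c, (usage_sum (size G) s f1); split=> //.
  + by split=> //; rewrite hsz.
  + exact: SU_trans (hf b0) q1.
  + move=> b hb; exact: SU_trans (hf b) (q2 b hb).
  + apply: ty_K (itv_eq_incl (itv_eq_sym eK)).
    have hwk : val_mor (@wk S j n) Phi (cwk j Phi) by exact: val_mor_cwk.
    rewrite -sk in EP; apply: (IHP _ _ _ _ _ _ _ _ _ h4 EP).
    * apply/wf_env_cat; split; first exact: wf_ctx_serv w'.1 eb.
      split; first exact: wf_ctx_subst hwk w'.1.
      by move=> b; apply: (wf_usage_subst hwk); exact: usage_sum_wf.
    * apply: ups_expr_ok => // v; rewrite size_map => hv1 fv; rewrite nth_tsubst //.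
      by apply: (expr_ok_isubst hwk); apply: hv => //; rewrite -sk fv orbT.
    * rewrite size_cat; apply: ups_usage_sum => // b; rewrite usage_sum_subst size_map; exact: subusage_refl.
  + by split=> // b; exact: usage_sum_wf.
- case=> w [Ts [U [c [f1 [K1 [[ha ea sk wc] h2 h3 h4 h5]]]]]].
  move=> /psubst_subject [b0 [P1 [sa EP ->]]] w' hv hf /=.
  have := hv a ha; rewrite eqxx ea sa => /(_ isT) [hb0 /skel_TCh [Ts' [V [eb hT hT']]]].
  have hsz : size Ts' = size Ts by case/subtypesP: hT.
  have [_ [_ wf1]] := (wf_env_cat _ _ _ _).1 (ty_wf_env h4).
  have [q1 q2] := usage_sum_prefix ha sa wc wf1 h2 h3.
  split=> //; exists Ts', V, c, (usage_sum (size G) s f1), K1; split=> //.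
  + by split=> //; rewrite hsz.
  + exact: SU_trans (hf b0) q1.
  + move=> b hb; exact: SU_trans (hf b) (q2 b hb).
  + rewrite -sk in EP; apply: (IHP _ _ _ _ _ _ _ _ _ h4 EP).
    * apply/wf_env_cat; split; first exact: wf_ctx_ch w'.1 eb.
      split; first exact: w'.1.
      by move=> b; exact: usage_sum_wf.
    * apply: ups_expr_ok => // v hv1 fv; by apply: hv => //; rewrite -sk fv orbT.
    * rewrite size_cat; apply: ups_usage_sum => // b; exact: subusage_refl.
- case=> w [Ts [c [f1 [K1 [K2 [[ha ea ses wc] [hes h2] h3 h4 h5]]]]]].
  move=> /psubst_subject [b0 [P1 [sa EP ->]]] w' hv hf /=.
  have := hv a ha; rewrite eqxx sa => /(_ isT) [hb0 /out_type_skel /(_ ea) [Ts' [K2' [eb hT hT' hK]]]].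
  have hsz : size Ts' = size Ts by case/subtypesP: hT.
  have [_ wf1] := ty_wf_env h4.
  have wTs := out_type_wf w.1 ea; have wTs' := out_type_wf w'.1 eb.
  have wf2 v : wf_usage Phi (UPar (args_usage es Ts v) (f1 v)) by split=> //; exact: args_usage_wf.
  have [q1 q2] := usage_sum_prefix ha sa wc wf2 h2 h3.
  (* The usage of an argument passes from its position to a variable and then along [s];
     [usage_sum_comp] composes the two maps, and the prescribed usages are converted from [Ts] to
     [Ts']. *)
  have hout b : subusage Phi (usage_sum (size G) s (fun v => UPar (args_usage es Ts v) (f1 v)) b)
      (UPar (args_usage (map (esubst s) es) Ts' b) (usage_sum (size G) s f1 b)).
    apply: (SU_trans (ucong_sub _ (usage_sum_par _ _ _ _ _))); apply: SU_compat_par.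
    apply: (SU_trans (@usage_sum_comp S n Phi (size G) (size Ts) s (nth EZero es) (fun i => usage_of (nth (nat0 S n) Ts i)) b _)).
      move=> i v hi; exact: expr_ok_nth_size hes hi.
    rewrite /args_usage hsz (@usage_sum_ext _ _ _ _ (nth EZero [seq esubst s i | i <- es])
      (fun i => usage_of (nth (nat0 S n) Ts i)) (fun i => usage_of (nth (nat0 S n) Ts i))) //.
      apply: usage_sum_mono => v hv1 _; case/subtypesP: hT' => _ /(_ v hv1).
      by case/subtypeE.
    by move=> v hv1; rewrite (nth_map EZero) // ses.
  split=> //; exists Ts', c, (usage_sum (size G) s f1), K1, K2'; split=> //.
  + by split=> //; rewrite size_map hsz.
  + split.
      move=> i hi; rewrite hsz in hi; rewrite (nth_map EZero) ?ses //.
      apply: expr_ok_skel (subtype_skel (proj2 ((subtypesP _ _ _).1 hT') i hi)).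
      apply: (expr_ok_subst (hes i hi)) => v hv1 fv; apply: hv => //.
      apply/or3P; apply: Or32; apply/(has_nthP EZero); exists i => //.
      by rewrite ses.
    apply: (SU_trans (SU_trans (hf b0) q1)); exact: SU_compat_act.
  + move=> b hb; apply: (SU_trans (SU_trans (hf b) (q2 b hb))); apply: (@delay_sub _ _ _ _ _ (UPar _ _)) => //.
    exact: usage_sum_wf.
  + apply: (IHP _ _ _ _ _ _ _ _ _ h4 EP).
    * by split; [exact: w'.1|move=> b; exact: usage_sum_wf].
    * by move=> v hv1 fv; apply: hv => //; rewrite fv !orbT.
    * move=> b; exact: subusage_refl.
  + apply: itv_incl_trans h5; exact: cap_seq_mono.
- case=> w [T [hT h]]; case EP: (psubst _ P) => [P1|//] [<-] w' hv hf /=.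
  split=> //; exists T; split=> //.
  have [/(wf_ctx_cat _ [:: T]) [wT _] _] := ty_wf_env h.
  apply: (IHP _ _ _ _ _ _ _ _ _ h EP).
  + by apply/(wf_env_cat _ [:: T]).
  + apply: (@ups_expr_ok _ _ _ [:: T] [:: T]); first exact: subtypes_refl.
    by move=> v hv1 fv; apply: hv.
  + apply: (@ups_usage_sum _ _ _ [:: T] [:: T] (size G)) => //; exact: subtypes_refl.
- case=> w [f1 [K1 [h1 h2 h3]]]; case EP: (psubst _ P) => [P1|//] [<-] w' hv hf /=.
  have [_ wf1] := ty_wf_env h2.
  split=> //; exists (usage_sum (size G) s f1), K1; split=> //.
  + move=> b; apply: (SU_trans (hf b)); rewrite usage_sum_delay; apply: usage_sum_mono => v _ _; exact: h1.
  + apply: (IHP _ _ _ _ _ _ _ _ _ h2 EP) => //.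
    * by split; [exact: w'.1|move=> b; exact: usage_sum_wf].
    * move=> b; exact: subusage_refl.
- case=> w [wK [J1 [J2 [h1 h2 h3]]]].
  case EP: (psubst s P) => [P1|//]; case EQ: (psubst _ Q) => [Q1|//] [<-] w' hv hf /=.
  have wk C := @weak_cons _ _ Phi C.
  split=> //; split=> //; exists J1, J2; split.
  + apply: (expr_ok_subst h1) => v hv1 fv; apply: hv => //; by rewrite fv.
  + apply: (IHP _ _ _ _ _ _ _ _ _ h2 EP).
    * exact (wf_env_weak (wk _) w').
    * by move=> v hv1 fv; apply: (expr_ok_weak (wk _)); apply: hv => //; rewrite fv orbT.
    * move=> b; exact (subusage_weak (wk _) (hf b)).
  + apply: (IHQ _ _ _ _ _ _ _ _ _ h3 EQ).
    * apply/(wf_env_cat _ [:: TNat _ _]); split; last exact (wf_env_weak (wk _) w').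
      by constructor; constructor.
    * apply: (@ups_expr_ok _ _ _ [:: TNat _ _] [:: TNat _ _]); first exact: subtypes_refl.
      by move=> v hv1 fv; apply: (expr_ok_weak (wk _)); apply: hv => //; rewrite fv !orbT.
    * apply: (@ups_usage_sum _ _ _ [:: TNat _ _] [:: TNat _ _] (size G)); first exact: subtypes_refl.
      move=> b; exact (subusage_weak (wk _) (hf b)).
- case=> w [f1 [K1 [h1 h2 h3]]]; case EP: (psubst _ P) => [P1|//] [<-] w' hv hf /=.
  have [_ wf1] := ty_wf_env h2.
  split=> //; exists (usage_sum (size G) s f1), K1; split=> //.
  + move=> b; apply: (SU_trans (hf b)); rewrite usage_sum_delay; apply: usage_sum_mono => v _ _; exact: h1.
  + apply: (IHP _ _ _ _ _ _ _ _ _ h2 EP) => //.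
    * by split; [exact: w'.1|move=> b; exact: usage_sum_wf].
    * move=> b; exact: subusage_refl.
Qed.

End Substitution.

(** * Renaming and substitution of process variables *)

Lemma esubst_id e : esubst EVar e = e.
Proof. by elim: e => //= e ->. Qed.

Lemma esubst_comp s t e : esubst s (esubst t e) = esubst (fun x => esubst s (t x)) e.
Proof. by elim: e => //= e ->. Qed.

Lemma ups_id k : ups k EVar = EVar.
Proof.
apply: functional_extensionality => x; rewrite /ups; case: ltnP => //= h.
by rewrite subnKC.
Qed.

Lemma ups_ren k r : ups k (fun x => EVar (r x)) = fun x => EVar (upr k r x).
Proof. by apply: functional_extensionality => x; rewrite /ups /upr; case: ltnP. Qed.

Lemma ups_upr k s r : (fun x => ups k s (upr k r x)) = ups k (fun x => s (r x)).
Proof.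
apply: functional_extensionality => x; rewrite {2}/ups /upr; case: ltnP => h.
  by rewrite /ups h.
by rewrite ups_add.
Qed.

Lemma psubst_ren r P : psubst (fun x => EVar (r x)) P = Some (pren r P).
Proof.
elim: P r => //= [P IHP Q IHQ|a k P IHP|a k P IHP|a es P IHP|P IHP|P IHP|e P IHP Q IHQ|m P IHP] r;
  by rewrite ?ups_ren ?IHP ?IHQ.
Qed.

Lemma psubst_pren s r P : psubst s (pren r P) = psubst (fun x => s (r x)) P.
Proof.
elim: P s r => //= [P IHP Q IHQ|a k P IHP|a k P IHP|a es P IHP|P IHP|P IHP|e P IHP Q IHQ|m P IHP] s r;
  rewrite ?IHP ?IHQ ?ups_upr //; last by rewrite esubst_comp.
case: (s (r a)) => // b; case: (psubst _ _) => // P'; congr (Some (POut _ _ _)).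
by rewrite -map_comp; apply: eq_map => e /=; rewrite esubst_comp.
Qed.

Lemma psubst_id P : psubst EVar P = Some P.
Proof.
elim: P => //= [P IHP Q IHQ|a k P IHP|a k P IHP|a es P IHP|P IHP|P IHP|e P IHP Q IHQ|m P IHP];
  rewrite ?ups_id ?IHP ?IHQ ?esubst_id //.
by rewrite (eq_map esubst_id) map_id.
Qed.

Lemma pren_pren r1 r2 P : pren r1 (pren r2 P) = pren (fun x => r1 (r2 x)) P.
Proof. by apply: Some_inj; rewrite -psubst_ren psubst_pren -psubst_ren. Qed.

Lemma pren_id P : pren (fun x => x) P = P.
Proof. by apply: Some_inj; rewrite -psubst_ren psubst_id. Qed.

Lemma fve_ren r e x : fve (esubst (fun y => EVar (r y)) e) x -> exists2 y, x = r y & fve e y.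
Proof. by elim: e => //= y /eqP <-; exists y. Qed.

Lemma upr_add k r y x : k + x = upr k r y -> exists2 y', y = k + y' & x = r y'.
Proof.
rewrite /upr; case: ltnP => h e; first by move: h; rewrite -e ltnNge leq_addr.
by exists (y - k); [rewrite subnKC|move/addnI: e].
Qed.

Lemma fvp_ren P r x : fvp (pren r P) x -> exists2 y, x = r y & fvp P y.
Proof.
have bnd k r' (p : nat -> bool) x' : (exists2 y, k + x' = upr k r' y & p y) -> exists2 y, x' = r' y & p (k + y).
  by move=> [y /upr_add [y' -> e] h]; exists y'.
elim: P r x => /= [|P IHP Q IHQ|a k P IHP|a k P IHP|a es P IHP|P IHP|P IHP|e P IHP Q IHQ|m P IHP] r x.
- by [].
- case/orP => [/IHP|/IHQ] [y -> h]; exists y => //; by rewrite h ?orbT.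
- case/orP => [/eqP <-|/IHP /bnd [y -> h]]; first by exists a => //; rewrite eqxx.
  by exists y => //; rewrite h orbT.
- case/orP => [/eqP <-|/IHP /bnd [y -> h]]; first by exists a => //; rewrite eqxx.
  by exists y => //; rewrite h orbT.
- case/or3P => [/eqP <-|h|/IHP [y -> h]]; first by exists a => //; rewrite eqxx.
    elim: es h => //= e es IH /orP [/fve_ren [y -> h]|/IH [y e1 /or3P [h|h|h]]].
    + by exists y => //; rewrite h orbT.
    + by exists y => //; rewrite h.
    + by exists y => //; rewrite h !orbT.
    + by exists y => //; rewrite h !orbT.
  by exists y => //; rewrite h !orbT.
- by move=> /IHP /bnd.
- exact: IHP.
- case/or3P => [/fve_ren [y -> h]|/IHP [y -> h]|/IHQ /bnd [y -> h]]; exists y => //; by rewrite h ?orbT.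
- exact: IHP.
Qed.

(** * Structural rules as instances of substitution, and index substitution in typings *)

Section Structural.
Variable S : signature.

(** At most one variable reaches [b]; if none does, [U] is discarded by [SU_zero]. *)
Lemma usage_sum_inj n (Phi : seq (constr S n)) N s f b U :
  (forall v, v < N -> s v = EVar b -> subusage Phi U (f v)) ->
  (forall v w, v < N -> w < N -> s v = EVar b -> s w = EVar b -> v = w) ->
  subusage Phi U (usage_sum N s f b).
Proof.
move=> h inj; case: (classic (exists2 v, v < N & s v = EVar b)) => [[v hv e]|hN].
  apply: (SU_trans (h v hv e)); apply: ucong_sub_r; apply: usage_sum_single => // w hw nw e'.
  by apply: nw; apply: inj.
apply: SU_trans (SU_zero _ _) _; apply: ucong_sub_r; apply: usage_sum_zero => v hv e.
by case: hN; exists v.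
Qed.

Lemma ty_sub P n (Phi : seq (constr S n)) G f K G' f' K' :
  ty P Phi G f K -> wf_env Phi G' f' -> size G' = size G ->
  (forall v, v < size G -> skel Phi (nth (nat0 S n) G' v) (nth (nat0 S n) G v)) ->
  (forall b, b < size G -> subusage Phi (f' b) (f b)) -> itv_incl Phi K K' ->
  ty P Phi G' f' K'.
Proof.
move=> h w hs hG hf /(ty_K _); apply.
apply: (ty_subst h (psubst_id P) w).
  by move=> v hv _ /=; rewrite hs; split=> //; exact: hG.
move=> b; apply: usage_sum_inj; first by move=> v hv [<-]; exact: hf.
by move=> v w' _ _ [->] [->].
Qed.

Lemma ty_usage P n (Phi : seq (constr S n)) G f f' K K' :
  ty P Phi G f K -> (forall b, wf_usage Phi (f' b)) ->
  (forall b, subusage Phi (f' b) (f b)) -> itv_incl Phi K K' -> ty P Phi G f' K'.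
Proof.
move=> h w hf hK; apply: (ty_sub h) => //; first by split=> //; exact: (ty_wf_env h).1.
by move=> v _; exact: skel_refl.
Qed.

Lemma ty_ren P n (Phi : seq (constr S n)) G f K r G' f' :
  ty P Phi G f K -> wf_env Phi G' f' ->
  (forall v, v < size G -> fvp P v -> r v < size G' /\ skel Phi (nth (nat0 S n) G' (r v)) (nth (nat0 S n) G v)) ->
  (forall v, v < size G -> subusage Phi (f' (r v)) (f v)) ->
  injective r -> ty (pren r P) Phi G' f' K.
Proof.
move=> h w hv hf hr; apply: (ty_subst h (psubst_ren r P) w hv).
move=> b; apply: usage_sum_inj; first by move=> v lv [<-]; exact: hf.
by move=> v w' _ _ [e1] [e2]; apply: hr; rewrite e1.
Qed.

Lemma ty_weaken P n (Phi : seq (constr S n)) G f K T : wf_type Phi T ->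
  ty P Phi G f K -> ty (pren succn P) Phi (T :: G) (cat_usages [:: T] f) K.
Proof.
move=> wT h; apply: (ty_ren h).
- apply/(wf_env_cat _ [:: T]); split; [by constructor|exact: ty_wf_env h].
- by move=> v hv _ /=; split=> //; exact: skel_refl.
- move=> v hv; rewrite /cat_usages /= subn1; exact: subusage_refl.
- exact: succn_inj.
Qed.

Lemma ty_strengthen P n (Phi : seq (constr S n)) G f K T :
  ty (pren succn P) Phi (T :: G) (cat_usages [:: T] f) K -> ty P Phi G f K.
Proof.
(* [EZero] is a dummy value: the variable 0 is not free in [pren succn P]. *)
move=> h; pose s x := if x is y.+1 then EVar y else EZero.
have e : psubst s (pren succn P) = Some P by rewrite psubst_pren psubst_id.
apply: (ty_subst h e).
- by have /(wf_env_cat _ [:: T]) [] := ty_wf_env h.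
- move=> [|v] hv; first by move=> /fvp_ren [].
  by move=> _ /=; split=> //; exact: skel_refl.
- move=> b; apply: usage_sum_inj; last by move=> [|v] [|w] //= _ _ [->] [->].
  move=> [|v] //= hv [->]; rewrite /cat_usages /= subn1; exact: subusage_refl.
Qed.

(** The sum over [Ts ++ G] splits into the usages passed with the arguments and those of the
    context, on which [einst] only undoes the shift. *)
Lemma ty_einst P P' n (Phi : seq (constr S n)) Ts es G f f' K :
  ty P Phi (Ts ++ G) (cat_usages Ts f) K -> size es = size Ts ->
  psubst (einst es) P = Some P' ->
  (forall i, i < size Ts -> expr_ok Phi G (nth EZero es i) (nth (nat0 S n) Ts i)) ->
  (forall b, wf_usage Phi (f' b)) ->
  (forall b, subusage Phi (f' b) (UPar (args_usage es Ts b) (f b))) ->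
  ty P' Phi G f' K.
Proof.
move=> h hs e hv w hf; have /wf_env_cat [wTs [wG wf]] := ty_wf_env h.
apply: (ty_subst h e) => //.
- move=> v; rewrite size_cat /einst nth_cat hs => lv _; case: ltnP => hT; first exact: hv.
  by rewrite /= ltn_subLR //; split=> //; exact: skel_refl.
- move=> b; rewrite size_cat; apply: (SU_trans (hf b)).
  apply: SU_trans _ (ucong_sub_r _ (usage_sum_add _ _ _ _ _)); apply: subusage_par.
    rewrite /args_usage (@usage_sum_ext _ _ _ _ (einst es) _ (cat_usages Ts f)); first exact: subusage_refl.
      by move=> v lv; rewrite /einst hs lv.
    by move=> v lv _; rewrite cat_usages_lt.
  apply: usage_sum_inj.
    by move=> v lv; rewrite /einst hs ltnNge leq_addr /= addKn => -[->]; rewrite cat_usages_add; exact: subusage_refl.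
  by move=> v v' _ _; rewrite /einst hs !ltnNge !leq_addr /= !addKn => -[->] [->].
Qed.

Lemma cat_usages_subst n m (sg : 'I_n -> fidx S m) Ts f :
  (fun b => usage_subst sg (cat_usages Ts f b)) = cat_usages (map (tsubst sg) Ts) (fun b => usage_subst sg (f b)).
Proof.
apply: functional_extensionality => b; rewrite /cat_usages size_map; case: ifP => // h.
by rewrite nth_tsubst // usage_of_subst.
Qed.

Lemma args_usage_subst n m (sg : 'I_n -> fidx S m) es Ts b :
  usage_subst sg (args_usage es Ts b) = args_usage es (map (tsubst sg) Ts) b.
Proof.
rewrite /args_usage usage_sum_subst size_map; apply: usage_sum_ext => // v hv _.
by rewrite nth_tsubst // usage_of_subst.
Qed.

Lemma out_type_subst n m (sg : 'I_n -> fidx S m) T K1 Ts K2 : out_type T K1 Ts K2 ->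
  out_type (tsubst sg T) (itv_subst sg K1) (map (tsubst sg) Ts) (itv_subst sg K2).
Proof.
case: T => //= [Ts' U|k K Ts' U]; first by move=> [-> ->].
move=> [Is [-> ->]]; exists (fun j => fsubst sg (Is j)); rewrite itv_subst_sqcup itv_subst_inst; split=> //.
by rewrite -!map_comp; apply: eq_map => T /=; exact: tsubst_inst.
Qed.

Lemma wf_env_subst n m (sg : 'I_n -> fidx S m) Phi Phi' G f : val_mor sg Phi Phi' ->
  wf_env Phi G f -> wf_env Phi' (map (tsubst sg) G) (fun b => usage_subst sg (f b)).
Proof.
by move=> hs [h1 h2]; split; [exact: (wf_ctx_subst hs h1)|move=> b; exact: (wf_usage_subst hs (h2 b))].
Qed.

Lemma csubst_ile n m (sg : 'I_n -> fidx S m) I J :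
  csubst sg (ile I J) = ile (isubst sg I) (isubst sg J).
Proof. by []. Qed.

Lemma ty_isubst P : forall n (Phi : seq (constr S n)) G f K m (sg : 'I_n -> fidx S m) Phi',
  val_mor sg Phi Phi' -> ty P Phi G f K ->
  ty P Phi' (map (tsubst sg) G) (fun b => usage_subst sg (f b)) (itv_subst sg K).
Proof.
elim: P => [|P IHP Q IHQ|a k P IHP|a k P IHP|a es P IHP|P IHP|P IHP|e P IHP Q IHQ|m P IHP] n Phi G f K m' sg Phi' hs /= [w h];
  (split; first exact: wf_env_subst hs w).
- by move/(itv_incl_subst hs): h; rewrite itv_subst_cst.
- case: h => f1 [f2 [K1 [K2 [h1 h2 h3 h4]]]].
  exists (fun b => usage_subst sg (f1 b)), (fun b => usage_subst sg (f2 b)), (itv_subst sg K1), (itv_subst sg K2); split.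
  + by move=> b; move/(subusage_subst hs): (h1 b).
  + exact: (IHP _ _ _ _ _ _ _ _ hs h2).
  + exact: (IHQ _ _ _ _ _ _ _ _ hs h3).
  + by rewrite -itv_subst_sqcup; exact: (itv_incl_subst hs h4).
- case: h => j [K1 [Ts [U [c [f1 [[ha ea sk wc] h2 h3 h4 [h5 h6]]]]]]].
  exists j, (itv_subst (up sg) K1), (map (tsubst (up sg)) Ts), (usage_subst sg U), (cap_subst sg c), (fun b => usage_subst sg (f1 b)); split.
  + by split; [rewrite size_map|rewrite nth_tsubst // ea|rewrite size_map|exact: (wf_cap_subst hs wc)].
  + by move/(subusage_subst hs): h2; rewrite /= itv_subst_cst.
  + by move=> b /h3 /(subusage_subst hs); rewrite /= usage_subst_delay.
  + have := IHP _ _ _ _ _ _ _ _ (val_mor_up (k := j) hs) h4.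
    rewrite cat_usages_subst map_cat -!map_comp.
    rewrite (eq_map (g := tsubst (wk S j (n := m')) \o tsubst sg)); last by move=> T /=; exact: up_wk.
    by under [fun b => usage_subst (up sg) _]functional_extensionality => b do rewrite usage_up_wk.
  + split; first by move=> b; exact: (wf_usage_subst hs (h5 b)).
    by move/(itv_incl_subst hs): h6; rewrite itv_subst_cst.
- case: h => Ts [U [c [f1 [K1 [[ha ea sk wc] h2 h3 h4 h5]]]]].
  exists (map (tsubst sg) Ts), (usage_subst sg U), (cap_subst sg c), (fun b => usage_subst sg (f1 b)), (itv_subst sg K1); split.
  + by split; [rewrite size_map|rewrite nth_tsubst // ea|rewrite size_map|exact: (wf_cap_subst hs wc)].
  + by move/(subusage_subst hs): h2; rewrite /= itv_subst_cst.
  + by move=> b /h3 /(subusage_subst hs); rewrite /= usage_subst_delay.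
  + by move: (IHP _ _ _ _ _ _ _ _ hs h4); rewrite cat_usages_subst map_cat.
  + by rewrite -cap_subst_seq; exact: (itv_incl_subst hs h5).
- case: h => Ts [c [f1 [K1 [K2 [[ha ea ses wc] [hes h2] h3 h4 h5]]]]].
  exists (map (tsubst sg) Ts), (cap_subst sg c), (fun b => usage_subst sg (f1 b)), (itv_subst sg K1), (itv_subst sg K2); split.
  + by split; [rewrite size_map|rewrite nth_tsubst //; exact: out_type_subst|rewrite size_map|exact: (wf_cap_subst hs wc)].
  + split; last by move/(subusage_subst hs): h2; rewrite /= itv_subst_cst args_usage_subst.
    by move=> i; rewrite size_map => hi; rewrite nth_tsubst //; exact: (expr_ok_isubst hs (hes i hi)).
  + by move=> b /h3 /(subusage_subst hs); rewrite /= !usage_subst_delay args_usage_subst.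
  + exact: (IHP _ _ _ _ _ _ _ _ hs h4).
  + by rewrite -cap_subst_seq; exact: (itv_incl_subst hs h5).
- case: h => T [h1 h2]; exists (tsubst sg T); split.
    rewrite usage_of_subst; apply: (reliable_subst hs) h1.
    by have /(wf_env_cat _ [:: T]) [wT _] := ty_wf_env h2; apply: wf_type_usage_of; inversion_clear wT.
  by move: (IHP _ _ _ _ _ _ _ _ hs h2); rewrite cat_usages_subst.
- case: h => f1 [K1 [h1 h2 h3]].
  exists (fun b => usage_subst sg (f1 b)), (itv_subst sg K1); split.
  + by move=> b; move/(subusage_subst hs): (h1 b); rewrite usage_subst_delay /= itv_subst_cst.
  + exact: (IHP _ _ _ _ _ _ _ _ hs h2).
  + by move/(itv_incl_subst hs): h3; rewrite itv_subst_add itv_subst_cst.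
- case: h => wK [J1 [J2 [h1 h2 h3]]]; split; first exact: (wf_itv_subst hs wK).
  exists (isubst sg J1), (isubst sg J2); split.
  + exact: (expr_ok_isubst hs h1).
  + have := IHP _ _ _ _ _ _ _ _ (val_mor_cons (C := ile J1 (icst S n 0)) hs) h2.
    by rewrite csubst_ile isubst_cst.
  + have := IHQ _ _ _ _ _ _ _ _ (val_mor_cons (C := ile (icst S n 1) J2) hs) h3.
    by rewrite cat_usages_subst csubst_ile isubst_cst /= !isubst_pred.
- case: h => f1 [K1 [h1 h2 h3]].
  exists (fun b => usage_subst sg (f1 b)), (itv_subst sg K1); split.
  + by move=> b; move/(subusage_subst hs): (h1 b); rewrite usage_subst_delay /= itv_subst_cst.
  + exact: (IHP _ _ _ _ _ _ _ _ hs h2).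
  + by move/(itv_incl_subst hs): h3; rewrite itv_subst_add itv_subst_cst.
Qed.

End Structural.

(** * Equivalence of the two typing judgements *)

Section Conversion.
Variable S : signature.

Definition usages n (G : ctx S n) (b : nat) : usage S n := usage_of (nth (nat0 S n) G b).
(** Only one composite with [usages] is the identity: the values of [f] at variables of type [TNat],
    and outside the context, are lost. *)
Definition assign n (G : ctx S n) (f : nat -> usage S n) : ctx S n :=
  mkseq (fun i => set_usage (f i) (nth (nat0 S n) G i)) (size G).

Section Fixed.
Variables (n : nat) (Phi : seq (constr S n)).
Implicit Types (G : ctx S n) (f g : nat -> usage S n).

Lemma usages_cat Ts G : usages (Ts ++ G) = cat_usages Ts (usages G).
Proof.
apply: functional_extensionality => b; rewrite /usages nth_cat /cat_usages; by case: ifP.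
Qed.

Lemma usages_wf G : wf_ctx Phi G -> wf_env Phi G (usages G).
Proof. by move=> h; split=> // b; apply: wf_type_usage_of; exact: wf_ctx_nth. Qed.

Lemma usages_delay c G b : usages (cdelay c G) b = delay c (usages G b).
Proof.
rewrite /usages; case: (ltnP b (size G)) => h; last by rewrite !nth_default ?size_map.
by rewrite (nth_map (nat0 S n)) //; case: (nth _ _ _).
Qed.

Lemma usages_rep G b : ucong (usages (crep G) b) (URep (usages G b)).
Proof.
rewrite /usages; case: (ltnP b (size G)) => h; last by rewrite !nth_default ?size_map //; exact: UC_sym (UC_rep0 _ _).
rewrite (nth_map (nat0 S n)) //; case: (nth _ _ _) => * /=; try exact: UC_refl.
exact: UC_sym (UC_rep0 _ _).
Qed.

Lemma map_strip_usage (h : usage S n -> usage S n) G :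
  map (set_usage UZero) (map (map_usage h) G) = map (set_usage UZero) G.
Proof. by rewrite -map_comp; apply: eq_map => -[]. Qed.

Lemma wf_type_set_usage T U : wf_type Phi T -> wf_usage Phi U -> wf_type Phi (set_usage U T).
Proof.
case: T => [J1 J2|Ts V|k K Ts V] /wf_type_inv /=; first by constructor.
  by case=> *; constructor.
by case=> *; constructor.
Qed.

Lemma wf_ctx_same G G' : map (set_usage UZero) G' = map (set_usage UZero) G -> wf_ctx Phi G ->
  (forall b, wf_usage Phi (usages G' b)) -> wf_ctx Phi G'.
Proof.
move=> e w h; apply/ForallP => i hi; have hs : size G = size G' by rewrite -(size_map (set_usage UZero)) -e size_map.
rewrite -[nth _ _ _](setuK _ UZero); apply: wf_type_set_usage; last exact: h.
have -> : set_usage UZero (nth (nat0 S n) G' i) = set_usage UZero (nth (nat0 S n) G i).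
  by rewrite -!(nth_map _ (nat0 S n)) ?hs // e.
apply: wf_type_set_usage => //; exact: wf_ctx_nth.
Qed.

Lemma ty_same P G f K G' f' : ty P Phi G f K -> map (set_usage UZero) G' = map (set_usage UZero) G ->
  wf_env Phi G' f' -> (forall b, subusage Phi (f' b) (f b)) -> ty P Phi G' f' K.
Proof.
move=> h e w hf; have hs : size G' = size G by rewrite -(size_map (set_usage UZero)) e size_map.
apply: (ty_sub h) => //; last exact: itv_incl_refl.
move=> v hv; apply: set_usage_strip.
by rewrite -!(nth_map _ (nat0 S n)) ?hs // e.
Qed.

Lemma cpar_usages G1 G2 G : cpar G1 G2 G ->
  [/\ map (set_usage UZero) G1 = map (set_usage UZero) G, map (set_usage UZero) G2 = map (set_usage UZero) G &
    forall b, ucong (usages G b) (UPar (usages G1 b) (usages G2 b))].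
Proof.
elim=> [|T1 T2 T H1 H2 H hT _ [e1 e2 h]].
  by split=> // b; rewrite /usages !nth_default //=; exact: UC_sym (UC_par0 _).
by split=> /=; [rewrite e1; case: hT|rewrite e2; case: hT|case=> [|b];
   [rewrite /usages /=; case: hT => *; [exact: UC_sym (UC_par0 _)|exact: UC_refl|exact: UC_refl]|exact: h]].
Qed.

(** Congruence can rewrite [UZero] into larger usages, so the invariant is that [UZero] is a
    subusage of whatever is reached. A synchronization there would be reflected by [sync_sub] to one
    of [UZero], which has no prefix. *)
Lemma reliable_zero : reliable Phi UZero.
Proof.
have hsync V A c U1 B d U2 R : subusage Phi UZero V -> ~ sync V A c U1 B d U2 R.
  move=> h hs; have [? [? [? [? [? [? [? [[? /wpickE]]]]]]]]] := sync_sub h (I : wf_usage Phi UZero) hs.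
  by [].
have inv U V : usteps Phi U V -> subusage Phi UZero U -> subusage Phi UZero V.
  elim=> {U V} [U V|//|U V W _ h1 _ h2 h]; last exact: h2 (h1 h).
  move=> /ustep_inv [[? [? [? [? [? [? [? [hs _]]]]]]]] /hsync /(_ hs)|[W [->] h h']] //.
  exact: SU_trans h' h.
move=> [V hV /ustep_inv [[? [? [? [? [? [? [? [hs _]]]]]]]]|[] //]].
by apply: hsync hs; apply: inv hV _; exact: subusage_refl.
Qed.

Lemma subtypes_usages G G' : subtypes Phi G G' -> forall b, subusage Phi (usages G b) (usages G' b).
Proof.
move=> /subtypesP [e h] b; rewrite /usages; case: (ltnP b (size G)) => hb; first by have /subtypeE [] := h b hb.
rewrite !nth_default -?e //; exact: subusage_refl.
Qed.

Lemma contrib_zero e b : @contrib S n e UZero b = UZero.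
Proof. by case: e => //= v; case: eqP. Qed.

Lemma onth_nth G v T : onth G v = Some T -> v < size G /\ nth (nat0 S n) G v = T.
Proof. by elim: G v => [|T' G IH] [|v] //=; [case|exact: IH]. Qed.

Lemma etyping_expr_ok G e T : etyping Phi G e T ->
  [/\ wf_ctx Phi G, wf_type Phi T, expr_ok Phi G e T & forall b, subusage Phi (usages G b) (contrib e (usage_of T) b)].
Proof.
elim=> {G e T}.
- move=> G v T w /onth_nth [hv eT].
  split=> //; first by rewrite -eT; exact: wf_ctx_nth.
    by rewrite /= eT; split=> //; exact: skel_refl.
  move=> b /=; case: eqP => [<-|_]; last exact: SU_zero.
  by rewrite /usages eT; exact: subusage_refl.
- move=> G w; split=> //; [by constructor|exact: skel_refl|by move=> b; exact: SU_zero].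
- move=> G e J1 J2 _ [w _ h1 h2]; split=> //; [by constructor| |by move=> b; exact: SU_zero].
  by exists J1, J2; split=> //; exact: skel_refl.
- move=> G D e T T' w wT _ [_ _ h1 h2] hG hT; split=> //.
    apply: expr_ok_skel (subtype_skel hT).
    move/subtypesP: hG => [e1 hG]; apply: (expr_ok_sub h1) => // v; rewrite -e1 => hv.
    by apply: subtype_skel; exact: hG.
  move=> b; apply: SU_trans (subtypes_usages hG b) _; apply: (SU_trans (h2 b)).
  have /subtypeE [_ hu] := hT; case: e {h1 h2} => [v||e] /=; try exact: subusage_refl.
  by case: eqP => // _; exact: subusage_refl.
Qed.

Lemma onth_nth_lt G v : v < size G -> onth G v = Some (nth (nat0 S n) G v).
Proof. by elim: G v => [|T' G IH] [|v] //=; exact: IH. Qed.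

Lemma expr_ok_etyping G e T : wf_ctx Phi G -> wf_type Phi T -> expr_ok Phi G e T ->
  (forall b, subusage Phi (usages G b) (contrib e (usage_of T) b)) -> etyping Phi G e T.
Proof.
elim: e T => [v||e IH] T w wT.
- move=> [hv hs] hb; apply: (ET_sub w wT (ET_var w (onth_nth_lt hv)) (subtypes_refl _ _)).
  by apply/subtypeE; split=> //; have := hb v; rewrite /= eqxx.
- move=> h _; apply: (ET_sub w wT (ET_zero w) (subtypes_refl _ _)).
  apply/subtypeE; split=> //; case: T h {wT} => [J1 J2|Ts U|k K Ts U] /subtype_inv /= [?] [?] [] //.
  move=> *; exact: SU_zero.
- move=> [J1 [J2 [h1 h2]]] _.
  have h3 : etyping Phi G e (TNat J1 J2).
    by apply: IH => //; [constructor|move=> b; rewrite contrib_zero; exact: SU_zero].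
  apply: (ET_sub w wT (ET_succ h3) (subtypes_refl _ _)).
  apply/subtypeE; split=> //; case: T h2 {wT} => [I1 I2|Ts U|k K Ts U] /subtype_inv /= [?] [?] [] //.
  move=> *; exact: SU_zero.
Qed.

(** [usage_sum] grows at its last index and a tuple at its first; splitting off one term with
    [usage_sum_add] bridges the two. *)
Lemma args_usage_cons e es (T : type S n) Ts b :
  ucong (args_usage (e :: es) (T :: Ts) b) (UPar (contrib e (usage_of T) b) (args_usage es Ts b)).
Proof.
apply: UC_trans (usage_sum_add 1 _ _ _ _) _; apply: UC_par (UC_refl _); exact: UPar0l.
Qed.

Lemma etypings_expr_ok G es Ts : etypings Phi G es Ts ->
  [/\ wf_ctx Phi G, size es = size Ts,
    forall i, i < size Ts -> expr_ok Phi G (nth EZero es i) (nth (nat0 S n) Ts i) &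
    forall b, subusage Phi (usages G b) (args_usage es Ts b)].
Proof.
elim=> [{}G w|G1 G2 {}G e {}es T {}Ts hG he _ [w2 hs h1 h2]].
  by split=> // b; exact: SU_zero.
have [w1 wT h3 h4] := etyping_expr_ok he.
have [e1 e2 hb] := cpar_usages hG.
have hsz1 : size G = size G1 by rewrite -(size_map (set_usage UZero)) -e1 size_map.
have hsz2 : size G = size G2 by rewrite -(size_map (set_usage UZero)) -e2 size_map.
split.
- apply: (wf_ctx_same (esym e1) w1) => b.
  by apply/(ucong_wf _ (hb b)); split; apply: (usages_wf _).2.
- by rewrite /= hs.
- move=> [|i] /= hi.
    apply: (expr_ok_sub h3) => // v hv; apply: set_usage_strip.
    by rewrite -!(nth_map _ (nat0 S n)) ?hsz1 // e1.
  apply: (expr_ok_sub (h1 i hi)) => // v hv; apply: set_usage_strip.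
  by rewrite -!(nth_map _ (nat0 S n)) ?hsz2 // e2.
- move=> b; apply: SU_trans (ucong_sub _ (hb b)) _.
  apply: SU_trans _ (ucong_sub_r _ (args_usage_cons _ _ _ _ _)).
  exact: subusage_par.
Qed.

Definition del T (a : nat) (l : seq T) := take a l ++ drop a.+1 l.

Lemma ins_del a G : a < size G -> ins a (nth (nat0 S n) G a) (del a G) = G.
Proof.
move=> h; rewrite /ins /del take_cat size_takel ?(ltnW h) // ltnn subnn take0 cats0.
by rewrite drop_cat size_takel ?(ltnW h) // ltnn subnn drop0 -drop_nth // cat_take_drop.
Qed.

Lemma size_ins a T G : a <= size G -> size (ins a T G) = (size G).+1.
Proof. by move=> h; rewrite /ins size_cat /= size_takel // size_drop addnS subnKC. Qed.

Lemma nth_ins a T G b : a <= size G ->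
  nth (nat0 S n) (ins a T G) b = if b == a then T else nth (nat0 S n) G (if b < a then b else b.-1).
Proof.
move=> h; rewrite /ins nth_cat size_takel //; case: ltngtP => hb.
- by rewrite nth_take.
- by rewrite -subn_gt0 in hb; case E: (b - a) hb => [|c] //= _; rewrite nth_drop; congr nth; lia.
- by rewrite hb subnn.
Qed.

Lemma map_ins (h : type S n -> type S n) a T G : map h (ins a T G) = ins a (h T) (map h G).
Proof. by rewrite /ins map_cat /= map_take map_drop. Qed.

Lemma map_del T1 T2 (h : T1 -> T2) a l : map h (del a l) = del a (map h l).
Proof. by rewrite /del map_cat map_take map_drop. Qed.

Lemma usages_ins_same a T G : a <= size G -> usages (ins a T G) a = usage_of T.
Proof. by move=> h; rewrite /usages nth_ins // eqxx. Qed.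

Lemma usages_ins_other a T T' G b : a <= size G -> b <> a -> usages (ins a T G) b = usages (ins a T' G) b.
Proof. by move=> h hb; rewrite /usages !nth_ins //; case: eqP. Qed.

Lemma strip_ins a T T' G G' : set_usage UZero T = set_usage UZero T' -> map (set_usage UZero) G = map (set_usage UZero) G' ->
  map (set_usage UZero) (ins a T G) = map (set_usage UZero) (ins a T' G').
Proof. by move=> e1 e2; rewrite !map_ins e1 e2. Qed.

End Fixed.

Lemma usages_map n m (sg : 'I_n -> fidx S m) (G : ctx S n) b :
  usages (map (tsubst sg) G) b = usage_subst sg (usages G b).
Proof.
rewrite /usages; case: (ltnP b (size G)) => h; last by rewrite !nth_default ?size_map.
by rewrite nth_tsubst // usage_of_subst.
Qed.

Lemma strip_tsubst n m (sg : 'I_n -> fidx S m) (G G' : ctx S n) :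
  map (set_usage UZero) G = map (set_usage UZero) G' ->
  map (set_usage UZero) (map (tsubst sg) G) = map (set_usage UZero) (map (tsubst sg) G').
Proof.
move=> e; rewrite -!map_comp.
have h (H : ctx S n) : map (set_usage UZero \o tsubst sg) H = map (tsubst sg) (map (set_usage UZero) H).
  by rewrite -map_comp; apply: eq_map => -[].
by rewrite !h e.
Qed.

Lemma typing_ty_out n (Phi : seq (constr S n)) G1 G2 D a T V U c es Ts P K1 K2 :
  out_type T K1 Ts K2 -> a <= size D -> wf_cap Phi c -> cpar G1 G2 D ->
  etypings Phi (ins a (set_usage V T) G2) es Ts ->
  ty P Phi (ins a (set_usage U T) G1) (usages (ins a (set_usage U T) G1)) K1 ->
  let G := ins a (set_usage (UAct AOut (itv_cst S n 0) c (UPar V U)) T) (cdelay c D) in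
  ty (POut a es P) Phi G (usages G) (cap_seq c K2).
Proof.
move=> hT ha wc hD hes h G'; rewrite {}/G'.
have [w2 hsz hv hu] := etypings_expr_ok hes.
have [w u] := ty_wf_env h.
have [e1 e2 hb] := cpar_usages hD.
have sD1 : size D = size G1 by rewrite -(size_map (set_usage UZero)) -e1 size_map.
have sD2 : size D = size G2 by rewrite -(size_map (set_usage UZero)) -e2 size_map.
set G' := ins a _ _; set G0 := ins a _ G1 in h w u; set G3 := ins a _ G2 in hes hv hu w2.
have ha' : a <= size (cdelay c D) by rewrite size_map.
have ha1 : a <= size G1 by rewrite -sD1.
have ha2 : a <= size G2 by rewrite -sD2.
have es0 : map (set_usage UZero) G' = map (set_usage UZero) G0.
  by apply: strip_ins; rewrite ?set_usage_set_usage // e1; exact: map_strip_usage.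
have es3 : map (set_usage UZero) G' = map (set_usage UZero) G3.
  by apply: strip_ins; rewrite ?set_usage_set_usage // e2; exact: map_strip_usage.
have sz0 : size G' = size G3 by rewrite -(size_map (set_usage UZero)) es3 size_map.
(* [out_type] excludes [TNat], the only kind of type on which [set_usage] has no effect. *)
have eT W : usage_of (set_usage W T) = W by case: (T) hT.
have ea : usages G' a = UAct AOut (itv_cst S n 0) c (UPar (usages G3 a) (usages G0 a)) by rewrite !usages_ins_same // !eT.
have eb b : b <> a -> ucong (usages G' b) (delay c (UPar (usages G3 b) (usages G0 b))).
  move=> hba; have -> : usages G' b = delay c (usages (ins a (set_usage V T) D) b).
    by rewrite -usages_delay /cdelay map_ins; exact: usages_ins_other.
  apply: delay_ucong; rewrite /usages !nth_ins //; case: eqP => // _.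
  exact: UC_trans (hb _) (UC_parC _ _).
have u3 := (usages_wf w2).2.
have u' b : wf_usage Phi (usages G' b).
  case: (b =P a) => [->|hba]; first by rewrite ea; split=> //; exact: wf_itv_cst.
  apply/(ucong_wf _ (eb b hba)); apply: wf_delay => //; by split.
have w' := wf_ctx_same es0 w u'.
split=> //=; exists Ts, c, (usages G0), K1, K2; split.
- rewrite size_ins // nth_ins // eqxx; split=> //; by case: (T) hT.
- split; last by rewrite ea; apply: SU_compat_act; exact: SU_compat_par.
  move=> i hi; apply: (expr_ok_sub (hv i hi)) => // v hv1; apply: set_usage_strip.
  by rewrite -!(nth_map _ (nat0 S n)) ?sz0 // es3.
- move=> b hba; apply: SU_trans (ucong_sub _ (eb b hba)) _.
  apply: (@delay_sub _ _ _ _ _ (UPar _ _)) => //.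
  exact: SU_compat_par.
- by apply: (ty_same h) => // b; exact: subusage_refl.
- exact: itv_incl_refl.
Qed.

Lemma typing_ty n (Phi : seq (constr S n)) G P K : typing Phi G P K -> ty P Phi G (usages G) K.
Proof.
elim=> {n Phi G P K}.
- by move=> n Phi G w; split; [exact: usages_wf|exact: itv_incl_refl].
- move=> n Phi G1 G2 G P Q K1 K2 hG _ h1 _ h2.
  have [e1 e2 hb] := cpar_usages hG; have [w1 u1] := ty_wf_env h1; have [w2 u2] := ty_wf_env h2.
  have uG b : wf_usage Phi (usages G b) by apply/(ucong_wf _ (hb b)); split.
  have wG := wf_ctx_same (esym e1) w1 uG.
  split=> //=; exists (usages G1), (usages G2), K1, K2; split.
  + move=> b; exact: ucong_sub.
  + apply: (ty_same h1) => // b; exact: subusage_refl.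
  + apply: (ty_same h2) => // b; exact: subusage_refl.
  + exact: itv_incl_refl.
- move=> n Phi G P K _ h; have [w u] := ty_wf_env h; have es := map_strip_usage (delay (CItv (itv_cst S n 1))) G.
  have u' b : wf_usage Phi (usages (cdelay (CItv (itv_cst S n 1)) G) b) by rewrite usages_delay; exact: wf_delay_cst.
  have w' := wf_ctx_same es w u'.
  split=> //=; exists (usages G), K; split; last exact: itv_incl_refl.
    by move=> b; rewrite usages_delay; exact: subusage_refl.
  apply: (ty_same h) => // b; exact: subusage_refl.
- move=> n Phi G m P K _ h; have [w u] := ty_wf_env h; have es := map_strip_usage (delay (CItv (itv_cst S n m))) G.
  have u' b : wf_usage Phi (usages (cdelay (CItv (itv_cst S n m)) G) b) by rewrite usages_delay; exact: wf_delay_cst.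
  have w' := wf_ctx_same es w u'.
  split=> //=; exists (usages G), K; split; last exact: itv_incl_refl.
    by move=> b; rewrite usages_delay; exact: subusage_refl.
  apply: (ty_same h) => // b; exact: subusage_refl.
- move=> n Phi G a Ts U c P K ha wc _; rewrite usages_cat => h.
  have /wf_env_cat [wTs [w u]] := ty_wf_env h.
  set G' := ins a _ _; set G0 := ins a _ _ in h w u.
  have ha' : a <= size (cdelay c G) by rewrite size_map.
  have es : map (set_usage UZero) G' = map (set_usage UZero) G0.
    by apply: strip_ins => //; exact: map_strip_usage.
  have ea : usages G' a = UAct AIn (itv_cst S n 0) c (usages G0 a) by rewrite !usages_ins_same.
  have eb b : b <> a -> usages G' b = delay c (usages G0 b).
    by move=> hb; rewrite -usages_delay /cdelay map_ins; exact: usages_ins_other.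
  have u' b : wf_usage Phi (usages G' b).
    case: (b =P a) => [->|/eb ->]; last exact: wf_delay.
    by rewrite ea; split=> //; exact: wf_itv_cst.
  have w' := wf_ctx_same es w u'.
  split=> //=; exists Ts, (UAct AIn (itv_cst S n 0) c U), c, (usages G0), K; split.
  + by rewrite size_ins // nth_ins // eqxx.
  + by rewrite ea; exact: subusage_refl.
  + by move=> b /eb ->; exact: subusage_refl.
  + apply: (ty_same h); first by rewrite [LHS]map_cat [RHS]map_cat es.
      exact/wf_env_cat.
    by move=> b; exact: subusage_refl.
  + exact: itv_incl_refl.
- move=> n Phi G a k K Ts U c P ha wc _; rewrite usages_cat => h.
  have /wf_env_cat [wTs [/wf_ctx_wk w _]] := ty_wf_env h.
  set G' := ins a _ _; set G0 := ins a _ _ in h w.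
  have u b : wf_usage Phi (usages G0 b) by apply: (usages_wf w).2.
  have ha' : a <= size (cdelay c (crep G)) by rewrite !size_map.
  have es : map (set_usage UZero) G' = map (set_usage UZero) G0.
    by apply: strip_ins => //; rewrite !map_strip_usage.
  have ea : usages G' a = URep (UAct AIn (itv_cst S n 0) c (usages G0 a)) by rewrite !usages_ins_same.
  have eb b : b <> a -> ucong (usages G' b) (delay c (URep (usages G0 b))).
    move=> hb; apply: UC_trans _ (delay_ucong _ (usages_rep _ _)).
    rewrite (_ : usages G' b = delay c (usages (crep G0) b)); first exact: UC_refl.
    by rewrite -usages_delay /cdelay /crep !map_ins; exact: usages_ins_other.
  have u' b : wf_usage Phi (usages G' b).
    case: (b =P a) => [->|hb]; first by rewrite ea; split=> //; exact: wf_itv_cst.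
    apply/(ucong_wf _ (eb b hb)); exact: (@wf_delay _ _ _ _ (URep _)).
  have w' := wf_ctx_same es w u'.
  have hwk : val_mor (@wk S k n) Phi (cwk k Phi) by exact: val_mor_cwk.
  split=> //=; exists k, K, Ts, (URep (UAct AIn (itv_cst S n 0) c U)), c, (usages G0); split.
  + by rewrite size_ins // nth_ins // eqxx.
  + by rewrite ea; exact: subusage_refl.
  + by move=> b /eb hb; exact: ucong_sub hb.
  + apply: (ty_same h); first by rewrite [LHS]map_cat [RHS]map_cat (strip_tsubst _ es).
      by apply/wf_env_cat; split=> //; apply: (wf_env_subst hwk).
    move=> b; rewrite (_ : usages (map _ G0) = fun b => usage_subst (wk S k (n:=n)) (usages G0 b)); first exact: subusage_refl.
    by apply: functional_extensionality => x; rewrite usages_map.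
  + by split=> //; exact: itv_incl_refl.
- move=> n Phi G1 G2 D a Ts V U c es P K ha wc hD hes _ h.
  by apply: (@typing_ty_out _ _ _ _ _ _ (TCh Ts U) V U) hes h.
- move=> n Phi G1 G2 D a k K Ts V U Is c es P K' ha wc hD hes _ h.
  apply: (@typing_ty_out _ _ _ _ _ _ (TServ K Ts U) V U) hes h => //.
  by exists Is.
- move=> n Phi G e J1 J2 P Q K wK he _ h1 _; rewrite (usages_cat [:: TNat _ _]) => h2.
  have [w _ hv _] := etyping_expr_ok he.
  by split=> /=; [exact: usages_wf|split=> //; exists J1, J2].
- move=> n Phi G T P K hT _; rewrite (usages_cat [:: T]) => h.
  have /(wf_env_cat _ [:: T]) [_ w] := ty_wf_env h.
  split=> //=; exists T; split=> //.
  (* For a [TNat] the reliability demanded by [ty] is that of [UZero]. *)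
  by case: T hT {h} => //= *; exact: reliable_zero.
- move=> n Phi G D P K K' w _ h hG hK; apply: (ty_sub h) => //.
  + exact: usages_wf.
  + by case/subtypesP: hG.
  + by move/subtypesP: hG => [e hG] v; rewrite -e => hv; apply: subtype_skel; exact: hG.
  + by move=> b _; exact: subtypes_usages.
Qed.

End Conversion.

(** * From the syntax-directed judgement back to [typing] *)

Section Back.
Variable S : signature.

Section Fixed.
Variables (n : nat) (Phi : seq (constr S n)).
Implicit Types (G : ctx S n) (f g : nat -> usage S n).

Lemma size_assign G f : size (assign G f) = size G.
Proof. by rewrite size_mkseq. Qed.

Lemma nth_assign G f b : b < size G -> nth (nat0 S n) (assign G f) b = set_usage (f b) (nth (nat0 S n) G b).
Proof. by move=> h; rewrite nth_mkseq. Qed.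

Lemma assign_usages G : assign G (usages G) = G.
Proof.
apply: (@eq_from_nth _ (nat0 S n)); rewrite size_assign // => i hi.
by rewrite nth_assign // /usages; case: (nth _ _ _).
Qed.

Lemma assign_cat Ts G f : assign (Ts ++ G) (cat_usages Ts f) = Ts ++ assign G f.
Proof.
apply: (@eq_from_nth _ (nat0 S n)); rewrite size_assign !size_cat ?size_assign // => i hi.
rewrite nth_assign ?size_cat // !nth_cat; case: ltnP => h.
  by rewrite cat_usages_lt //; case: (nth _ _ _).
by rewrite nth_assign /cat_usages ?ltnNge ?h /= //; lia.
Qed.

Lemma assign_wf G f : wf_env Phi G f -> wf_ctx Phi (assign G f).
Proof.
move=> [w h]; apply/ForallP => i; rewrite size_assign => hi; rewrite nth_assign //.
apply: wf_type_set_usage => //; exact: wf_ctx_nth.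
Qed.

Lemma subtype_set_usage T U V : subusage Phi U V -> subtype Phi (set_usage U T) (set_usage V T).
Proof.
move=> h; apply/subtypeE; rewrite /skel !set_usage_set_usage; split; first exact: subtype_refl.
by case: T => //= *; exact: subusage_refl.
Qed.

Lemma assign_sub G f g : (forall b, subusage Phi (f b) (g b)) -> subtypes Phi (assign G f) (assign G g).
Proof.
move=> h; apply/subtypesP; rewrite !size_assign; split=> // i hi; rewrite !nth_assign //.
exact: subtype_set_usage.
Qed.

Lemma map_assign (h : usage S n -> usage S n) G f : map (map_usage h) (assign G f) = assign G (fun b => h (f b)).
Proof.
rewrite /assign /mkseq -map_comp; apply: eq_map => b /=; by case: (nth _ _ _).
Qed.

Lemma cpar_assign G f g : cpar (assign G f) (assign G g) (assign G (fun b => UPar (f b) (g b))).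
Proof.
rewrite /assign /mkseq; elim: iota => [|i l IH] /=; constructor=> //.
case: (nth _ _ _) => *; constructor.
Qed.

Lemma cpar_del a G1 G2 G : cpar G1 G2 G -> cpar (del a G1) (del a G2) (del a G).
Proof.
move=> h; elim: h a => [|T1 T2 T H1 H2 H hT h IH] [|a]; rewrite /del /=; try by constructor.
  by rewrite !drop0.
constructor=> //; exact: IH.
Qed.

Lemma size_del a G : a < size G -> size (del a G) = (size G).-1.
Proof. by move=> h; rewrite /del size_cat size_takel ?(ltnW h) // size_drop; lia. Qed.

Lemma nth_ins_del a T G b : a < size G ->
  nth (nat0 S n) (ins a T (del a G)) b = if b == a then T else nth (nat0 S n) G b.
Proof.
move=> h; rewrite -{2}(ins_del h) !nth_ins ?size_del //; try lia.
by case: eqP.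
Qed.

(** The prefix rules of [typing] single out the subject with [ins]; this returns to one pointwise
    function of usages, where [assign_sub] applies. *)
Lemma ins_assign a G f T X (h : usage S n -> usage S n) : a < size G ->
  set_usage X (nth (nat0 S n) G a) = T ->
  ins a T (map (map_usage h) (del a (assign G f))) = assign G (fun b => if b == a then X else h (f b)).
Proof.
move=> ha <-; rewrite map_del map_assign.
apply: (@eq_from_nth _ (nat0 S n)).
  rewrite size_assign size_ins ?size_del ?size_assign //; lia.
move=> i; rewrite size_ins ?size_del ?size_assign //; last lia.
rewrite prednK; last by lia.
move=> hi; rewrite nth_ins_del ?size_assign // !nth_assign //.
by case: eqP => [->|].
Qed.

Lemma ins_assign_id a G f T X : a < size G -> set_usage X (nth (nat0 S n) G a) = T -> X = f a ->
  ins a T (del a (assign G f)) = assign G f.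
Proof.
move=> ha e1 e2; rewrite -{2}(@ins_del _ _ a (assign G f)) ?size_assign //; congr ins.
by rewrite nth_assign // -e1 e2.
Qed.

Lemma args_usage_etypings G es Ts : wf_ctx Phi G -> wf_ctx Phi Ts -> size es = size Ts ->
  (forall i, i < size Ts -> expr_ok Phi G (nth EZero es i) (nth (nat0 S n) Ts i)) ->
  exists g, etypings Phi (assign G g) es Ts /\ forall b, subusage Phi (args_usage es Ts b) (g b).
Proof.
move=> w; elim: Ts es => [|T Ts IH] [|e es] // wTs hs hv.
  exists (fun _ => UZero); split; last by move=> b; exact: SU_zero.
  constructor; apply: assign_wf; by split.
have wT : wf_type Phi T by inversion wTs.
have wTs' : wf_ctx Phi Ts by inversion wTs.
have [|i hi|g [hg hu]] := IH es wTs'; [by case: hs|exact: (hv i.+1)|].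
exists (fun b => UPar (contrib e (usage_of T) b) (g b)); split; last first.
  move=> b; apply: SU_trans (ucong_sub _ (args_usage_cons _ _ _ _ _)) _.
  by apply: subusage_par (subusage_refl _ _) _.
apply: ETS_cons (cpar_assign _ _ _) _ hg.
have wc b : wf_usage Phi (contrib e (usage_of T) b).
  by case: (e) => //= v; case: eqP => // _; exact: wf_type_usage_of.
apply: expr_ok_etyping => //; first by apply: assign_wf.
  apply: (expr_ok_sub (hv 0 isT)); first exact: size_assign.
  by move=> v hx; rewrite nth_assign //; exact: (skel_set_usage _ _ _).2.
move=> b; rewrite /usages; case: (ltnP b (size G)) => hb; last first.
  rewrite nth_default ?size_assign //.
  have := hv 0 isT; case: (e) => [v [hv1 _]|_|e' _] /=; try exact: SU_zero.
  case: eqP => [ev|_]; last exact: SU_zero.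
  by move: hv1; rewrite ev ltnNge hb.
(* At a variable of type [TNat] the assigned usage is lost. Nothing is missing: the expected type is
   then a [TNat] too and contributes [UZero]. *)
rewrite nth_assign //; case E: (nth (nat0 S n) G b) => [J1 J2|Ts1 U|k K Ts1 U] /=; try exact: subusage_refl.
have := hv 0 isT; case: (e) => [v [hv1]|_|e' _] /=; try exact: SU_zero.
case: eqP => [->|_ _]; last exact: SU_zero.
by rewrite E => /subtype_inv /= [?] [?] []; case: (T) => //= *; exact: SU_zero.
Qed.

End Fixed.

Lemma assign_subst n m (sg : 'I_n -> fidx S m) G f :
  assign (map (tsubst sg) G) (fun b => usage_subst sg (f b)) = map (tsubst sg) (assign G f).
Proof.
rewrite /assign /mkseq size_map -map_comp; apply/eq_in_map => i /=.
by rewrite mem_iota /= add0n => hi; rewrite nth_tsubst // tsubst_set_usage.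
Qed.

(** Where [ty] stores inequalities between usages and complexities, the corresponding rule of
    [typing] is followed by one [Ty_sub]. *)
Lemma ty_typing P : forall n (Phi : seq (constr S n)) G f K, ty P Phi G f K -> typing Phi (assign G f) P K.
Proof.
elim: P => [|P IHP Q IHQ|a k P IHP|a k P IHP|a es P IHP|P IHP|P IHP|e P IHP Q IHQ|m P IHP] n Phi G f K /= [w h];
  have wG := assign_wf w.
- by apply: (Ty_sub wG (Ty_zero wG) (subtypes_refl _ _) h).
- case: h => f1 [f2 [K1 [K2 [h1 /IHP h2 /IHQ h3 h4]]]].
  apply: (Ty_sub wG (Ty_par (cpar_assign _ _ _) h2 h3) _ h4); exact: assign_sub.
- case: h => j [K1 [Ts [U [c [f1 [[ha ea sk wc] h2 h3 /IHP + [h5 h6]]]]]]].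
  rewrite assign_cat assign_subst -sk.
  rewrite -(@ins_assign_id _ a G f1 (TServ K1 Ts (f1 a)) (f1 a)) ?ea // => h4.
  have hsz : a <= size (del a (assign G f1)) by rewrite size_del ?size_assign //; lia.
  apply: (Ty_sub wG (Ty_iserv hsz wc h4) _ h6).
  rewrite /cdelay /crep -map_comp (eq_map (g := map_usage (delay c \o @URep S n))); last by case.
  rewrite (@ins_assign _ _ _ _ _ (URep (UAct AIn (itv_cst S n 0) c (f1 a)))) ?ea //.
  apply: assign_sub => b /=; case: eqP => [->|] //; exact: h3.
- case: h => Ts [U [c [f1 [K1 [[ha ea sk wc] h2 h3 /IHP + h5]]]]].
  rewrite assign_cat -sk.
  rewrite -(@ins_assign_id _ a G f1 (TCh Ts (f1 a)) (f1 a)) ?ea // => h4.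
  have hsz : a <= size (del a (assign G f1)) by rewrite size_del ?size_assign //; lia.
  apply: (Ty_sub wG (Ty_ich hsz wc h4) _ h5).
  rewrite /cdelay (@ins_assign _ _ _ _ _ (UAct AIn (itv_cst S n 0) c (f1 a))) ?ea //.
  apply: assign_sub => b; case: eqP => [->|] //; exact: h3.
- case: h => Ts [c [f1 [K1 [K2 [[ha ea ses wc] [hes h2] h3 h4 h5]]]]].
  have [_ wf1] := ty_wf_env h4.
  have [g [hg hu]] := args_usage_etypings w.1 (out_type_wf w.1 ea) ses hes.
  move/IHP: h4 => h4.
  have hsz : a <= size (del a (assign G (fun b => UPar (f1 b) (g b)))) by rewrite size_del ?size_assign //; lia.
  have hc := cpar_del a (cpar_assign G f1 g).
  have wu b : wf_usage Phi (UPar (args_usage es Ts b) (f1 b)).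
    by split=> //; apply: args_usage_wf; exact: out_type_wf w.1 ea.
  have hsub : subtypes Phi (assign G f) (assign G (fun b =>
      if b == a then UAct AOut (itv_cst S n 0) c (UPar (g a) (f1 a)) else delay c (UPar (f1 b) (g b)))).
    apply: assign_sub => b; case: eqP => [->|hb].
      apply: (SU_trans h2); apply: SU_compat_act; exact: SU_compat_par.
    apply: (SU_trans (h3 b hb)); apply: (@delay_sub _ _ _ _ (UPar _ _) (UPar _ _)) => //.
    apply: (SU_trans (SU_compat_par _ (hu b))); exact/ucong_sub/UC_parC.
  case E : (nth (nat0 S n) G a) ea => [|Ts' U|k K' Ts' U] //=.
    case=> e1 e2; rewrite {}e1 {}e2 in hg h5 *.
    have hg' : etypings Phi (ins a (TCh Ts' (g a)) (del a (assign G g))) es Ts'.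
      by rewrite (@ins_assign_id _ _ _ _ _ (g a)) ?E.
    have h4' : typing Phi (ins a (TCh Ts' (f1 a)) (del a (assign G f1))) P K1.
      by rewrite (@ins_assign_id _ _ _ _ _ (f1 a)) ?E.
    apply: (Ty_sub wG (Ty_och hsz wc hc hg' h4') _ h5).
    by rewrite /cdelay (@ins_assign _ _ _ _ _ (UAct AOut (itv_cst S n 0) c (UPar (g a) (f1 a)))) ?E.
  case=> Is [e1 e2]; rewrite {}e1 {}e2 in hg h5 *.
  have hg' : etypings Phi (ins a (TServ K' Ts' (g a)) (del a (assign G g))) es (map (tsubst (inst Is)) Ts').
    by rewrite (@ins_assign_id _ _ _ _ _ (g a)) ?E.
  have h4' : typing Phi (ins a (TServ K' Ts' (f1 a)) (del a (assign G f1))) P K1.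
    by rewrite (@ins_assign_id _ _ _ _ _ (f1 a)) ?E.
  apply: (Ty_sub wG (Ty_oserv hsz wc hc hg' h4') _ h5).
  by rewrite /cdelay (@ins_assign _ _ _ _ _ (UAct AOut (itv_cst S n 0) c (UPar (g a) (f1 a)))) ?E.
- case: h => T [hT /IHP]; rewrite (assign_cat [:: T]) => h; apply: Ty_nu h.
  by case: (T) hT.
- case: h => f1 [K1 [h1 /IHP h2 h3]]; apply: (Ty_sub wG (Ty_tick h2) _ h3).
  rewrite /cdelay map_assign; exact: assign_sub.
- case: h => wK [J1 [J2 [h1 /IHP h2 /IHQ]]]; rewrite (assign_cat [:: TNat _ _]) => h3.
  apply: (Ty_case wK _ h2 h3); apply: expr_ok_etyping => //; first by constructor.
    apply: (expr_ok_sub h1); first exact: size_assign.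
    by move=> v hx; rewrite nth_assign //; exact: (skel_set_usage _ _ _).2.
  move=> b; rewrite contrib_zero; exact: SU_zero.
- case: h => f1 [K1 [h1 /IHP h2 h3]]; apply: (Ty_sub wG (Ty_annot m h2) _ h3).
  rewrite /cdelay map_assign; exact: assign_sub.
Qed.

End Back.

(** * Congruence *)

Section Congruence.
Variable S : signature.

Section Fixed.
Variables (n : nat) (Phi : seq (constr S n)).
Local Notation cst := (itv_cst S n).
Local Notation "U <<= V" := (subusage Phi U V) (at level 70).

(* The detour through [typing] replaces by [UZero] the irrelevant usages that [f]
   may give to variables of type [TNat]. *)
Lemma ty_head P T G f K : ty P Phi (T :: G) f K ->
  ty P Phi (set_usage (f 0) T :: G) (cat_usages [:: set_usage (f 0) T] (fun b => f b.+1)) K.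
Proof.
move=> h; have [w wf] := ty_wf_env h; have [wT wG] := (wf_ctx_cat _ [:: T] G).1 w.
apply: (ty_sub (typing_ty (ty_typing h))).
- apply/(wf_env_cat _ [:: _]); split; last by split.
  constructor; last by constructor.
  by apply: wf_type_set_usage => //; inversion wT.
- by rewrite size_assign.
- move=> v; rewrite size_assign => hv; rewrite nth_assign //.
  by case: v hv => [|v] hv /=; [exact: skel_refl|exact: (skel_set_usage _ _ _).1].
- move=> b; rewrite size_assign => hb; rewrite /usages nth_assign //.
  case: b hb => [|b] hb /=; first exact: subusage_refl.
  rewrite /cat_usages /= subn1 /=; case: (nth _ _ _) => *; [exact: SU_zero|exact: subusage_refl|exact: subusage_refl].
- exact: itv_incl_refl.
Qed.

Lemma reliable_set_usage T U : reliable Phi U -> reliable Phi (usage_of (set_usage U T)).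
Proof. by case: T => //= *; exact: reliable_zero. Qed.

Lemma delay0_le U : wf_usage Phi U -> delay (CItv (cst 0)) U <<= U.
Proof.
move=> wU; rewrite delayE -{2}(map_obl_id U); apply: map_obl_le => // A wA.
rewrite /itv_shift; split=> //; index_arith.
Qed.

Lemma delay0_ge U : wf_usage Phi U -> U <<= delay (CItv (cst 0)) U.
Proof.
move=> wU; rewrite delayE -{1}(map_obl_id U); apply: map_obl_le => // A wA.
rewrite /itv_shift; split=> //; index_arith.
Qed.

Lemma delay_add_le p q U : wf_usage Phi U ->
  delay (CItv (cst p)) (delay (CItv (cst q)) U) <<= delay (CItv (cst (p + q))) U.
Proof.
move=> wU; rewrite delay_comp delayE; apply: map_obl_le => // A wA.
rewrite /itv_shift /=; split; index_arith.
Qed.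

Lemma delay_add_ge p q U : wf_usage Phi U ->
  delay (CItv (cst (p + q))) U <<= delay (CItv (cst p)) (delay (CItv (cst q)) U).
Proof.
move=> wU; rewrite delay_comp delayE; apply: map_obl_le => // A wA.
rewrite /itv_shift /=; split; index_arith.
Qed.

Lemma delay_cst_sub p U V : wf_usage Phi U -> U <<= V ->
  delay (CItv (cst p)) U <<= delay (CItv (cst p)) V.
Proof. apply: delay_sub; exact: wf_itv_cst. Qed.

Lemma add_cst_mono K K' p : itv_incl Phi K K' -> itv_incl Phi (itv_add K (cst p)) (itv_add K' (cst p)).
Proof. move=> h; index_arith. Qed.

Lemma ty_swap P T1 T2 G f K : ty P Phi (T1 :: T2 :: G) (cat_usages [:: T1] (cat_usages [:: T2] f)) K ->
  ty (pren swap01 P) Phi (T2 :: T1 :: G) (cat_usages [:: T2] (cat_usages [:: T1] f)) K.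
Proof.
move=> h; have /(wf_env_cat _ [:: T1]) [w1 /(wf_env_cat _ [:: T2]) [w2 w]] := ty_wf_env h.
apply: (ty_ren h).
- by apply/(wf_env_cat _ [:: T2]); split=> //; apply/(wf_env_cat _ [:: T1]).
- by move=> [|[|v]] hv _ /=; split=> //; exact: skel_refl.
- by move=> [|[|v]] hv; exact: subusage_refl.
- by move=> [|[|x]] [|[|y]].
Qed.

Lemma ty_par_intro P Q G f f1 f2 K1 K2 K : (forall b, wf_usage Phi (f b)) ->
  (forall b, f b <<= UPar (f1 b) (f2 b)) -> ty P Phi G f1 K1 -> ty Q Phi G f2 K2 ->
  itv_incl Phi (itv_sqcup K1 K2) K -> ty (PPar P Q) Phi G f K.
Proof.
move=> w hf h1 h2 hK; split; first by split=> //; exact: (ty_wf_env h1).1.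
by exists f1, f2, K1, K2.
Qed.

Lemma ty_annot_intro P m G f f1 K1 K : (forall b, wf_usage Phi (f b)) ->
  (forall b, f b <<= delay (CItv (cst m)) (f1 b)) -> ty P Phi G f1 K1 ->
  itv_incl Phi (itv_add K1 (cst m)) K -> ty (PAnnot m P) Phi G f K.
Proof.
move=> w hf h1 hK; split; first by split=> //; exact: (ty_wf_env h1).1.
by exists f1, K1.
Qed.

Lemma ty_nu_intro P T G f K : reliable Phi (usage_of T) ->
  ty P Phi (T :: G) (cat_usages [:: T] f) K -> ty (PNu P) Phi G f K.
Proof.
move=> hT h; have /(wf_env_cat _ [:: T]) [_ w] := ty_wf_env h.
by split=> //; exists T.
Qed.

End Fixed.

Definition ty_imp P Q := forall n (Phi : seq (constr S n)) G f K, ty P Phi G f K -> ty Q Phi G f K.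

Lemma ty_imp_nu_nu P : ty_imp (PNu (PNu P)) (PNu (PNu (pren swap01 P))).
Proof.
move=> n Phi G f K [w [T [hT [w' [T' [hT' h]]]]]].
apply: (ty_nu_intro hT'); apply: (ty_nu_intro hT); exact: ty_swap.
Qed.

Lemma ty_imp_parC P Q : ty_imp (PPar P Q) (PPar Q P).
Proof.
move=> n Phi G f K [[_ w] [f1 [f2 [K1 [K2 [h1 h2 h3 h4]]]]]].
apply: (ty_par_intro w _ h3 h2); last exact: itv_incl_trans (sqcupC_incl _ _ _) h4.
move=> b; apply: (SU_trans (h1 b)); exact/ucong_sub/UC_parC.
Qed.

Lemma ty_imp_parA P Q R : ty_imp (PPar P (PPar Q R)) (PPar (PPar P Q) R).
Proof.
move=> n Phi G f K [[_ w] [f1 [f2 [K1 [K2 [h1 h2 [_ [f3 [f4 [K3 [K4 [h3 h4 h5 h6]]]]]] h7]]]]]].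
have [_ w1] := ty_wf_env h2; have [_ w3] := ty_wf_env h4.
apply: (@ty_par_intro _ _ _ _ _ _ (fun b => UPar (f1 b) (f3 b)) f4 (itv_sqcup K1 K3) K4) => //.
- move=> b; apply: (SU_trans (h1 b)).
  apply: (SU_trans (subusage_par (subusage_refl _ _) (h3 b))); exact/ucong_sub/UC_parA.
- apply: ty_par_intro h2 h4 _ => //; [by move=> b; exact: subusage_refl|exact: itv_incl_refl].
- apply: itv_incl_trans h7.
  apply: itv_incl_trans _ (sqcup_incl (itv_incl_refl _ _) h6); index_arith.
Qed.

Lemma ty_imp_parA' P Q R : ty_imp (PPar (PPar P Q) R) (PPar P (PPar Q R)).
Proof.
move=> n Phi G f K /ty_imp_parC /ty_imp_parA /ty_imp_parC /ty_imp_parA.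
exact: ty_imp_parC.
Qed.

Lemma ty_imp_par P P' Q Q' : ty_imp P P' -> ty_imp Q Q' -> ty_imp (PPar P Q) (PPar P' Q').
Proof.
move=> hP hQ n Phi G f K [w [f1 [f2 [K1 [K2 [h1 h2 h3 h4]]]]]].
split=> //; exists f1, f2, K1, K2; split=> //; [exact: hP|exact: hQ].
Qed.

Lemma pcong_imp P Q : pcong P Q -> ty_imp P Q /\ ty_imp Q P.
Proof.
elim=> {P Q}.
- by move=> P; split.
- by move=> P Q _ [].
- by move=> P Q R _ [h1 h2] _ [h3 h4]; split=> n Phi G f K; [move/h1; exact: h3|move/h4; exact: h2].
- by move=> P P' Q Q' _ [h1 h2] _ [h3 h4]; split; exact: ty_imp_par.
- move=> a k P P' _ [h1 h2]; split=> n Phi G f K [w [j [K1 [Ts [U [c [f1 [ha e1 e2 h e3]]]]]]]];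
    split=> //; exists j, K1, Ts, U, c, f1; split=> //; [exact: h1|exact: h2].
- move=> a k P P' _ [h1 h2]; split=> n Phi G f K [w [Ts [U [c [f1 [K1 [ha e1 e2 h e3]]]]]]];
    split=> //; exists Ts, U, c, f1, K1; split=> //; [exact: h1|exact: h2].
- move=> a es P P' _ [h1 h2]; split=> n Phi G f K [w [Ts [c [f1 [K1 [K2 [ha e1 e2 h e3]]]]]]];
    split=> //; exists Ts, c, f1, K1, K2; split=> //; [exact: h1|exact: h2].
- by move=> P P' _ [h1 h2]; split=> n Phi G f K [w [T [hT h]]]; split=> //; exists T; split=> //; [exact: h1|exact: h2].
- move=> P P' _ [h1 h2]; split=> n Phi G f K [w [f1 [K1 [e1 h e2]]]]; split=> //; exists f1, K1; split=> //; [exact: h1|exact: h2].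
- move=> e P P' Q Q' _ [h1 h2] _ [h3 h4]; split=> n Phi G f K [w [wK [J1 [J2 [hv hP hQ]]]]];
    split=> //; split=> //; exists J1, J2; split=> //; [exact: h1|exact: h3|exact: h2|exact: h4].
- move=> m P P' _ [h1 h2]; split=> n Phi G f K [w [f1 [K1 [e1 h e2]]]]; split=> //; exists f1, K1; split=> //; [exact: h1|exact: h2].
- move=> P; split=> n Phi G f K.
    move=> [[_ w] [f1 [f2 [K1 [K2 [h1 h2 [_ h3] h4]]]]]].
    apply: (ty_usage h2 w).
      by move=> b; apply: (SU_trans (h1 b)); exact: subusage_parl.
    apply: itv_incl_trans _ h4; index_arith.
  move=> h; have [wG w] := ty_wf_env h.
  apply: (@ty_par_intro _ _ _ _ _ _ f (fun _ => UZero) K (itv_cst S n 0)) => //.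
  + by move=> b; exact/ucong_sub_r/UC_par0.
  + by split=> //; exact: itv_incl_refl.
  + index_arith.
- by move=> P Q; split; exact: ty_imp_parC.
- by move=> P Q R; split; [exact: ty_imp_parA|exact: ty_imp_parA'].
- move=> P; split; first exact: ty_imp_nu_nu.
  (* [swap01] is an involution, so the converse is another instance of the same implication. *)
  have {2}-> : P = pren swap01 (pren swap01 P); last exact: ty_imp_nu_nu.
  rewrite pren_pren -[LHS]pren_id; congr pren.
  by apply: functional_extensionality => -[|[|x]].
(* Scope extrusion. To narrow the scope, the name gets in [P] the usage [f1 0], reliable because the
   usage of [T] is a subusage of it, and is dropped from the other component, where it does not
   occur. To widen the scope, [Q] receives the name with usage [UZero]. *)
- move=> P Q; split=> n Phi G f K.
    move=> [[wG w] [T [hT [[/(wf_ctx_cat _ [:: T]) [wT _] w'] [f1 [f2 [K1 [K2 [h1 h2 h3 h4]]]]]]]]].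
    have {h1} h1' := h1; have h0 := h1' 0; rewrite /cat_usages /= in h0.
    have wU : wf_usage Phi (usage_of T) by apply: wf_type_usage_of; inversion wT.
    have r0 : reliable Phi (f1 0).
      by apply: reliable_sub hT => //; exact: SU_trans h0 (subusage_parl _ _ _).
    apply: (@ty_par_intro _ _ _ _ _ _ (fun b => f1 b.+1) (fun b => f2 b.+1) K1 K2) => //.
    + by move=> b; have := h1' b.+1; rewrite /cat_usages /= subn1.
    + apply: ty_nu_intro (ty_head h2); exact: reliable_set_usage.
    + exact: ty_strengthen (ty_head h3).
  move=> [[wG w] [f1 [f2 [K1 [K2 [h1 [_ [T [hT h2]]] h3 h4]]]]]].
  have /(wf_env_cat _ [:: T]) [wT [_ w1]] := ty_wf_env h2; have [_ w2] := ty_wf_env h3.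
  have wT' : wf_type Phi T by inversion wT.
  apply: (ty_nu_intro hT).
  apply: (@ty_par_intro _ _ _ _ _ _ (cat_usages [:: T] f1) (cat_usages [:: set_usage UZero T] f2) K1 K2) => //.
  + by have /(wf_env_cat _ [:: T]) [] : wf_ctx Phi [:: T] /\ wf_env Phi G f by split.
  + move=> [|b]; rewrite /cat_usages /= ?subn1 //.
    apply: SU_trans (ucong_sub_r _ (UC_par0 _)) _; apply: subusage_par (subusage_refl _ _) _.
    by case: (T) => *; exact: subusage_refl.
  + have wT2 : wf_type Phi (set_usage UZero T) by apply: wf_type_set_usage.
    apply: (ty_same (ty_weaken wT2 h3)) => /=; first by rewrite set_usage_set_usage.
      split; first by constructor.
      by have /(wf_env_cat _ [:: _]) [] : wf_ctx Phi [:: set_usage UZero T] /\ wf_env Phi G f2 by split=> //; constructor=> //; constructor.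
    move=> b; exact: subusage_refl.
- move=> P; split=> n Phi G f K.
    move=> [[wG w] [f1 [K1 [h1 h2 h3]]]]; have [_ w1] := ty_wf_env h2.
    apply: (ty_usage h2 w); last by apply: itv_incl_trans _ h3; index_arith.
    by move=> b; apply: (SU_trans (h1 b)); exact: delay0_le.
  move=> h; have [wG w] := ty_wf_env h; apply: (ty_annot_intro w _ h); last by index_arith.
  by move=> b; exact: delay0_ge.
- move=> m P Q; split=> n Phi G f K.
    move=> [[wG w] [f1 [K1 [h1 [[_ w1] [f2 [f3 [K2 [K3 [h2 h3 h4 h5]]]]]] h6]]]].
    have [_ w2] := ty_wf_env h3; have [_ w3] := ty_wf_env h4.
    apply: (@ty_par_intro _ _ _ _ _ _ (fun b => delay (CItv (itv_cst S n m)) (f2 b)) (fun b => delay (CItv (itv_cst S n m)) (f3 b)) (itv_add K2 (itv_cst S n m)) (itv_add K3 (itv_cst S n m))) => //.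
    + move=> b; apply: (SU_trans (h1 b)); exact: (@delay_cst_sub _ _ _ _ (UPar _ _)).
    + apply: ty_annot_intro h3 (itv_incl_refl _ _); first by move=> b; exact: wf_delay_cst.
      by move=> b; exact: subusage_refl.
    + apply: ty_annot_intro h4 (itv_incl_refl _ _); first by move=> b; exact: wf_delay_cst.
      by move=> b; exact: subusage_refl.
    + apply: itv_incl_trans _ h6; apply: itv_incl_trans _ (add_cst_mono _ h5); index_arith.
  move=> [[wG w] [f1 [f2 [K1 [K2 [h1 [_ [f3 [K3 [h3 h4 h5]]]] [_ [f5 [K5 [h6 h7 h8]]]] h9]]]]]].
  have [_ w3] := ty_wf_env h4; have [_ w5] := ty_wf_env h7.
  apply: (@ty_annot_intro _ _ _ _ _ _ (fun b => UPar (f3 b) (f5 b)) (itv_sqcup K3 K5)) => //.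
  + by move=> b; apply: (SU_trans (h1 b)); exact: subusage_par.
  + apply: ty_par_intro h4 h7 (itv_incl_refl _ _) => //.
    by move=> b; exact: subusage_refl.
  + apply: itv_incl_trans _ h9; apply: itv_incl_trans _ (sqcup_incl h5 h8); index_arith.
(* Moving the restriction out of the annotation delays the type of the name, and moving it in
   removes the delay; [simrel_delay] and [simrel_undelay] keep that type reliable. *)
- move=> m P; split=> n Phi G f K.
    move=> [[wG w] [f1 [K1 [h1 [[_ w1] [T [hT h2]]] h3]]]].
    have /(wf_env_cat _ [:: T]) [wT [_ w1']] := ty_wf_env h2.
    have wT' : wf_type Phi T by inversion wT.
    have wU := wf_type_usage_of wT'; have wd := wf_delay_cst m wU.
    pose T' := set_usage (delay (CItv (itv_cst S n m)) (usage_of T)) T.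
    have eT : usage_of T' = delay (CItv (itv_cst S n m)) (usage_of T) by rewrite /T'; case: (T).
    have wT2 : wf_type Phi T' by apply: wf_type_set_usage.
    have hw g : (forall b, wf_usage Phi (g b)) -> wf_env Phi (T' :: G) (cat_usages [:: T'] g).
      by move=> wg; apply/(wf_env_cat _ [:: T']); split=> //; constructor=> //; constructor.
    apply: (@ty_nu_intro _ _ _ T').
      rewrite eT; apply: (simrel_reliable (simrel_delay Phi m)) hT; split=> //; exact: subusage_refl.
    apply: (@ty_annot_intro _ _ _ _ _ _ (cat_usages [:: T] f1) K1) => //.
    + exact: (hw f w).2.
    + move=> [|b]; rewrite /cat_usages /= ?subn1 ?eT //; exact: subusage_refl.
    + apply: (ty_same h2) => /=; first by rewrite /T' set_usage_set_usage.
        by split; [exact: (hw f w).1|exact: (ty_wf_env h2).2].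
      by move=> b; exact: subusage_refl.
  move=> [[wG w] [T [hT [[wTG wf] [f1 [K1 [h1 h2 h3]]]]]]].
  have [_ w1] := ty_wf_env h2.
  have [wT _] := (wf_ctx_cat _ [:: T] G).1 wTG.
  have wT' : wf_type Phi T by inversion wT.
  apply: (@ty_annot_intro _ _ _ _ _ _ (fun b => f1 b.+1) K1) => //.
    by move=> b; have := h1 b.+1; rewrite /cat_usages /= subn1.
  apply: ty_nu_intro (ty_head h2); apply: reliable_set_usage.
  apply: (simrel_reliable (simrel_undelay Phi m)) hT; split=> //; first exact: wf_type_usage_of.
  exact: (h1 0).
- move=> m p P; split=> n Phi G f K.
    move=> [[wG w] [f1 [K1 [h1 [[_ w1] [f2 [K2 [h2 h3 h4]]]] h5]]]].
    have [_ w2] := ty_wf_env h3.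
    apply: (ty_annot_intro w _ h3).
      move=> b; apply: (SU_trans (h1 b)); apply: SU_trans (delay_cst_sub m _ (h2 b)) _ => //.
      exact: delay_add_le.
    apply: itv_incl_trans _ h5; apply: itv_incl_trans _ (add_cst_mono m h4); index_arith.
  move=> [[wG w] [f1 [K1 [h1 h2 h3]]]]; have [_ w1] := ty_wf_env h2.
  apply: (@ty_annot_intro _ _ _ _ _ _ (fun b => delay (CItv (itv_cst S n p)) (f1 b)) (itv_add K1 (itv_cst S n p))) => //.
  + move=> b; apply: (SU_trans (h1 b)); exact: delay_add_ge.
  + apply: ty_annot_intro h2 (itv_incl_refl _ _); first by move=> b; exact: wf_delay_cst.
    by move=> b; exact: subusage_refl.
  + apply: itv_incl_trans _ h3; index_arith.
Qed.

End Congruence.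

(** * Subject reduction *)

Section Reduction.
Variable S : signature.

Definition update n (f : nat -> usage S n) a U b := if b == a then U else f b.

Lemma update_id n (f : nat -> usage S n) a : update f a (f a) = f.
Proof. by apply: functional_extensionality => b; rewrite /update; case: eqP => [->|]. Qed.

Lemma update_wf n (Phi : seq (constr S n)) f a U : (forall b, wf_usage Phi (f b)) ->
  wf_usage Phi U -> forall b, wf_usage Phi (update f a U b).
Proof. by move=> h hU b; rewrite /update; case: eqP. Qed.

(** Removes the constraint added for a branch of a [PMatch] once the reduction has shown it to be
    entailed. *)
Lemma ty_cut P n (Phi Phi' : seq (constr S n)) G f K :
  (forall rho, all (csat rho) Phi' -> all (csat rho) Phi) -> ty P Phi G f K -> ty P Phi' G f K.
Proof.
move=> h /(ty_isubst (val_mor_id h)).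
rewrite (eq_map (@tsubst_id S n)) map_id itv_subst_id.
by under [fun b => usage_subst _ _]functional_extensionality => b do rewrite usage_subst_id.
Qed.

Section Fixed.
Variables (n : nat) (Phi : seq (constr S n)).
Local Notation cst := (itv_cst S n).
Local Notation "U <<= V" := (subusage Phi U V) (at level 70).

(* A prefix of capacity [c] delayed by [p] that synchronizes with one delayed
   by [q] fires at time [max p q], which lies within the delay [p + c]. *)
Lemma delay_bound p q r c U : r = maxn p q ->
  itv_incl Phi (itv_add (cst q) (cst 0)) (itv_oplus (itv_add (cst p) (cst 0)) c) ->
  wf_cap Phi c -> wf_usage Phi U ->
  delay (CItv (cst p)) (delay c U) <<= delay (CItv (cst r)) U.
Proof.
move=> -> hc wc wU; rewrite delay_comp delayE; apply: map_obl_le => // A wA.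
rewrite /itv_shift /=; split; case: c hc wc => [J|B] hc wc; index_arith.
Qed.

(** The continuation starts at [maxn p q], which is at most [p] plus the upper end of [c]. A
    capacity with an infinite lower end is excluded, since [q] would have to be infinite. *)
Lemma cap_seq_bound p q r c K : r = maxn p q ->
  itv_incl Phi (itv_add (cst q) (cst 0)) (itv_oplus (itv_add (cst p) (cst 0)) c) ->
  itv_incl Phi (itv_add K (cst r)) (itv_add (cap_seq c K) (cst p)).
Proof. by move=> ->; case: c => [J|[[a|] J]] hc; rewrite /cap_seq; index_arith. Qed.

Lemma sqcup_cst_le p q r U : r = maxn p q -> wf_usage Phi U ->
  delay (CItv (itv_sqcup (itv_add (cst p) (cst 0)) (itv_add (cst q) (cst 0)))) U <<= delay (CItv (cst r)) U.
Proof. by move=> -> wU; apply: delay_itv_le => //; index_arith. Qed.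

Lemma add_sqcup_le K1 K2 p : itv_incl Phi (itv_add (itv_sqcup K1 K2) (cst p))
  (itv_sqcup (itv_add K1 (cst p)) (itv_add K2 (cst p))).
Proof. index_arith. Qed.

End Fixed.

(** A step of the process reduces the usage of at most one variable, so the new usages are an
    [update] of [f]. When no usage is reduced, [0] and [f 0] serve as dummy witnesses. *)
Lemma subject_reduction P Q : pstep P Q -> forall n (Phi : seq (constr S n)) G f K,
  ty P Phi G f K -> (forall b, reliable Phi (f b)) ->
  exists a U, usteps Phi (f a) U /\ ty Q Phi G (update f a U) K.
Proof.
elim=> {P Q}.
- move=> p q a k P P' es Q hes EP n Phi G f K [[wG w] h] hr.
  case: h => f1 [f2 [K1 [K2 [h1 hin hout hK]]]].
  case: hin => [[_ w1] [f3 [K3 [h3 hin hK3]]]].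
  case: hin => [[_ w3] [Ts [U [c [f4 [K4 [[ha ea sk wc] h4a h4b hP hK4]]]]]]].
  case: hout => [[_ w2] [f5 [K5 [h5 hout hK5]]]].
  case: hout => [[_ w5] [Ts2 [d [f6 [K6 [K7 [[_ eo ses wd] [hv h6a] h6b hQ hK7]]]]]]].
  rewrite ea /= in eo; case: eo => e1 e2; rewrite {}e1 {}e2 in ses hv h6a h6b hK7.
  have [_ w6] := ty_wf_env hQ; have /wf_env_cat [wTs [_ w4]] := ty_wf_env hP.
  have wu b : wf_usage Phi (args_usage es Ts b) by exact: args_usage_wf.
  pose fin b := UPar (f4 b) (UPar (args_usage es Ts b) (f6 b)).
  have wfin b : wf_usage Phi (fin b) by split=> //; split.
  pose A := itv_add (itv_cst S n p) (itv_cst S n 0); pose B := itv_add (itv_cst S n q) (itv_cst S n 0).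
  (* The usage of the subject with both prefixes exposed; their obligations are the annotations [p]
     and [q]. *)
  pose V := UPar (UAct AIn A c (f4 a)) (UAct AOut B d (UPar (args_usage es Ts a) (f6 a))).
  have faV : subusage Phi (f a) V.
    apply: (SU_trans (h1 a)); apply: subusage_par.
      apply: (SU_trans (h3 a)); exact: (delay_cst_sub p (w3 a) h4a).
    apply: (SU_trans (h5 a)); exact: (delay_cst_sub q (w5 a) h6a).
  have hs : sync V A c (f4 a) B d (UPar (args_usage es Ts a) (f6 a)) (UPar UZero UZero).
    by exists (UPar UZero (UAct AOut B d (UPar (args_usage es Ts a) (f6 a)))); constructor; constructor.
  have hc := reliable_sync (reliable_sub (w a) faV (hr a)) hs; have [hc1 hc2] := hc.
  (* The firing happens in [V]; as subusage is a simulation, [f a] reduces to a subusage of the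
     result. *)
  have [U' hU' [wU' hle]] := simrel_steps (simrel_sub Phi) (conj (w a) faV) (hr a) (sync_fire hs hc).
  exists a, U'; split=> //.
  have e1 : maxn q p = maxn p q by exact: maxnC.
  have wupd := update_wf a w wU'.
  apply: (@ty_annot_intro _ _ _ _ _ _ _ fin (itv_sqcup K4 K6)) => //.
  (* The subject has its reduced usage. Any other name keeps the old one, and there the annotation
     and the capacity together are bounded by the firing time, by [delay_bound]. *)
  + move=> b; rewrite /update; case: eqP => [->|hb].
      apply: (SU_trans hle); apply: SU_trans (subusage_parl _ _ _) _.
      exact: sqcup_cst_le.
    apply: (SU_trans (h1 b)); apply: subusage_par.
      apply: (SU_trans (h3 b)); apply: (SU_trans (delay_cst_sub p (w3 b) (h4b b hb))).
      exact: (delay_bound e1 hc1).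
    apply: (SU_trans (h5 b)); apply: (SU_trans (delay_cst_sub q (w5 b) (h6b b hb))).
    exact: (@delay_bound _ _ q p _ d (UPar _ _) _ hc2).
  + apply: (@ty_par_intro _ _ _ _ _ _ _ (fun b => UPar (args_usage es Ts b) (f4 b)) f6 K4 K6) => //.
    * move=> b; rewrite /fin; apply: ucong_sub.
      apply: UC_trans (UC_parA _ _ _) _; exact: UC_par (UC_parC _ _) (UC_refl _).
    * apply: (ty_einst hP ses EP hv); first by move=> b; split.
      by move=> b; exact: subusage_refl.
    * exact: itv_incl_refl.
  + apply: itv_incl_trans (add_sqcup_le _ _ _ _) _; apply: itv_incl_trans _ hK.
    apply: sqcup_incl.
      apply: itv_incl_trans (cap_seq_bound _ e1 hc1) _.
      exact: (itv_incl_trans (add_cst_mono p hK4) hK3).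
    apply: itv_incl_trans (cap_seq_bound _ (erefl _) hc2) _.
    exact: (itv_incl_trans (add_cst_mono q hK7) hK5).
- move=> p q a k P P' es Q hes EP n Phi G f K [[wG w] h] hr.
  case: h => f1 [f2 [K1 [K2 [h1 hin hout hK]]]].
  case: hin => [[_ w1] [f3 [K3 [h3 hin hK3]]]].
  case: hin => [[_ w3] [j [Ks [Ts0 [U [c [f4 [[ha ea sk wc] h4a h4b hP [w4 hK4]]]]]]]]].
  case: hout => [[_ w2] [f5 [K5 [h5 hout hK5]]]].
  case: hout => [[_ w5] [Ts [d [f6 [K6 [K7 [[_ eo ses wd] [hv h6a] h6b hQ hK7]]]]]]].
  rewrite ea /= in eo; case: eo => Is [eTs eK7].
  have wTs : wf_ctx Phi Ts.
    by apply: (@out_type_wf _ _ Phi G a K6 Ts K7 wG); rewrite ea; exists Is.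
  (* The body of the server is typed for arbitrary indices; the output fixes them to [Is]. *)
  have hP' : ty P Phi (Ts ++ G) (cat_usages Ts f4) (itv_subst (inst Is) Ks).
    have := ty_isubst (val_mor_inst Is (Phi := Phi)) hP.
    rewrite cat_usages_subst map_cat -eTs -map_comp (eq_map (g := id)); last by move=> T /=; exact: inst_wk.
    rewrite map_id; by under [fun b => usage_subst (inst Is) _]functional_extensionality => b do rewrite usage_inst_wk.
  have [_ w6] := ty_wf_env hQ.
  have wu b : wf_usage Phi (args_usage es Ts b) by exact: args_usage_wf.
  pose fin b := UPar (f4 b) (UPar (args_usage es Ts b) (f6 b)).
  have wfin b : wf_usage Phi (fin b) by split=> //; split.
  (* The usages that remain for the server itself under the annotation [p]: replication leaves them
     unchanged. *)
  pose f0 b := if b == a then URep (UAct AIn (itv_cst S n 0) c (f4 a)) else delay c (URep (f4 b)).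
  have w0 b : wf_usage Phi (f0 b).
    rewrite /f0; case: eqP => _; last exact: (@wf_delay _ _ _ _ (URep _)).
    by split=> //; exact: wf_itv_cst.
  pose A := itv_add (itv_cst S n p) (itv_cst S n 0); pose B := itv_add (itv_cst S n q) (itv_cst S n 0).
  pose X := UAct AIn A c (f4 a).
  pose V := UPar (URep X) (UAct AOut B d (UPar (args_usage es Ts a) (f6 a))).
  have faV : subusage Phi (f a) V.
    apply: (SU_trans (h1 a)); apply: subusage_par.
      apply: (SU_trans (h3 a)); exact: (delay_cst_sub p (w3 a) h4a).
    apply: (SU_trans (h5 a)); exact: (delay_cst_sub q (w5 a) h6a).
  have hs : sync V A c (f4 a) B d (UPar (args_usage es Ts a) (f6 a)) (UPar (UPar (URep X) UZero) UZero).
    exists (UPar (UPar (URep X) UZero) (UAct AOut B d (UPar (args_usage es Ts a) (f6 a)))).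
      by apply: WP_parl; apply: WP_rep; exact: WP_act.
    by apply: WP_parr; exact: WP_act.
  have hc := reliable_sync (reliable_sub (w a) faV (hr a)) hs; have [hc1 hc2] := hc.
  have [U' hU' [wU' hle]] := simrel_steps (simrel_sub Phi) (conj (w a) faV) (hr a) (sync_fire hs hc).
  exists a, U'; split=> //.
  have e1 : maxn q p = maxn p q by exact: maxnC.
  have wupd := update_wf a w wU'.
  apply: (@ty_par_intro _ _ _ _ _ _ _ (fun b => delay (CItv (itv_cst S n p)) (f0 b))
     (fun b => delay (CItv (itv_cst S n (maxn q p))) (fin b)) K1
     (itv_add (itv_sqcup (itv_subst (inst Is) Ks) K6) (itv_cst S n (maxn q p)))) => //.
  + move=> b; rewrite /update /f0; case: eqP => [->|hb].
      apply: (SU_trans hle); apply: (SU_trans (ucong_sub _ (UC_parC _ _))); apply: subusage_par.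
        apply: ucong_sub; apply: UC_trans (UC_par0 _) _; exact: UC_par0.
      exact: sqcup_cst_le.
    have d1 : subusage Phi (f1 b) (delay (CItv (itv_cst S n p)) (delay c (URep (f4 b)))).
      apply: (SU_trans (h3 b)); exact: (delay_cst_sub p (w3 b) (h4b b hb)).
    apply: (SU_trans (h1 b)).
    (* For a name other than the subject, one copy of its replicated usage is unfolded and pays for
       the body that has been started. *)
    apply: (@SU_trans _ _ _ _ (UPar (UPar (delay (CItv (itv_cst S n p)) (delay c (URep (f4 b))))
       (delay (CItv (itv_cst S n p)) (delay c (f4 b)))) (f2 b))).
      apply: SU_compat_par; apply: (SU_trans d1); apply: ucong_sub.
      exact: (delay_ucong _ (delay_ucong _ (UC_unfold _))).
    apply: (SU_trans (ucong_sub_r _ (UC_parA _ _ _))); apply: subusage_par (subusage_refl _ _) _.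
    apply: subusage_par; first exact: (delay_bound e1 hc1).
    apply: (SU_trans (h5 b)); apply: (SU_trans (delay_cst_sub q (w5 b) (h6b b hb))).
    exact: (@delay_bound _ _ q p _ d (UPar _ _) _ hc2).
  + apply: (@ty_annot_intro _ _ _ _ _ _ _ f0 K3) => //.
    * by move=> b; exact: wf_delay_cst.
    * by move=> b; exact: subusage_refl.
    * split=> //; exists j, Ks, Ts0, U, c, f4; split=> //.
        by rewrite /f0 eqxx; exact: subusage_refl.
      by move=> b hb; rewrite /f0; case: eqP => // _; exact: subusage_refl.
  + apply: (@ty_annot_intro _ _ _ _ _ _ _ fin (itv_sqcup (itv_subst (inst Is) Ks) K6)) => //.
    * by move=> b; exact: wf_delay_cst.
    * by move=> b; exact: subusage_refl.
    * apply: (@ty_par_intro _ _ _ _ _ _ _ (fun b => UPar (args_usage es Ts b) (f4 b)) f6 (itv_subst (inst Is) Ks) K6) => //.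
      - move=> b; rewrite /fin; apply: ucong_sub.
        apply: UC_trans (UC_parA _ _ _) _; exact: UC_par (UC_parC _ _) (UC_refl _).
      - apply: (ty_einst hP' ses EP hv); first by move=> b; split.
        by move=> b; exact: subusage_refl.
      - exact: itv_incl_refl.
    * exact: itv_incl_refl.
  + apply: itv_incl_trans _ hK; apply: sqcup_incl; first exact: itv_incl_refl.
    apply: itv_incl_trans (add_cst_mono _ (sqcupC_incl _ _ _)) _; rewrite -eK7.
    apply: itv_incl_trans (cap_seq_bound _ (erefl _) hc2) _.
    exact: (itv_incl_trans (add_cst_mono q hK7) hK5).
(* [ty] has the same clause for [PTick P] and for [PAnnot 1 P]. *)
- move=> P n Phi G f K h _; exists 0, (f 0); split; first exact: rt_refl.
  by rewrite update_id.
(* That [EZero] has type [TNat J1 J2] entails [J1 <= 0], the constraint under which the branch is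
   typed. *)
- move=> P Q n Phi G f K [w [wK [J1 [J2 [/subtype_inv hv h _]]]]] _.
  exists 0, (f 0); split; first exact: rt_refl.
  rewrite update_id; apply: ty_cut h => rho hrho; rewrite /= hrho andbT.
  by case: hv => I' [J' [[-> _] h1 _]]; exact: h1.
(* The inclusion of [[I1 + 1, I2 + 1]] in [[J1, J2]] gives both [1 <= J2], the constraint of the
   branch, and the bounds [[J1 - 1, J2 - 1]] for the predecessor. *)
- move=> e P Q Q' EQ n Phi G f K [[wG w] [wK [J1 [J2 [[I1 [I2 [hv /subtype_inv hs]]] _ h]]]]] _.
  case: hs => I' [J' [[eI eJ] h1 h2]]; rewrite -{}eI -{}eJ {I' J'} in h1 h2.
  exists 0, (f 0); split; first exact: rt_refl.
  have hJ2 : entails Phi (ile (icst S n 1) J2) by index_arith.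
  rewrite update_id; apply: (ty_einst (Ts := [:: TNat (ipred J1) (ipred J2)]) (f := f) _ _ EQ) => //.
  + apply: ty_cut h => rho hrho; rewrite /= hrho andbT; exact: hJ2.
  + move=> [|i] //= _; apply: (expr_ok_skel hv); constructor; index_arith.
  + move=> b; apply: SU_trans (ucong_sub_r _ (UPar0l _)) _.
    apply: subusage_par (subusage_refl _ _); rewrite /args_usage /= contrib_zero.
    exact/ucong_sub_r/UC_par0.
- move=> P P' Q _ IH n Phi G f K [[wG w] [f1 [f2 [K1 [K2 [h1 hP hQ hK]]]]]] hr.
  have [_ w1] := ty_wf_env hP.
  have r1 b : reliable Phi (f1 b).
    apply: reliable_sub (hr b) => //; exact: SU_trans (h1 b) (subusage_parl _ _ _).
  have [a [U1 [hU1 hP']]] := IH _ _ _ _ _ hP r1.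
  have [U' hU' [wU' hle]] := simrel_steps (simrel_sub Phi) (conj (w a) (h1 a)) (hr a) (usteps_parl (f2 a) hU1).
  exists a, U'; split=> //; apply: (ty_par_intro _ _ hP' hQ hK); first exact: update_wf.
  by move=> b; rewrite /update; case: eqP => [->|_].
- move=> P P' _ IH n Phi G f K [[wG w] [T [hT h]]] hr.
  have r1 b : reliable Phi (cat_usages [:: T] f b) by rewrite /cat_usages; case: b => [|b] //=.
  (* Variable 0 is the restricted name: its reduction is absorbed by its own type, which stays
     reliable, and the outer context does not move. *)
  have [[|a] [U1 [hU1 hP']]] := IH _ _ _ _ _ h r1.
    exists 0, (f 0); split; first exact: rt_refl.
    rewrite update_id; apply: ty_nu_intro (_ : ty P' Phi (set_usage U1 T :: G) _ K).
      apply: reliable_set_usage; exact: reliable_usteps hU1 hT.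
    have := ty_head hP'; congr ty.
    by apply: functional_extensionality => -[|b] //; rewrite /cat_usages /update /= !subn1.
  exists a, U1; split; first by move: hU1; rewrite /cat_usages /= subn1.
  apply: (ty_nu_intro hT); move: hP'; congr ty.
  apply: functional_extensionality => -[|b] //; by rewrite /cat_usages /update /= !subn1.
- move=> p P P' _ IH n Phi G f K [[wG w] [f1 [K1 [h1 hP hK]]]] hr.
  have [_ w1] := ty_wf_env hP.
  have hd b := And3 (w b) (w1 b) (h1 b).
  have r1 b : reliable Phi (f1 b) := simrel_reliable (simrel_undelay Phi p) (hd b) (hr b).
  have [a [U1 [hU1 hP']]] := IH _ _ _ _ _ hP r1.
  have [U' hU' [wU' _ hle]] := simrel_steps (simrel_undelay Phi p) (hd a) (hr a) hU1.
  exists a, U'; split=> //; apply: (ty_annot_intro _ _ hP' hK); first exact: update_wf.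
  by move=> b; rewrite /update; case: eqP.
- move=> P P1 Q1 Q eP _ IH eQ n Phi G f K h0 hr.
  have h := (pcong_imp S eP).1 _ _ _ _ _ h0.
  have [a [U [hU h']]] := IH _ _ _ _ _ h hr.
  by exists a, U; split=> //; apply: (pcong_imp S eQ).1.
Qed.

(** [ctx_steps] changes a channel or a server only. If [a] is out of range or has type [TNat], the
    update is invisible after [assign] and the context does not move. *)
Lemma assign_update_steps n (Phi : seq (constr S n)) (G : ctx S n) a U :
  usteps Phi (usages G a) U -> ctx_steps Phi G (assign G (update (usages G) a U)).
Proof.
move=> h; case: (ltnP a (size G)) => ha; last first.
  rewrite (_ : assign _ _ = G); first exact: CS_refl.
  rewrite -[RHS]assign_usages /assign /mkseq; apply/eq_in_map => i; rewrite mem_iota add0n /= => hi.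
  by rewrite /update; case: eqP => // e; move: hi; rewrite e ltnNge ha.
have -> : assign G (update (usages G) a U) = ins a (set_usage U (nth (nat0 S n) G a)) (del a G).
  apply: (@eq_from_nth _ (nat0 S n)).
    rewrite size_assign size_ins size_del //; lia.
  move=> i; rewrite size_assign => hi; rewrite nth_assign // nth_ins_del // /update.
  case: eqP => [->|_] //; rewrite /usages; by case: (nth _ _ _).
rewrite -{1}(ins_del ha); move: h; rewrite /usages.
have hsz : a <= size (del a G) by rewrite size_del //; lia.
case: (nth _ _ _) => [J1 J2|Ts V|k K Ts V] /= h; [exact: CS_refl|exact: CS_ch|exact: CS_serv].
Qed.

Lemma reliable_usages n (Phi : seq (constr S n)) (G : ctx S n) :
  reliable_ctx Phi G -> forall b, reliable Phi (usages G b).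
Proof.
move=> /ForallP h b; rewrite /usages; case: (ltnP b (size G)) => hb; last first.
  rewrite nth_default //; exact: reliable_zero.
by have := h b hb; case: (nth _ _ _) => //= *; exact: reliable_zero.
Qed.

End Reduction.

Theorem mainTheorem2 (S : signature) (phi : nat) (Phi : seq (constr S phi))
    (Gamma : ctx S phi) (P Q : proc) (K : itv S phi)
    (Gamma_P : typing Phi Gamma P K)
    (Gamma_reliable : reliable_ctx Phi Gamma)
    (P_Q : pstep P Q) :
  exists Gamma' : ctx S phi, ctx_steps Phi Gamma Gamma' /\ typing Phi Gamma' Q K.
Proof.
have [a [U [hU hQ]]] := subject_reduction P_Q (typing_ty Gamma_P) (reliable_usages Gamma_reliable).
exists (assign Gamma (update (usages Gamma) a U)); split; first exact: assign_update_steps.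
exact: ty_typing.
Qed.
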